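(* For every monotone differential-henselian valued differential field $F$ there exist a linearly surjective differential field $\boldsymbol{k}$, an ordered abelian group $\Gamma$, and an additive map $c:\Gamma\to\boldsymbol{k}$ such that $F$ is elementarily equivalent, as a valued differential field, to $K_c=\boldsymbol{k}((t^\Gamma))_c$.
   Context: All differential fields have characteristic $0$ and a single distinguished derivation, written $f\mapsto f'$. A valued differential field is a differential field $F$ together with a (Krull) valuation $v:F^\times\to v(F^\times)$ whose residue field has characteristic $0$; $\mathcal{O}$ is its valuation ring and $\mathfrak{m}$ the maximal ideal of $\mathcal{O}$. $F$ is monotone if $v(f')\ge v(f)$ for all $f\in F$. If $F$ is monotone, then its derivation is small, i.e. $\mathfrak{m}'\subseteq\mathfrak{m}$, and also $\mathcal{O}'\subseteq\mathcal{O}$, so the residue field $\mathcal{O}/\mathfrak{m}$ becomes a differential field with the induced derivation. A valued differential field with small derivation is differential-henselian if every differential polynomial $P\in\mathcal{O}\{Y\}=\mathcal{O}[Y,Y',Y'',\dots]$ whose reduction $\overline{P}\in(\mathcal{O}/\mathfrak{m})\{Y\}$ has total degree $1$ has a zero in $\mathcal{O}$. A differential field $\boldsymbol{k}$ with derivation $\partial$ is linearly surjective if for every nonzero linear differential operator $A=a_0+a_1\partial+\dots+a_n\partial^n$ over $\boldsymbol{k}$ we have $A(\boldsymbol{k})=\boldsymbol{k}$. For a differential field $\boldsymbol{k}$ with derivation $\partial$, an ordered abelian group $\Gamma$, and an additive map $c:\Gamma\to\boldsymbol{k}$, $\boldsymbol{k}((t^\Gamma))_c$ is the Hahn field $\boldsymbol{k}((t^\Gamma))$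 with its usual valuation and the derivation $\partial_c\big(\sum_\gamma a_\gamma t^\gamma\big)=\sum_\gamma\big(\partial(a_\gamma)+c(\gamma)a_\gamma\big)t^\gamma$. Elementary equivalence is in the first-order language of valued differential fields (ring language with symbols for the derivation and the valuation, e.g. a predicate for the valuation ring). *)

(* Defs.v *)
From HB Require Import structures.
From mathcomp Require Import all_boot all_order all_algebra ring_quotient generic_quotient.
From mathcomp Require Import mpoly.
From mathcomp Require Import boolp classical_sets functions cardinality fsbigop.

Set Implicit Arguments.
Unset Strict Implicit.
Unset Printing Implicit Defensive.

Import Order.TTheory GRing.Theory Num.Theory.

Local Open Scope classical_set_scope.
Local Open Scope ring_scope.

HB.mixin Record isOrderedAbelianGroup G of Num.POrderedZmodule G := {
  oag_leD2r_subproof : forall z x y : G, x <= y -> x + z <= y + z;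
  oag_le_total : forall x y : G, (x <= y) || (y <= x)
}.

(* Not stated as a join with Order.Total: Hierarchy Builder rejects such a join
   once realDomainType is declared. *)
#[short(type="oagType")]
HB.structure Definition OrderedAbelianGroup :=
  { G of Num.POrderedZmodule G & isOrderedAbelianGroup G }.

Section OrderedAbelianGroupTheory.
Variable G : oagType.
Implicit Types x y z t : G.

Lemma oag_comparable x y : x >=< y.
Proof. exact: oag_le_total. Qed.

Lemma oag_ltNge x y : (x < y) = ~~ (y <= x).
Proof. by rewrite comparable_ltNge ?oag_comparable. Qed.

Lemma oag_leNgt x y : (x <= y) = ~~ (y < x).
Proof. by rewrite oag_ltNge negbK. Qed.

Lemma oag_neq_lt x y : (x != y) = (x < y) || (y < x).
Proof.
by case: (comparable_ltgtP (oag_comparable x y)) => // ->; rewrite ltxx.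
Qed.

Lemma oag_le_min z x y : (z <= Num.min x y) = (z <= x) && (z <= y).
Proof. by rewrite comparable_le_min ?oag_comparable. Qed.

Lemma oag_lt_min z x y : (z < Num.min x y) = (z < x) && (z < y).
Proof. by rewrite comparable_lt_min ?oag_comparable. Qed.

Lemma oag_leD2r z x y : (x + z <= y + z) = (x <= y).
Proof.
apply/idP/idP; last exact: oag_leD2r_subproof.
by move/(oag_leD2r_subproof (- z)); rewrite !addrK.
Qed.

Lemma oag_leD2l z x y : (z + x <= z + y) = (x <= y).
Proof. by rewrite ![z + _]addrC oag_leD2r. Qed.

Lemma oag_ltD2r z x y : (x + z < y + z) = (x < y).
Proof. by rewrite !oag_ltNge oag_leD2r. Qed.

Lemma oag_ltD2l z x y : (z + x < z + y) = (x < y).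
Proof. by rewrite !oag_ltNge oag_leD2l. Qed.

Lemma oag_leD x y z t : x <= y -> z <= t -> x + z <= y + t.
Proof. by move=> xy zt; apply: (le_trans (y := y + z));
  rewrite ?oag_leD2r ?oag_leD2l. Qed.

Lemma oag_ltleD x y z t : x < y -> z <= t -> x + z < y + t.
Proof. by move=> xy zt; apply: (lt_le_trans (y := y + z));
  rewrite ?oag_ltD2r ?oag_leD2l. Qed.

Lemma oag_le_subLR x y z : (x - y <= z) = (x <= z + y).
Proof. by rewrite -(oag_leD2r y (x - y)) subrK. Qed.

Lemma oag_le_subRL x y z : (x <= y - z) = (x + z <= y).
Proof. by rewrite -(oag_leD2r z x) subrK. Qed.

Lemma oag_double_eq0 x : x + x = 0 -> x = 0.
Proof.
move=> xx0; case: (comparable_ltgtP (oag_comparable x 0)) => // x0.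
  by have := oag_ltleD x0 (ltW x0); rewrite xx0 addr0 ltxx.
by have := oag_ltleD x0 (ltW x0); rewrite xx0 addr0 ltxx.
Qed.

End OrderedAbelianGroupTheory.

Definition is_derivation (R : nzRingType) (d : R -> R) : Prop :=
  (forall x y, d (x + y) = d x + d y) /\
  (forall x y, d (x * y) = d x * y + x * d y).

Record diffField := DiffField {
  df_sort :> fieldType;
  der : df_sort -> df_sort;
  derP : is_derivation der;
  df_pchar0 : [pchar df_sort] =i pred0
}.

Arguments der {d}.

(* [A] only records the coefficients a_0, ..., a_n of the operator
   a_0 + a_1 der + ... + a_n der^n; the product of {poly k} plays no role. *)
Definition lin_diff_op (k : diffField) (A : {poly k}) (y : k) : k :=
  \sum_(i < size A) A`_i * iter i der y.

Definition linearly_surjective (k : diffField) : Prop :=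
  forall A : {poly k}, A != 0 -> forall b : k, exists y, lin_diff_op A y = b.

(* A valuation onto the ordered abelian group [vgroup]; the value of [vval]
   at 0, which should be infinite, is irrelevant. *)
Record valuation (F : fieldType) := Valuation {
  vgroup : oagType;
  vval :> F -> vgroup;
  valM : forall x y, x != 0 -> y != 0 -> vval (x * y) = vval x + vval y;
  valD : forall x y, x != 0 -> y != 0 -> x + y != 0 ->
    Num.min (vval x) (vval y) <= vval (x + y);
  val_surj : forall g, exists2 x, x != 0 & vval x = g
}.

Section ValuationRing.
Variables (F : fieldType) (v : valuation F).

(* v x <= v y, with v 0 infinite *)
Definition val_le (x y : F) : bool := (y == 0) || (x != 0) && (v x <= v y).

Definition valring_pred : {pred F} := fun x => (x == 0) || (0 <= v x).
Definition maxideal_pred : {pred F} := fun x => (x == 0) || (0 < v x).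

Lemma val1 : v 1 = 0.
Proof.
have := valM v (oner_neq0 F) (oner_neq0 F).
by rewrite mulr1 => /(congr1 (fun z => z - v 1)); rewrite subrr addrK.
Qed.

Lemma valN1 : v (-1) = 0.
Proof.
have N10 : (-1 : F) != 0 by rewrite oppr_eq0 oner_neq0.
by apply: oag_double_eq0; rewrite -(valM v N10 N10) mulrNN mulr1 val1.
Qed.

Lemma valN x : v (- x) = v x.
Proof.
have [->|x0] := eqVneq x 0; first by rewrite oppr0.
by rewrite -mulN1r valM ?oppr_eq0 ?oner_neq0// valN1 add0r.
Qed.

Lemma valring_subring : subring_closed valring_pred.
Proof.
split=> [|x y|x y]; rewrite !unfold_in.
- by rewrite val1 lexx orbT.
- have [->|x0] /= := eqVneq x 0; first by rewrite sub0r oppr_eq0 valN.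
  have [->|y0] /= := eqVneq y 0; first by rewrite subr0 (negbTE x0).
  move=> vx vy; have [//|xy0] /= := eqVneq (x - y) 0.
  apply: le_trans (valD v x0 _ xy0); last by rewrite oppr_eq0.
  by rewrite oag_le_min valN vx.
- have [->|x0] /= := eqVneq x 0; first by rewrite mul0r eqxx.
  have [->|y0] /= := eqVneq y 0; first by rewrite mulr0 eqxx.
  by move=> vx vy; have := oag_leD vx vy;
  rewrite addr0 valM// => ->; rewrite orbT.
Qed.

HB.instance Definition _ :=
  GRing.isSubringClosed.Build F valring_pred valring_subring.

Record valring := ValRing { valring_val :> F; _ : valring_val \in valring_pred }.

HB.instance Definition _ := [isSub for valring_val].
HB.instance Definition _ := [Choice of valring by <:].
HB.instance Definition _ := [SubChoice_isSubComNzRing of valring by <:].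

Definition maxideal : {pred valring} := fun x => val x \in maxideal_pred.

Lemma maxideal_idealr : idealr_closed maxideal.
Proof.
split=> [||a x y]; rewrite !unfold_in /=.
- by rewrite eqxx.
- by rewrite oner_eq0 val1 ltxx.
case: a x y => [a Va] [x Vx] [y Vy] /=; move: Va; rewrite unfold_in.
have [->|a0] /= := eqVneq a 0; first by rewrite mul0r add0r.
have [->|x0] /= := eqVneq x 0; first by rewrite mulr0 add0r.
have ax0 : a * x != 0 by rewrite mulf_neq0.
move=> va vx; have vax : 0 < v (a * x).
  by have := oag_ltleD vx va; rewrite addr0 [v x + _]addrC -valM.
have [->|y0] /= := eqVneq y 0; first by rewrite addr0 vax orbT.
move=> vy; have [//|s0] /= := eqVneq (a * x + y) 0.
by apply: lt_le_trans (valD v ax0 y0 s0); rewrite oag_lt_min vax.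
Qed.

HB.instance Definition _ := isIdealr.Build valring maxideal maxideal_idealr.

Definition residue := {ideal_quot maxideal}.
HB.instance Definition _ := GRing.ComNzRing.on residue.

Definition reduction : valring -> residue := \pi_(residue)%qT.

End ValuationRing.

Record valuedDiffField := ValuedDiffField {
  vdf_sort :> diffField;
  vdf_val : valuation vdf_sort;
  vdf_res_pchar0 : [pchar (residue vdf_val)] =i pred0
}.

Definition monotone (F : valuedDiffField) : Prop :=
  forall f : F, val_le (vdf_val F) f (der f).

Definition small_derivation (F : valuedDiffField) : Prop :=
  forall f : F, f \in maxideal_pred (vdf_val F) ->
    der f \in maxideal_pred (vdf_val F).

(* A differential polynomial of order < n over the valuation ring is an element
   P of {mpoly (valring _)[n]}, 'X_i standing for the i-th derivative of Y.
   [msize] is one more than the total degree. *)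
Definition diff_henselian (F : valuedDiffField) : Prop :=
  small_derivation F /\
  forall (n : nat) (P : {mpoly (valring (vdf_val F))[n]}),
    msize (map_mpoly (@reduction F (vdf_val F)) P) = 2%N ->
    exists2 y : F, y \in valring_pred (vdf_val F) &
      (map_mpoly (@valring_val F (vdf_val F)) P).@[fun i => iter i der y] = 0.

(* First-order formulas, with free variables indexed by 'I_n, in the language of
   rings with a unary function symbol for the derivation and a unary predicate
   symbol for the valuation ring. *)
Inductive term (n : nat) : Type :=
| TVar of 'I_n
| TZero
| TOne
| TAdd of term n & term n
| TOpp of term n
| TMul of term n & term n
| TDer of term n.

Inductive formula : nat -> Type :=
| FEq n of term n & term n : formula n
| FVal n of term n : formula n
| FNot n of formula n : formula n
| FAnd n of formula n & formula n : formula n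
| FEx n of formula n.+1 : formula n.

Section Satisfaction.
Variable F : valuedDiffField.

Fixpoint teval n (e : 'I_n -> F) (t : term n) : F :=
  match t with
  | TVar i => e i
  | TZero => 0
  | TOne => 1
  | TAdd t1 t2 => teval e t1 + teval e t2
  | TOpp t1 => - teval e t1
  | TMul t1 t2 => teval e t1 * teval e t2
  | TDer t1 => der (teval e t1)
  end.

(* the quantified variable is variable 0 *)
Definition env_cons n (x : F) (e : 'I_n -> F) : 'I_n.+1 -> F :=
  fun i => if unlift ord0 i is Some j then e j else x.

Fixpoint holds n (p : formula n) : ('I_n -> F) -> Prop :=
  match p with
  | FEq _ t1 t2 => fun e => teval e t1 = teval e t2
  | FVal _ t => fun e => teval e t \in valring_pred (vdf_val F)
  | FNot _ q => fun e => ~ holds q e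
  | FAnd _ q r => fun e => holds q e /\ holds r e
  | FEx _ q => fun e => exists x, holds q (env_cons x e)
  end.

End Satisfaction.

Definition sentence := formula 0.

Definition models (F : valuedDiffField) (p : sentence) : Prop :=
  holds p (fun i : 'I_0 => (0 : F)).

Definition elementarily_equivalent (F K : valuedDiffField) : Prop :=
  forall p : sentence, models F p <-> models K p.

Section WellOrderedSets.
Variable G : oagType.
Implicit Types A B C : set G.

Definition well_ordered A : Prop :=
  forall B, B `<=` A -> B !=set0 -> exists2 m, B m & forall x, B x -> m <= x.

Lemma well_orderedS A B : A `<=` B -> well_ordered B -> well_ordered A.
Proof. by move=> AB wB C CA; apply: wB => x /CA /AB. Qed.

Lemma well_ordered0 : well_ordered (set0 : set G).
Proof. by move=> B sB [x /sB]. Qed.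

Lemma well_ordered1 (a : G) : well_ordered [set a].
Proof.
by move=> B sB [x Bx]; exists x => // y /sB ->; rewrite (sB _ Bx).
Qed.

Lemma well_orderedU A B :
  well_ordered A -> well_ordered B -> well_ordered (A `|` B).
Proof.
move=> wA wB C sC [x0 Cx0].
have [[a0 [Ca0 Aa0]]|nA] := pselect (C `&` A !=set0); last first.
  apply: wB; last by exists x0.
  by move=> x Cx; case: (sC _ Cx) => // Ax; case: nA; exists x.
have [a [Ca Aa] amin] : exists2 m, (C `&` A) m & forall x, (C `&` A) x -> m <= x.
  by apply: wA; [move=> x [] | exists a0].
have [[b0 [Cb0 Bb0]]|nB] := pselect (C `&` B !=set0); last first.
  exists a => // x Cx; case: (sC _ Cx) => [Ax|Bx]; first exact: amin.
  by case: nB; exists x.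
have [b [Cb Bb] bmin] : exists2 m, (C `&` B) m & forall x, (C `&` B) x -> m <= x.
  by apply: wB; [move=> x [] | exists b0].
have [ab|ba] := orP (oag_le_total a b).
  exists a => // x Cx; case: (sC _ Cx) => [Ax|Bx]; first exact: amin.
  by apply: (le_trans ab); apply: bmin.
exists b => // x Cx; case: (sC _ Cx) => [Ax|Bx]; last exact: bmin.
by apply: (le_trans ba); apply: amin.
Qed.

Definition sumset A B : set G := [set x | exists a b, [/\ A a, B b & x = a + b]].

Lemma well_ordered_sumset A B :
  well_ordered A -> well_ordered B -> well_ordered (sumset A B).
Proof.
move=> wA wB.
pose has_min C := exists2 m, C m & forall x, C x -> m <= x.
pose wf_below a := forall C, C !=set0 ->
  C `<=` sumset [set a' | A a' /\ a' < a] B -> has_min C.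
have step A' : A' `<=` A -> (forall a, A' a -> wf_below a) ->
    forall C, C !=set0 -> C `<=` sumset A' B -> has_min C.
  move=> sA' wfA' C [x0 Cx0] sC.
  pose Bs := [set b | B b /\ exists2 a, A' a & C (a + b)].
  have [b [Bb [a A'a Cab]] bmin] : has_min Bs.
    apply: wB; first by move=> x [].
    have [a' [b' [A'a' Bb' E]]] := sC _ Cx0.
    by exists b'; split=> //; exists a' => //; rewrite -E.
  have [C'0|C'n] := pselect ((C `&` [set x | x < a + b]) !=set0); last first.
    exists (a + b) => // x Cx; rewrite oag_leNgt; apply/negP => lx.
    by apply: C'n; exists x.
  have [|m [Cm /= lm] mmin] := wfA' a A'a _ C'0.
    move=> x [Cx /= lx]; have [a2 [b2 [A'a2 Bb2 E]]] := sC _ Cx.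
    exists a2, b2; split=> //; split; first exact: sA'.
    have bb2 : b <= b2.
      by apply: bmin; split=> //; exists a2 => //; rewrite -E.
    rewrite oag_ltNge; apply/negP => a12.
    by have := oag_leD a12 bb2; rewrite -E oag_leNgt lx.
  exists m => // x Cx; have [lx|] := boolP (x < a + b); first exact: mmin.
  by rewrite -oag_leNgt; apply: le_trans; apply: ltW.
have wfA a0 : A a0 -> wf_below a0.
  move=> Aa0; apply: contrapT => nwf.
  have [a [Aa bada] amin] : has_min [set a | A a /\ ~ wf_below a].
    by apply: wA; [move=> x [] | exists a0].
  apply: bada; apply: step => [x []|a' [Aa' a'a]] //; apply: contrapT => bada'.
  by have := amin a' (conj Aa' bada'); rewrite oag_leNgt a'a.
by move=> C sC C0; apply: (step A).
Qed.

Lemma well_ordered_fiber A B (c : G) : well_ordered A -> well_ordered B ->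
  finite_set [set a | A a /\ B (c - a)].
Proof.
move=> wA wB; set W := [set a | _]; apply: contrapT => infW.
have maxW C : C `<=` W -> C !=set0 -> exists2 m, C m & forall x, C x -> x <= m.
  move=> sC [x0 Cx0].
  have [||y /= Cy ymin] := wB [set y | C (c - y)].
  - by move=> y /= /sC[_]; rewrite opprB addrC subrK.
  - by exists (c - x0); rewrite /= opprB addrC subrK.
  exists (c - y) => // x Cx; rewrite oag_le_subRL addrC -oag_le_subRL.
  by apply: ymin; rewrite /= opprB addrC subrK.
have minW C : C `<=` W -> C !=set0 -> exists2 m, C m & forall x, C x -> m <= x.
  by move=> sC; apply: wA => x /sC[].
have W0 : W !=set0.
  by apply/set0P; apply/negP => /eqP W0; apply: infW; rewrite W0.
pose S := [set x | W x /\ ~ finite_set [set y | W y /\ y <= x]].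
have [|M WM Mmax] := maxW W _ W0; first by [].
have [s [Ws infs] smin] : exists2 m, S m & forall x, S x -> m <= x.
  apply: minW; first by move=> x [].
  exists M; split=> //; apply: contra_not infW; apply: sub_finite_set.
  by move=> x Wx; split=> //; apply: Mmax.
apply: infs.
have sU : [set y | W y /\ y <= s] `<=` [set s] `|` [set y | W y /\ y < s].
  move=> y [Wy]; rewrite le_eqVlt => /orP[/eqP ->|ys]; first by left.
  by right.
apply: (sub_finite_set sU); rewrite finite_setU; split; first exact: finite_set1.
have [lt0|nlt0] := pselect ([set y | W y /\ y < s] !=set0); last first.
  suff -> : [set y | W y /\ y < s] = set0 by [].
  by apply: contrapT => /eqP /set0P.
have [|t [Wt ts] tmax] := maxW _ _ lt0; first by move=> y [].
have /not_andP[//|/contrapT] : ~ S t.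
  by move=> /smin; rewrite oag_leNgt ts.
by apply: sub_finite_set => y [Wy ys]; split=> //; apply: tmax.
Qed.

End WellOrderedSets.

Section HahnSeries.
Variables (k : fieldType) (G : oagType).

Definition supp (f : G -> k) : set G := [set a | f a != 0].

Definition hahn_pred : {pred (G -> k)} := fun f => `[< well_ordered (supp f) >].

Lemma hahn_zmod : zmod_closed hahn_pred.
Proof.
split=> [|f g /asboolP wf /asboolP wg]; apply/asboolP.
  by apply: well_orderedS (@well_ordered0 G) => a; rewrite /supp /= eqxx.
apply: well_orderedS (well_orderedU wf wg) => a.
rewrite /supp /= -[(f - g) a]/(f a - g a).
have [->|fa] := eqVneq (f a) 0; last by left.
by rewrite sub0r oppr_eq0; right.
Qed.

HB.instance Definition _ := GRing.isZmodClosed.Build (G -> k) hahn_pred hahn_zmod.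

(* Addition of Hahn series is inherited from pointwise addition in G -> k. *)
Record hahn := Hahn { hcoef :> G -> k; _ : hcoef \in hahn_pred }.

HB.instance Definition _ := [isSub for hcoef].
HB.instance Definition _ := [Choice of hahn by <:].
HB.instance Definition _ := [SubChoice_isSubZmodule of hahn by <:].

Implicit Types f g h : hahn.

Lemma hahnP f : well_ordered (supp f).
Proof. exact/asboolP/(valP f). Qed.

Lemma hahn_eqP f g : f =1 g -> f = g.
Proof. by move=> fg; apply: val_inj; apply/funext. Qed.

Lemma hcoef0 a : (0 : hahn) a = 0. Proof. by []. Qed.
Lemma hcoefD f g a : (f + g) a = f a + g a. Proof. by []. Qed.
Lemma hcoefN f a : (- f) a = - f a. Proof. by []. Qed.

Lemma hmono_subproof (b : G) (x : k) :
  (fun a => if a == b then x else 0) \in hahn_pred.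
Proof.
apply/asboolP; apply: well_orderedS (@well_ordered1 G b) => a.
by rewrite /supp /=; have [//|] := eqVneq a b; rewrite eqxx.
Qed.

Definition hmono (b : G) (x : k) : hahn := Hahn (hmono_subproof b x).

Lemma hcoef_mono b x a : hmono b x a = if a == b then x else 0.
Proof. by []. Qed.

(* The sum is over all pairs of exponents adding up to c; by [finite_conv] only
   finitely many terms are nonzero. *)
Definition conv (f g : G -> k) (c : G) : k :=
  \sum_(a \in [set: G]) f a * g (c - a).

Lemma finite_conv f g c : finite_set [set a | supp f a /\ supp g (c - a)].
Proof. exact: well_ordered_fiber (@hahnP f) (@hahnP g). Qed.

Lemma fsum_sub (D : set G) (F : G -> k) : (forall a, F a != 0 -> D a) ->
  \sum_(a \in [set: G]) F a = \sum_(a \in D) F a.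
Proof.
move=> FD; apply/esym/fsbig_widen => // a [_ Da] /=.
by apply/eqP; apply: contra_notT Da => /FD.
Qed.

Lemma fsum1 (b : G) (F : G -> k) : (forall a, a != b -> F a = 0) ->
  \sum_(a \in [set: G]) F a = F b.
Proof.
move=> Fb; rewrite (@fsum_sub [set b]) ?fsbig_set1// => a /=.
by apply: contra_neq_eq => /Fb.
Qed.

Lemma conv_subproof f g : conv f g \in hahn_pred.
Proof.
apply/asboolP; apply: well_orderedS (well_ordered_sumset (@hahnP f) (@hahnP g)).
move=> c /= fgc; apply: contrapT => nc; move/negP: fgc; apply.
apply/eqP; apply: fsbig1 => a _; apply/eqP; rewrite mulf_eq0.
apply: contra_notT nc; rewrite negb_or => /andP[fa ga].
by exists a, (c - a); split=> //; rewrite addrC subrK.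
Qed.

Definition hmul f g : hahn := Hahn (conv_subproof f g).

Lemma conv_sub f g c (D : set G) :
  [set a | supp f a /\ supp g (c - a)] `<=` D ->
  hmul f g c = \sum_(a \in D) f a * g (c - a).
Proof.
move=> sD; apply: fsum_sub => a; rewrite mulf_eq0 negb_or => /andP[fa ga].
exact: sD.
Qed.

Lemma hmulC : commutative hmul.
Proof.
move=> f g; apply: hahn_eqP => c /=; rewrite /conv.
rewrite (reindex_fsbigT (fun a => c - a)).
  by apply: eq_fsbigr => a _; rewrite subKr mulrC.
by exists (fun a => c - a) => a; rewrite subKr.
Qed.

Lemma hmul_mono f b x c : hmul f (hmono b x) c = f (c - b) * x.
Proof.
rewrite /= /conv (fsum1 (b := c - b)) /= ?subKr ?eqxx// => a acb.
have [E|_] := eqVneq (c - a) b; last by rewrite mulr0.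
by move/eqP: acb; case; rewrite -E subKr.
Qed.

Definition hone : hahn := hmono 0 1.

Lemma hmul1 : left_id hone hmul.
Proof.
by move=> f; apply: hahn_eqP => c; rewrite hmulC hmul_mono subr0 mulr1.
Qed.

Lemma hmulDl : left_distributive hmul +%R.
Proof.
move=> f g h; apply: hahn_eqP => c; rewrite hcoefD.
pose D := [set a | supp f a /\ supp h (c - a)] `|`
  [set a | supp g a /\ supp h (c - a)].
have finD : finite_set D by rewrite finite_setU; split; apply: finite_conv.
rewrite (@conv_sub f h c D); last by move=> a ?; left.
rewrite (@conv_sub g h c D); last by move=> a ?; right.
rewrite (@conv_sub (f + g) h c D); last first.
  move=> a [+ ha]; rewrite /supp /mkset hcoefD.
  by have [->|fa] := eqVneq (f a) 0; [rewrite add0r; right | left].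
by rewrite -fsbig_split//; apply: eq_fsbigr => a _; rewrite hcoefD mulrDl.
Qed.

Lemma hmulA : associative hmul.
Proof.
move=> f g h; apply: hahn_eqP => c.
pose D1 := [set a | supp f a /\ sumset (supp g) (supp h) (c - a)].
pose D2 := [set b | sumset (supp f) (supp g) b /\ supp h (c - b)].
have wo := @well_ordered_sumset G.
have fD1 : finite_set D1.
  by apply: well_ordered_fiber; [apply: hahnP | apply: wo; apply: hahnP].
have fD2 : finite_set D2.
  by apply: well_ordered_fiber; [apply: wo; apply: hahnP | apply: hahnP].
rewrite (@conv_sub f _ c D1); last first.
  move=> a [fa gha]; split=> //.
  have [//|n] := pselect (sumset (supp g) (supp h) (c - a)).
  move/negP: gha; case; apply/eqP; apply: fsbig1 => b _; apply/eqP.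
  rewrite mulf_eq0; apply: contra_notT n; rewrite negb_or => /andP[gb hb].
  by exists b, (c - a - b); split=> //; rewrite [RHS]addrC subrK.
rewrite (@conv_sub _ h c D2); last first.
  move=> b [fgb hb]; split=> //.
  have [//|n] := pselect (sumset (supp f) (supp g) b).
  move/negP: fgb; case; apply/eqP; apply: fsbig1 => a _; apply/eqP.
  rewrite mulf_eq0; apply: contra_notT n; rewrite negb_or => /andP[fa ga].
  by exists a, (b - a); split=> //; rewrite addrC subrK.
transitivity (\sum_(a \in D1) \sum_(b \in D2) f a * g (b - a) * h (c - b)).
  apply: eq_fsbigr => a /set_mem[fa _]; rewrite /= /conv.
  rewrite (reindex_fsbigT (fun b => b - a)); last first.
    by exists (fun b => b + a) => b; rewrite ?addrK ?subrK.
  rewrite (@fsum_sub D2) => [|b]; last first.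
    rewrite mulf_eq0 negb_or opprB addrA subrK => /andP[gb hb]; split=> //.
    by exists a, (b - a); split=> //; rewrite addrC subrK.
  rewrite mulr_fsumr; apply: eq_fsbigr => b _.
  by rewrite opprB addrA subrK mulrA.
rewrite exchange_fsbig//; apply: eq_fsbigr => b /set_mem[_ hb].
rewrite -mulr_fsuml; congr (_ * _); rewrite (@conv_sub _ _ _ D1)// => a [fa ga].
split=> //; exists (b - a), (c - b); split=> //.
by rewrite [RHS]addrC addrA subrK.
Qed.

Lemma hone_neq0 : hone != 0.
Proof.
apply/eqP => E; have := hcoef0 0; rewrite -E /= eqxx => /eqP.
by rewrite oner_eq0.
Qed.

HB.instance Definition _ := GRing.Zmodule_isComNzRing.Build hahn
  hmulA hmulC hmul1 hmulDl hone_neq0.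

Lemma hcoefM f g c : (f * g) c = \sum_(a \in [set: G]) f a * g (c - a).
Proof. by []. Qed.

Lemma hcoef1 a : (1 : hahn) a = (a == 0)%:R.
Proof. by rewrite /= mulrb. Qed.

(* the least element of the support of f *)
Definition hval f : G :=
  xget 0 [set a | supp f a /\ forall b, supp f b -> a <= b].

Lemma hvalP f : f != 0 ->
  f (hval f) != 0 /\ forall b, f b != 0 -> hval f <= b.
Proof.
move=> f0; rewrite /hval; case: xgetP => [a _ //|noval].
have [|a fa amin] := hahnP (@subset_refl _ (supp f)); last by case: (noval a).
apply: contrapT => n; move/negP: f0; apply; apply/eqP/hahn_eqP => a.
by apply/eqP; apply: contra_notT n => fa; exists a.
Qed.

Lemma hval_uniq f a : f a != 0 -> (forall b, f b != 0 -> a <= b) -> hval f = a.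
Proof.
move=> fa amin; have f0 : f != 0.
  by apply: contraNneq fa => ->; rewrite hcoef0.
by have [vf vmin] := hvalP f0; apply: le_anti; rewrite vmin// amin.
Qed.

Lemma hcoef_lt f a : f != 0 -> a < hval f -> f a = 0.
Proof.
move=> /hvalP[_ vmin] av; apply/eqP; apply: contraTT av => /vmin.
by rewrite oag_leNgt.
Qed.

Lemma hcoefM_val f g : f != 0 -> g != 0 ->
  (f * g) (hval f + hval g) = f (hval f) * g (hval g).
Proof.
move=> f0 g0; rewrite hcoefM (fsum1 (b := hval f)).
  by rewrite addrAC subrr add0r.
move=> a; rewrite oag_neq_lt => /orP[av|va]; first by rewrite hcoef_lt ?mul0r.
rewrite [X in _ * X]hcoef_lt ?mulr0//.
by rewrite -(oag_ltD2r a) subrK addrC oag_ltD2l.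
Qed.

Lemma hcoefM_lt f g c : f != 0 -> g != 0 -> c < hval f + hval g ->
  (f * g) c = 0.
Proof.
move=> f0 g0 cv; rewrite hcoefM; apply: fsbig1 => a _.
have [av|] := boolP (a < hval f); first by rewrite hcoef_lt ?mul0r.
rewrite -oag_leNgt => va; rewrite [X in _ * X]hcoef_lt ?mulr0//.
rewrite -(oag_ltD2r a) subrK; apply: lt_le_trans cv _.
by rewrite addrC oag_leD2l.
Qed.

Definition end_ext f g : Prop :=
  forall a, f a != 0 -> forall b, b <= a -> g b = f b.

(* A maximal approximate inverse, for the order given by end extension, is an
   inverse: otherwise the leading term of 1 - f * g allows extending g. *)
Lemma hahn_inv_exists f : f != 0 -> exists g, g * f = 1.
Proof.
move=> f0; set d := hval f.
pose approx g := forall a, g a != 0 -> forall b, b <= a + d -> (1 - f * g) b = 0.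
pose T := {g : hahn | `[< approx g >]}.
pose R (g h : T) := `[< end_ext (val g) (val h) >].
have agree g h a : end_ext g h \/ end_ext h g -> g a != 0 ->
    forall b, b <= a -> h b != 0 -> h b = g b.
  move=> [gh|hg] ga b ba hb; first exact: gh ba.
  by rewrite (hg b hb).
have [|g1 h1 i1|g1 h1|A Atot|gT gmax] := @Zorn T R.
- by move=> g; apply/asboolP.
- move=> /asboolP gh /asboolP hi; apply/asboolP => a ga b ba.
  by rewrite (hi a) ?(gh a)// (gh a).
- move=> /asboolP gh /asboolP hg; apply/val_inj/hahn_eqP => a.
  have [ga|] := eqVneq (val g1 a) 0; last by move=> ga; rewrite (gh a).
  have [//|ha] := eqVneq (val h1 a) 0; first by rewrite ga.
  by rewrite (hg a).
- pose u a := xget 0 [set x | x != 0 /\ exists2 g : T, A g & val g a = x].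
  have uE (g : T) a b : A g -> val g a != 0 -> b <= a -> u b = val g b.
    move=> Ag ga ba; rewrite /u; case: xgetP => [x _ [x0 [h Ah hx]]|nox].
      rewrite -hx; apply: (agree _ _ a) => //; last by rewrite hx.
      by case: (Atot _ _ Ag Ah) => /asboolP; [left|right].
    apply/eqP; rewrite eq_sym; apply/negPn/negP => gb.
    by apply: (nox (val g b)); split=> //; exists g.
  have usupp a : u a != 0 -> exists2 g : T, A g & val g a != 0.
    rewrite /u; case: xgetP => [x _ [x0 [g Ag gx]] _|]; last by rewrite eqxx.
    by exists g => //; rewrite gx.
  have uH : u \in hahn_pred.
    apply/asboolP => B sB [x Bx]; have [g Ag gx] := usupp _ (sB _ Bx).
    have [||m [Bm mx] mmin] := hahnP (f := val g) (B := B `&` [set y | y <= x]).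
    - by move=> y [By yx]; rewrite /supp /= -(uE g x)//; apply: sB.
    - by exists x; split=> /=.
    exists m => // y By; have [yx|] := boolP (y <= x); first exact: mmin.
    by rewrite -oag_ltNge => /ltW; apply: le_trans.
  have uA : approx (Hahn uH).
    move=> a /= ua b bad; have [g Ag ga] := usupp _ ua.
    have /asboolP/(_ a ga b bad) := valP g; move=> E.
    rewrite -[RHS]E !hcoefD !hcoefN; congr (_ - _); rewrite !hcoefM; apply: eq_fsbigr => e _ /=.
    have [->|fe] := eqVneq (f e) 0; first by rewrite !mul0r.
    have [_ /(_ _ fe) de] := hvalP f0.
    congr (_ * _); apply: (uE g a) => //.
    by rewrite oag_le_subLR; apply: le_trans bad _; rewrite oag_leD2l.
  exists (exist _ (Hahn uH) (asboolT uA)) => g Ag; apply/asboolP => a ga b ba.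
  exact: (uE g a).
pose g := val gT; have /asboolP gA := valP gT; rewrite -/g in gA.
exists g; rewrite mulrC; apply/esym/eqP; rewrite -subr_eq0.
apply: contraT => r0; set r := 1 - f * g in r0 *.
have [re rmin] := hvalP r0; set e := hval r in re rmin.
have [fd dmin] := hvalP f0; rewrite -/d in fd dmin.
have lt_e a : g a != 0 -> a < e - d.
  move=> ga; rewrite -(oag_ltD2r d) subrK oag_ltNge; apply/negP => ead.
  by move/negP: re; apply; apply/eqP; apply: gA ead.
pose x := r e / f d; have x0 : x != 0 by rewrite mulf_neq0 ?invr_eq0.
pose h := g + hmono (e - d) x.
have hA : approx h.
  move=> a ha b bad; have ae : a <= e - d.
    have [ga|/lt_e/ltW//] := eqVneq (g a) 0.
    move: ha; rewrite hcoefD ga add0r /=.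
    by have [->|] := eqVneq a (e - d); rewrite ?eqxx.
  have be : b <= e by apply: (le_trans bad); rewrite -(subrK d e) oag_leD2r.
  have -> : 1 - f * h = r - f * hmono (e - d) x.
    by rewrite /h mulrDr opprD addrA.
  rewrite hcoefD hcoefN hmul_mono.
  move: be; rewrite le_eqVlt => /orP[/eqP ->|be].
    by rewrite subKr /x mulrC divfK// subrr.
  rewrite (hcoef_lt r0)// (hcoef_lt f0) ?mul0r ?subrr//.
  by rewrite -(oag_ltD2r (e - d)) subrK -/d addrC subrK.
have /gmax : R gT (exist _ h (asboolT hA)).
  apply/asboolP => a ga b ba; rewrite -[LHS]/(h b) hcoefD hcoef_mono.
  by rewrite lt_eqF ?addr0//; apply: le_lt_trans ba _; apply: lt_e.
move=> E; have /eqP : h (e - d) = g (e - d).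
  exact: (congr1 (fun g : T => val g (e - d)) E).
by rewrite hcoefD hcoef_mono eqxx -subr_eq0 addrAC subrr add0r (negbTE x0).
Qed.

Definition hinv f : hahn := xget 0 [set g | g * f = 1].

Lemma hmulV f : f != 0 -> hinv f * f = 1.
Proof.
move=> /hahn_inv_exists[g gf]; rewrite /hinv.
by case: xgetP => // /(_ g).
Qed.

Lemma hinv0 : hinv 0 = 0.
Proof.
rewrite /hinv; case: xgetP => // g _ /=; rewrite mulr0 => /esym/eqP.
by rewrite oner_eq0.
Qed.

HB.instance Definition _ := GRing.ComNzRing_isField.Build hahn hmulV hinv0.

Lemma hvalM f g : f != 0 -> g != 0 -> hval (f * g) = hval f + hval g.
Proof.
move=> f0 g0; apply: hval_uniq => [|b].
  by rewrite hcoefM_val// mulf_neq0//; [case: (hvalP f0) | case: (hvalP g0)].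
by rewrite oag_leNgt; apply: contra_neqN => /(hcoefM_lt f0 g0).
Qed.

Lemma hvalD f g : f != 0 -> g != 0 -> f + g != 0 ->
  Num.min (hval f) (hval g) <= hval (f + g).
Proof.
move=> f0 g0 fg0; have [fg _] := hvalP fg0.
rewrite oag_leNgt oag_lt_min; apply: contraNN fg => /andP[vf vg].
by rewrite hcoefD !hcoef_lt ?addr0.
Qed.

Lemma hval_mono b x : x != 0 -> hval (hmono b x) = b.
Proof.
move=> x0; apply: hval_uniq => [|a] /=; first by rewrite eqxx.
by have [->|] := eqVneq a b; rewrite ?eqxx.
Qed.

Lemma hval_surj (b : G) : exists2 f, f != 0 & hval f = b.
Proof.
exists (hmono b 1); last by rewrite hval_mono ?oner_neq0.
apply/eqP => E; have := hcoef0 b; rewrite -E /= eqxx => /eqP.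
by rewrite oner_eq0.
Qed.

Definition hahn_val : valuation hahn := Valuation hvalM hvalD hval_surj.

End HahnSeries.

Section HahnDifferentialField.
Variables (k : diffField) (G : oagType) (c : {additive G -> k}).
Local Notation H := (hahn k G).

Lemma der_add0 : der (0 : k) = 0.
Proof.
have [dD _] := derP k; have := dD 0 0; rewrite addr0.
by move=> /eqP; rewrite -subr_eq0 opprD addrA subrr sub0r oppr_eq0 => /eqP.
Qed.

Lemma hder_subproof (f : H) : (fun a => der (f a) + c a * f a) \in @hahn_pred k G.
Proof.
apply/asboolP; apply: well_orderedS (hahnP (f := f)) => a.
by apply: contra_neq => /= ->; rewrite der_add0 mulr0 addr0.
Qed.

Definition hder (f : H) : H := Hahn (hder_subproof f).

Lemma hcoef_der (f : H) a : hder f a = der (f a) + c a * f a.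
Proof. by []. Qed.

Lemma hderP : is_derivation hder.
Proof.
have [dD dM] := derP k; split=> f g; apply: hahn_eqP => a.
  by rewrite hcoefD !hcoef_der hcoefD dD mulrDr addrACA.
pose D := [set b | supp f b /\ supp g (a - b)].
have finD : finite_set D := finite_conv f g a.
have supp_der (h : H) b : supp (hder h) b -> supp h b.
  by apply: contra_neq => /= ->; rewrite der_add0 mulr0 addr0.
rewrite hcoefD hcoef_der.
have -> : (f * g) a = \sum_(b \in D) f b * g (a - b) by apply: conv_sub.
have -> : (hder f * g) a = \sum_(b \in D) hder f b * g (a - b).
  by apply: conv_sub => b [/supp_der].
have -> : (f * hder g) a = \sum_(b \in D) f b * hder g (a - b).
  by apply: conv_sub => b [? /supp_der].
rewrite -fsbig_split// mulr_fsumr !fsbig_finite//=.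
rewrite (big_morph der dD der_add0) -big_split /=; apply: eq_bigr => b _.
rewrite dM -[c a](_ : c b + c (a - b) = _); last first.
  by rewrite -raddfD addrC subrK.
rewrite !mulrDl !mulrDr -!mulrA (mulrCA (f b)) -!addrA; congr (_ + _).
exact: addrCA.
Qed.

Lemma hcoef_nat n (a : G) : (n%:R : H) a = if a == 0 then n%:R else 0.
Proof.
elim: n => [|n IH]; first by rewrite hcoef0; case: ifP.
by rewrite !mulrS hcoefD IH hcoef1; case: eqP => _; rewrite ?addr0.
Qed.

Lemma hahn_pchar0 : [pchar H] =i pred0.
Proof.
move=> p; rewrite !inE; apply/negP => /andP[p_pr /eqP].
move=> /(congr1 (fun f : H => f 0)); rewrite hcoef_nat eqxx hcoef0 => p0.
by have := df_pchar0 k p; rewrite !inE p_pr p0 eqxx.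
Qed.

Lemma hahn_res_pchar0 : [pchar (residue (hahn_val k G))] =i pred0.
Proof.
move=> p; rewrite !inE; apply/negP => /andP[p_pr].
set I := maxideal (v := hahn_val k G); set pi := \pi_({ideal_quot I})%qT.
rewrite -(rmorph_nat pi) -(rmorph0 pi) -Quotient.idealrBE subr0.
rewrite -[_ \in I]/(val (p%:R : valring (hahn_val k G)) \in _) rmorph_nat unfold_in.
have p0 : (p%:R : H) 0 != 0.
  rewrite hcoef_nat eqxx; apply/negP => p0.
  by have := df_pchar0 k p; rewrite !inE p_pr p0.
have pH : (p%:R : H) != 0 by apply: contraNneq p0 => ->.
have [_ pmin] := hvalP pH.
by rewrite (negbTE pH) /= oag_ltNge (pmin _ p0).
Qed.

Definition hahn_diffField : diffField := DiffField hderP hahn_pchar0.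

Definition hahn_vdf : valuedDiffField :=
  @ValuedDiffField hahn_diffField (hahn_val k G) hahn_res_pchar0.

End HahnDifferentialField.

(* Main.v *)
(** Replace [F] by an ultrapower [F*] over the natural numbers, which is monotone, still
    solves the differential equations with linear reduction, and has the property that
    countable nested families of balls intersect.

    By a Newton-type argument at a minimal differential polynomial, a differential
    subfield [K] of [F] that is maximal among those inside the units of the valuation
    ring (and 0) maps onto the residue field. Solving [u' = - e u] with [u] in [1 + m]
    removes the infinitesimal part [e] of a logarithmic derivative, so the elements
    with logarithmic derivative in [K] attain all values. In the ultrapower this
    surjection onto the torsion-free value group splits, because countable systems of
    equations are solvable there. This yields a cross-section [s] of [F*] with
    [(s a)' = c(a) s(a)], [c] additive with values in the ultrapower [k] of [K], and
    [k] is linearly surjective.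

    [F*] and the Hahn field [k((t^G))_c] now have the same [k], [G] and [c]. They are
    elementarily equivalent by back and forth between countable differential subfields
    whose nonzero elements correspond with equal leading terms [b t^a]. A new element
    is reached by first adjoining countably many [b] and [t^a]; the remaining extension
    is immediate, and the element is matched with a pseudolimit, which a Newton-type
    argument makes a zero of the minimal differential polynomial when there is one. *)

Require Import Defs.
From HB Require Import structures.
From mathcomp Require Import all_boot all_order all_algebra.
From mathcomp Require Import ring_quotient generic_quotient mpoly.
From mathcomp Require Import boolp classical_sets functions cardinality filter.
From mathcomp Require Import ring.

Set Implicit Arguments.
Unset Strict Implicit.
Unset Printing Implicit Defensive.

Import Order.TTheory GRing.Theory Num.Theory.

Local Open Scope classical_set_scope.
Local Open Scope ring_scope.

(** * Minimal differential polynomials *)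

(** Differential-henselianity is about polynomials over the valuation ring with zeros in that ring,
    while every use here concerns a ball x + gO. Substituting x + gY mixes the derivatives of g with
    those of Y. Monotonicity gives v(g^(i)) >= v(g), so after division by g the mixing is a
    unitriangular change of variables over the valuation ring and a linear reduction stays linear.
    For the same reason a differential polynomial can be treated on a ball as an ordinary polynomial
    in the jets.

    The field K is lifted inside F, before the ultrapower is taken: the value map on elements with
    logarithmic derivative in K is then a homomorphism of ordinary groups, and it is the ultrapower
    of this homomorphism that is split, by solving finitely many equations at each coordinate.

    An immediate extension may have to adjoin other elements before the given one, and completeness
    is only countable. Everything is therefore confined to a countable hull N closed under the zeros
    that may be needed, and a partial isomorphism maximal among those with domain inside N has
    domain N. The Hahn field is spherically complete and needs no ultrapower. *)

Lemma map_polyZXn (R S : nzRingType) (f : {additive R -> S}) a k :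
  map_poly f (a *: 'X^k) = f a *: 'X^k.
Proof.
apply/polyP => j; rewrite coef_map_id0 ?raddf0 // !coefZ !coefXn.
by case: eqP => _; rewrite ?mulr1 ?mulr0 ?raddf0.
Qed.

Section LastVariable.
Variables (R : comNzRingType) (n : nat).
Implicit Types (P Q : {mpoly R[n.+1]}).

Definition wid (i : 'I_n) : 'I_n.+1 := widen_ord (leqnSn n) i.

Lemma muniX (m : 'X_{1..n.+1}) : muni ('X_[m] : {mpoly R[n.+1]}) =
  'X_[[multinom m (wid i) | i < n]] *: 'X^(m ord_max).
Proof. by rewrite muniE msuppX big_seq1 mcoeffX eqxx scale1r. Qed.

Lemma mmap_muni (S : comNzRingType) (f : {rmorphism R -> S}) (h : 'I_n.+1 -> S) P :
  mmap f h P = (map_poly (mmap f (h \o wid)) (muni P)).[h ord_max].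
Proof.
elim/mpolyind: P => [|c m p _ _ IH]; first by rewrite muni0 !raddf0 horner0.
rewrite raddfD /= IH muniD raddfD hornerD; congr (_ + _).
rewrite mmapZ mmapX muniZ muniX /= !map_polyZ map_polyXn !hornerZ hornerXn.
rewrite /= mmapC mmapX; congr (_ * _); rewrite /mmap1 big_ord_recr /=; congr (_ * _).
by apply: eq_bigr => i _; rewrite mnmE.
Qed.

Lemma mpoly_muni P : P = (map_poly (@mwiden n R) (muni P)).['X_ord_max].
Proof.
transitivity (mmap (@mpolyC n.+1 R) (fun i => 'X_i) P); last exact: mmap_muni.
elim/mpolyind: P => [|c m p _ _ IH]; first by rewrite raddf0.
by rewrite raddfD /= -IH mmapZ mmapX mmap1_id mul_mpolyC.
Qed.

Lemma muni_eq0 P : (muni P == 0) = (P == 0).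
Proof.
apply/eqP/eqP => [E|->]; last exact: muni0.
by rewrite (mpoly_muni P) E raddf0 horner0.
Qed.

Lemma muni_const P : (size (muni P) <= 1)%N -> P = mwiden (muni P)`_0.
Proof.
move=> /size1_polyC E; rewrite {1}(mpoly_muni P) E map_polyC /=.
by rewrite hornerC coefC.
Qed.

Lemma muni_mderiv_max P : muni P^`M(ord_max) = (muni P)^`().
Proof.
elim/mpolyind: P => [|c m p _ _ IH]; first by rewrite mderiv0 muni0 deriv0.
rewrite mderivD !muniD derivD IH; congr (_ + _).
rewrite mderivZ mderivX !muniZ !muniX derivZ derivZ derivXn; congr (_ *: _).
rewrite mnmBE mnm1E eqxx subn1 mpolyC_nat scaler_nat scalerMnr; congr (_ *: _).
by congr 'X_[_]; apply/mnmP => i; rewrite !mnmE -val_eqE /= gtn_eqF // subn0.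
Qed.

Lemma muni_mderiv P (i : 'I_n) :
  muni P^`M(wid i) = map_poly (mderiv i) (muni P).
Proof.
elim/mpolyind: P => [|c m p _ _ IH]; first by rewrite mderiv0 muni0 raddf0.
rewrite mderivD !muniD raddfD IH; congr (_ + _).
rewrite mderivZ mderivX !muniZ !muniX !scalerA /= map_polyZXn; congr (_ *: _); last first.
  by rewrite mnmBE mnm1E -val_eqE /= ltn_eqF // subn0.
rewrite /= mderiv_mulC mderivX mnmE -mulrA mpolyC_nat mulr_natl -scaler_nat; congr (_ * (_ *: _)).
by congr 'X_[_]; apply/mnmP => j; rewrite !mnmE.
Qed.

Lemma size_muni_mderiv P (i : 'I_n) :
  (size (muni P^`M(wid i)) <= size (muni P))%N.
Proof. by rewrite muni_mderiv; apply: size_poly. Qed.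

End LastVariable.

Lemma msize_mderiv (R : nzRingType) n (P : {mpoly R[n]}) i :
  P != 0 -> (msize P^`M(i) < msize P)%N.
Proof.
move=> P0; rewrite (leq_ltn_trans (n := (msize P).-1)) //; last first.
  by rewrite prednK // lt0n mmeasure_poly_eq0.
rewrite msizeE; apply/bigmax_leqP_seq => m + _; rewrite mcoeff_msupp mcoeff_mderiv => Pm.
have /msize_mdeg_lt : (m + U_(i))%MM \in msupp P.
  by rewrite mcoeff_msupp; apply: contraNneq Pm => ->; rewrite mul0rn.
by rewrite mdegD mdeg1 addn1; case: (msize P).
Qed.

Section MinimalPolynomial.
Variables (A : fieldType) (charA : forall n, n.+1%:R != 0 :> A).
Variable bad : forall n, {mpoly A[n]} -> Prop.
Hypothesis bad0 : forall P : {mpoly A[0]}, P != 0 -> ~ bad P.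
Hypothesis bad_widen : forall n (Q : {mpoly A[n]}), bad (mwiden Q) -> bad Q.

(* G plays the role of a minimal differential polynomial: least order, then least
   degree in the top derivative, then least total degree. *)
Lemma minimal_bad n0 (P0 : {mpoly A[n0]}) : P0 != 0 -> bad P0 ->
  exists n (G : {mpoly A[n.+1]}), [/\ G != 0 /\ bad G,
    forall Q : {mpoly A[n]}, Q != 0 -> ~ bad Q,
    forall P : {mpoly A[n.+1]}, P != 0 -> (size (muni P) < size (muni G))%N -> ~ bad P,
    (1 < size (muni G))%N &
    G^`M(ord_max) != 0] /\ forall l, G^`M(l) != 0 -> ~ bad G^`M(l).
Proof.
move=> P00 badP0.
pose p1 n := `[< exists2 P : {mpoly A[n]}, P != 0 & bad P >].
have ex1 : exists n, p1 n by exists n0; apply/asboolP; exists P0.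
case: (ex_minnP ex1) => -[|n] /asboolP[P1 P10 badP1] minn; first by case: (bad0 P10).
have lowvar (Q : {mpoly A[n]}) : Q != 0 -> ~ bad Q.
  move=> Q0 bQ; have /minn : p1 n by apply/asboolP; exists Q.
  by rewrite ltnn.
pose p2 d := `[< exists P : {mpoly A[n.+1]}, [/\ P != 0, bad P & size (muni P) = d] >].
have ex2 : exists d, p2 d by exists (size (muni P1)); apply/asboolP; exists P1.
case: (ex_minnP ex2) => d /asboolP[P2 [P20 badP2 sP2]] mind.
pose p3 t := `[< exists P : {mpoly A[n.+1]},
  [/\ P != 0, bad P, size (muni P) = d & msize P = t] >].
have ex3 : exists t, p3 t by exists (msize P2); apply/asboolP; exists P2.
case: (ex_minnP ex3) => t /asboolP[G [G0 badG sG mG]] mint.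
have lowdeg (P : {mpoly A[n.+1]}) : P != 0 -> (size (muni P) < size (muni G))%N -> ~ bad P.
  move=> P'0 sP bP; have /mind : p2 (size (muni P)) by apply/asboolP; exists P.
  by rewrite leqNgt -sG sP.
(* If [G] did not involve its last variable, it would come from a bad polynomial in fewer variables,
   against [lowvar]. *)
have sG1 : (1 < size (muni G))%N.
  rewrite ltnNge; apply/negP => /muni_const EG.
  move: (badG); rewrite EG => /bad_widen; apply: lowvar.
  by apply: contraNneq G0 => E; rewrite EG E mwiden0.
exists n, G; split=> [|l]; first split=> //.
  rewrite -muni_eq0 muni_mderiv_max -size_poly_eq0 -lt0n.
  set s := size (muni G) in sG1 *.
  suff : ((muni G)^`())`_s.-2 != 0.
    by apply: contraNT; rewrite -eqn0Ngt size_poly_eq0 => /eqP ->; rewrite coef0.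
  rewrite coef_deriv -mulr_natr mulf_neq0 //.
    have -> : s.-2.+1 = s.-1 by rewrite -[in RHS](ltn_predK sG1) /=; case: (s) sG1 => [|[]].
    by rewrite -lead_coefE lead_coef_eq0 muni_eq0.
  by rewrite -mpolyC_nat mpolyC_eq0 charA.
have [i ->|->] := unliftP ord_max l; last first.
  move=> d0; apply: lowdeg => //; rewrite muni_mderiv_max lt_size_deriv // muni_eq0 //.
have -> : lift ord_max i = wid i.
  by apply: val_inj; rewrite /= /bump leqNgt ltn_ord.
(* A derivative in another variable either lowers the degree in the last one, or keeps it and lowers
   the total degree; the third minimisation is made for this second case. *)
move=> d0 bd; have := size_muni_mderiv G i; rewrite leq_eqVlt => /orP[/eqP E|]; last first.
  by move/lowdeg => /(_ d0).
have /mint : p3 (msize G^`M(wid i)).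
  by apply/asboolP; exists G^`M(wid i); split; [exact: d0 | exact: bd | rewrite E sG | ].
by rewrite -mG leqNgt msize_mderiv.
Qed.

End MinimalPolynomial.

Section LastVariableSurjective.
Variables (R : comNzRingType) (n : nat).

Lemma muni_mwiden (q : {mpoly R[n]}) : muni (mwiden q) = q%:P.
Proof.
elim/mpolyind: q => [|c m p _ _ IH]; first by rewrite mwiden0 muni0.
rewrite mwidenD muniD IH polyCD; congr (_ + _).
rewrite mwidenZ muniZ mwidenX muniX mnmwiden_ordmax expr0.
rewrite scalerA -mul_polyC mulr1 mul_mpolyC; congr (_ *: 'X_[_])%:P.
by apply/mnmP => i; rewrite mnmE /wid mnmwiden_widen.
Qed.

(** Turns the remainder of a division in the last variable back into a multivariate polynomial, so
    that minimality of the degree applies to it. *)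
Lemma muni_surj (p : {poly {mpoly R[n]}}) :
  muni (map_poly (@mwiden n R) p).['X_ord_max] = p.
Proof.
elim/poly_ind: p => [|p c IH]; first by rewrite raddf0 horner0 muni0.
rewrite rmorphD rmorphM /= map_polyX map_polyC /= hornerD hornerM hornerX hornerC.
rewrite muniD muniM IH muni_mwiden; congr (_ * _ + _).
rewrite muniX mnm1E eqxx expr1 (_ : [multinom _ | i < n] = 0%MM).
  by rewrite mpolyX0 scale1r.
by apply/mnmP => j; rewrite mnmE mnm1E mnm0E -val_eqE /= gtn_eqF.
Qed.

End LastVariableSurjective.

(** * Differential subfields *)

Section Derivations.
Variables (B : comUnitRingType) (d : B -> B) (dP : is_derivation d).

Lemma is_derD x y : d (x + y) = d x + d y. Proof. exact: (proj1 dP). Qed.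
Lemma is_derM x y : d (x * y) = d x * y + x * d y. Proof. exact: (proj2 dP). Qed.
Lemma is_der0 : d 0 = 0.
Proof. by apply: (addrI (d 0)); rewrite -is_derD !addr0. Qed.
Lemma is_derN x : d (- x) = - d x.
Proof. by apply: (addrI (d x)); rewrite -is_derD !subrr is_der0. Qed.
Lemma is_derB x y : d (x - y) = d x - d y.
Proof. by rewrite is_derD is_derN. Qed.
Lemma is_der1 : d 1 = 0.
Proof. by apply: (addrI (d 1)); rewrite -{3}[1]mulr1 is_derM mulr1 mul1r addr0. Qed.
Lemma is_derV x : x \is a GRing.unit -> d x^-1 = - (d x * x^-1 ^+ 2).
Proof.
move=> xu; have : d (x * x^-1) = 0 by rewrite divrr // is_der1.
rewrite is_derM => /(congr1 (fun z => x^-1 * z)).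
rewrite mulr0 mulrDr [X in _ + X]mulrA mulVr // mul1r => /eqP.
by rewrite addrC addr_eq0 => /eqP ->; rewrite expr2 mulrCA.
Qed.
Lemma is_derX x m : d (x ^+ m) = x ^+ m.-1 * d x *+ m.
Proof.
elim: m => [|m IH]; first by rewrite expr0 is_der1 mulr0n.
rewrite exprS is_derM IH mulrC mulrS; congr (_ + _).
case: m {IH} => [|m]; first by rewrite !mulr0n mulr0.
by rewrite /= mulrnAr mulrA -exprS.
Qed.

Variables (A : comNzRingType) (f : {rmorphism A -> B}) (dA : A -> A).
Hypothesis f_der : forall a, f (dA a) = d (f a).

(** Chain rule, [P'] being [P] with differentiated coefficients. The clause on constant coefficients
    serves for the formal partial derivatives of a composition in [aff_mderiv]. *)
Lemma der_mmap n (P : {mpoly A[n]}) (h : 'I_n -> B) : exists P' : {mpoly A[n]},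
  d (mmap f h P) = mmap f h P' + \sum_(j < n) mmap f h P^`M(j) * d (h j) /\
  ((forall a, dA a = 0) -> P' = 0).
Proof.
elim/mpolyind: P => [|c m p _ _ [p' [IH p'0]]].
  exists 0; split=> //; rewrite raddf0 is_der0 big1 ?addr0 // => j _.
  by rewrite mderiv0 raddf0 mul0r.
exists (dA c *: 'X_[m] + p'); split=> [|dA0]; last by rewrite dA0 scale0r p'0 ?addr0.
rewrite !raddfD /= is_derD IH.
under eq_bigr do rewrite mderivD raddfD /= mulrDl.
rewrite big_split /= addrACA; congr (_ + _); rewrite !mmapZ is_derM f_der; congr (_ + _).
rewrite !mmapX.
suff -> : d (mmap1 h m) = \sum_(j < n) (mmap f h 'X_[m]^`M(j)) * d (h j).
  by rewrite mulr_sumr; apply: eq_bigr => j _; rewrite mderivZ mmapZ mulrA.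
have -> : d (mmap1 h m) =
    \sum_(j < n) (\prod_(i < n | i != j) h i ^+ m i) * (h j ^+ (m j).-1 * d (h j) *+ m j).
  rewrite /mmap1; pose g (r : seq 'I_n) := \prod_(i <- r) h i ^+ m i.
  have Dprod (r : seq 'I_n) : uniq r -> d (\prod_(i <- r) h i ^+ m i) =
      \sum_(j <- r) (\prod_(i <- r | i != j) h i ^+ m i) * (h j ^+ (m j).-1 * d (h j) *+ m j).
    elim: r => [|a r IHr] /=; first by rewrite !big_nil is_der1.
    move=> /andP[ar ur]; rewrite !big_cons is_derM IHr // is_derX eqxx /=; congr (_ + _).
      rewrite mulrC; congr (_ * _); rewrite big_seq_cond [RHS]big_seq_cond; apply: eq_bigl => i.
      by case: eqP => [->|_]; rewrite ?(negbTE ar) //= andbT.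
    rewrite mulr_sumr big_seq [RHS]big_seq; apply: eq_bigr => j jr.
    rewrite big_cons ifT ?mulrA //; first by apply: contraNneq ar => ->.
  by rewrite Dprod // index_enum_uniq.
apply: eq_bigr => j _; rewrite mderivX mmapZ mmapX rmorph_nat mulr_natl.
rewrite mulrnAr mulrnAl; congr (_ *+ _); rewrite mulrA; congr (_ * _).
rewrite /mmap1 [RHS](bigD1 j) //= mulrC; congr (_ * _).
  by rewrite mnmBE mnm1E eqxx subn1.
by apply: eq_bigr => i ij; rewrite mnmBE mnm1E eq_sym (negbTE ij) subn0.
Qed.

End Derivations.

Section GoodSubfields.
Variables (B : comUnitRingType) (d : B -> B) (U : set B).

Record diff_closed (T : set B) : Prop := DiffClosed {
  dc1 : T 1;
  dcB : forall x y, T x -> T y -> T (x - y);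
  dcM : forall x y, T x -> T y -> T (x * y);
  dcV : forall x, T x -> T x^-1;
  dcD : forall x, T x -> T (d x)
}.

(* When B = M1 * M2, U is the set of pairs with the same leading term; when
   B = M, it is the set of units of the valuation ring. *)
Record gfield := GField {
  gf_set :> set B;
  gf_closed : diff_closed gf_set;
  gf_good : forall x, gf_set x -> x = 0 \/ U x;
  gf_unit : forall x, gf_set x -> x != 0 -> x \is a GRing.unit
}.

Section AsField.
Variable K : gfield.

Definition gf_pred : {pred B} := fun x => `[< gf_set K x >].

Lemma gf_subring : subring_closed gf_pred.
Proof.
have [K1 KB KM _ _] := gf_closed K.
split=> [|x y|x y]; rewrite !unfold_in; first exact/asboolP.
  by move=> /asboolP Kx /asboolP Ky; apply/asboolP/KB.
by move=> /asboolP Kx /asboolP Ky; apply/asboolP/KM.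
Qed.

HB.instance Definition _ := GRing.isSubringClosed.Build B gf_pred gf_subring.

Record gf_type := GfType { gf_val : B; _ : gf_val \in gf_pred }.

HB.instance Definition _ := [isSub for gf_val].
HB.instance Definition _ := [Choice of gf_type by <:].
HB.instance Definition _ := [SubChoice_isSubComNzRing of gf_type by <:].

Lemma gf_valP (a : gf_type) : gf_set K (val a).
Proof. by have /asboolP := valP a. Qed.

Lemma gf_inv_subproof (a : gf_type) : (val a)^-1 \in gf_pred.
Proof. by apply/asboolP/(dcV (gf_closed K)); apply: gf_valP. Qed.

Definition gf_inv (a : gf_type) : gf_type := GfType (gf_inv_subproof a).

Lemma gf_mulV (a : gf_type) : a != 0 -> gf_inv a * a = 1.
Proof.
move=> a0; apply: val_inj; rewrite rmorphM rmorph1 /= mulVr //.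
apply: gf_unit (gf_valP a) _; apply: contra_neq a0 => E.
by apply: val_inj; rewrite rmorph0.
Qed.

Lemma gf_inv0 : gf_inv 0 = 0.
Proof. by apply: val_inj; rewrite /= invr0. Qed.

HB.instance Definition _ := GRing.ComNzRing_isField.Build gf_type gf_mulV gf_inv0.

Lemma gf_der_subproof (a : gf_type) : d (val a) \in gf_pred.
Proof. by apply/asboolP/(dcD (gf_closed K)); apply: gf_valP. Qed.

Definition gf_der (a : gf_type) : gf_type := GfType (gf_der_subproof a).

End AsField.
End GoodSubfields.

(** * Adjoining one element to a differential subfield of a ring *)

Section ExtendGoodSubfields.
Variables (B : comUnitRingType) (d : B -> B) (dP : is_derivation d) (U : set B).
Hypotheses (U1 : U 1) (UM : forall x y, U x -> U y -> U (x * y)).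
Hypotheses (UV : forall x, U x -> U x^-1) (Uunit : forall x, U x -> x \is a GRing.unit).

Lemma dc0 T : diff_closed d T -> T 0.
Proof. by move=> TP; rewrite -(subrr 1); apply: (dcB TP); apply: (dc1 TP). Qed.

Lemma dcN T x : diff_closed d T -> T x -> T (- x).
Proof. by move=> TP Tx; rewrite -sub0r; apply: (dcB TP) => //; apply: dc0. Qed.

Lemma dcAdd T x y : diff_closed d T -> T x -> T y -> T (x + y).
Proof. by move=> TP Tx Ty; rewrite -[y]opprK; apply: (dcB TP) => //; apply: dcN. Qed.

Lemma dc_iter T x j : diff_closed d T -> T x -> T (iter j d x).
Proof. by move=> TP Tx; elim: j => //= j; apply: (dcD TP). Qed.

Section FractionField.
Variable S : set B.
Hypotheses (S1 : S 1) (SB : forall x y, S x -> S y -> S (x - y)).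
Hypotheses (SM : forall x y, S x -> S y -> S (x * y)).
Hypothesis Sgood : forall x, S x -> x = 0 \/ U x.

(** Denominators are taken in [U] because [B] may be a product of two fields, where a nonzero
    element need not be invertible. *)
Definition fractions : set B := [set z | exists x y, [/\ S x, S y, U y & z = x * y^-1]].

(** Derivatives of [S] are only asked to be fractions: in the algebraic case the derivative of the
    top jet has the separant as denominator. *)
Hypothesis SD : forall x, S x -> fractions (d x).

Lemma fractions_sub x : S x -> fractions x.
Proof. by move=> Sx; exists x, 1; split; rewrite // invr1 mulr1. Qed.

Lemma fractionsM x y : fractions x -> fractions y -> fractions (x * y).
Proof.
move=> [a [b [Sa Sb Ub ->]]] [a' [b' [Sa' Sb' Ub' ->]]].
exists (a * a'), (b * b'); split; [exact: SM | exact: SM | exact: UM |].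
by rewrite invrM ?Uunit // mulrACA [b'^-1 * _]mulrC.
Qed.

Lemma fractionsB x y : fractions x -> fractions y -> fractions (x - y).
Proof.
move=> [a [b [Sa Sb Ub ->]]] [a' [b' [Sa' Sb' Ub' ->]]].
exists (a * b' - a' * b), (b * b'); split; [|exact: SM|exact: UM|].
  by apply: SB; apply: SM.
rewrite invrM ?Uunit // mulrBl mulrA mulrK ?Uunit //; congr (_ - _).
by rewrite [b'^-1 * _]mulrC mulrA mulrK ?Uunit.
Qed.

Lemma fractionsV x : fractions x -> fractions x^-1.
Proof.
move=> [a [b [Sa Sb Ub ->]]]; case: (Sgood Sa) => [->|Ua].
  by rewrite mul0r invr0; apply: fractions_sub; rewrite -(subrr 1); apply: SB.
by exists b, a; split=> //; rewrite invrM ?unitrV ?Uunit // invrK.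
Qed.

Lemma fractions_closed : diff_closed d fractions.
Proof.
split; [exact: fractions_sub | exact: fractionsB | exact: fractionsM |
  exact: fractionsV |].
move=> _ [a [b [Sa Sb Ub ->]]].
have Fb := fractionsV (fractions_sub Sb).
rewrite (is_derM dP) (is_derV dP) ?Uunit // mulrN.
apply: fractionsB; apply: fractionsM; rewrite ?expr2 //;
  by [apply: SD | apply: fractions_sub | do ?apply: fractionsM => //; apply: SD].
Qed.

Lemma fractions_good x : fractions x -> x = 0 \/ U x.
Proof.
move=> [a [b [Sa Sb Ub ->]]]; case: (Sgood Sa) => [->|Ua]; first by left; rewrite mul0r.
by right; apply: UM => //; apply: UV.
Qed.

Lemma fractions_unit x : fractions x -> x != 0 -> x \is a GRing.unit.
Proof. by move=> /fractions_good[->|/Uunit //]; rewrite eqxx. Qed.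

Definition fraction_field : gfield d U :=
  GField fractions_closed fractions_good fractions_unit.

Lemma fractions_min T : diff_closed d T -> S `<=` T -> fractions `<=` T.
Proof.
move=> TP ST _ [a [b [Sa Sb Ub ->]]].
by apply: (dcM TP); [exact: ST | apply: (dcV TP); apply: ST].
Qed.

End FractionField.

Variable K : gfield d U.
Notation A := (gf_type K).

Lemma is_der_gf : is_derivation (@gf_der B d U K).
Proof.
split=> x y; apply: val_inj; first by rewrite /= (is_derD dP).
by rewrite /= (is_derM dP).
Qed.

Definition jet (w : B) n : 'I_n -> B := fun j => iter j d w.
Definition devalB (w : B) n (P : {mpoly A[n]}) : B :=
  mmap (val : A -> B) (@jet w n) P.

Lemma devalB_mwiden w n (P : {mpoly A[n]}) : devalB w (mwiden P) = devalB w P.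
Proof.
rewrite /devalB (mmap_muni _ _ (mwiden P)) muni_mwiden map_polyC /= hornerC.
by [].
Qed.

(** The minimality clause later keeps an extension inside a prescribed countable set that is closed
    under the operations. *)
Definition gf_extension (w : B) := exists K' : gfield d U,
  [/\ gf_set K `<=` gf_set K', gf_set K' w &
    forall T, diff_closed d T -> gf_set K `<=` T -> T w -> gf_set K' `<=` T].

Lemma devalB_const w n (x : A) : devalB w (x%:MP_[n]) = val x.
Proof. by rewrite /devalB mmapC. Qed.

Lemma devalB_var w n (i : 'I_n) : devalB w ('X_i : {mpoly A[n]}) = iter i d w.
Proof. by rewrite /devalB mmapX mmap1U. Qed.

Lemma gf_val_ex x : gf_set K x -> exists a : A, x = val a.
Proof.
by move=> /asboolP Kx; have Px : x \in gf_pred K by []; exists (GfType Px).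
Qed.

Lemma devalB_closed T w n (P : {mpoly A[n]}) : diff_closed d T ->
  gf_set K `<=` T -> T w -> T (devalB w P).
Proof.
move=> TP KT Tw; rewrite /devalB /mmap; elim: (msupp P) => [|m s IH].
  by rewrite big_nil; apply: dc0.
rewrite big_cons; apply: (dcAdd TP) => //; apply: (dcM TP); first exact/KT/gf_valP.
rewrite /mmap1; elim/big_rec: _ => [|i y _ Ty]; first exact: (dc1 TP).
apply: (dcM TP) => //; elim: (m i) => [|e IHe]; first exact: (dc1 TP).
by rewrite exprS; apply: (dcM TP) => //; apply: dc_iter.
Qed.

Section Transcendental.
Variable w : B.
Hypothesis w_good : forall n (P : {mpoly A[n]}), P != 0 -> U (devalB w P).

Let S : set B := [set z | exists n (P : {mpoly A[n]}), z = devalB w P].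

Let widen_to n m (P : {mpoly A[n]}) : exists P' : {mpoly A[m + n]}, devalB w P' = devalB w P.
Proof.
elim: m => [|m [P' E]]; first by exists P.
by exists (mwiden P'); rewrite devalB_mwiden.
Qed.

Lemma extend_transcendental : gf_extension w.
Proof.
have common n1 n2 (P1 : {mpoly A[n1]}) (P2 : {mpoly A[n2]}) :
    exists n (Q1 Q2 : {mpoly A[n]}), devalB w Q1 = devalB w P1 /\ devalB w Q2 = devalB w P2.
  have [Q1 E1] := widen_to n2 P1; have [Q2 E2] := widen_to n1 P2.
  move: Q2 E2; rewrite addnC => Q2 E2.
  by exists (n2 + n1)%N, Q1, Q2.
have S1 : S 1 by exists 0%N, 1; rewrite /devalB rmorph1.
have SB x y : S x -> S y -> S (x - y).
  move=> [n1 [P1 ->]] [n2 [P2 ->]]; have [n [Q1 [Q2 [<- <-]]]] := common _ _ P1 P2.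
  by exists n, (Q1 - Q2); rewrite /devalB raddfB.
have SM x y : S x -> S y -> S (x * y).
  move=> [n1 [P1 ->]] [n2 [P2 ->]]; have [n [Q1 [Q2 [<- <-]]]] := common _ _ P1 P2.
  by exists n, (Q1 * Q2); rewrite /devalB rmorphM.
have Sgood x : S x -> x = 0 \/ U x.
  move=> [n [P ->]]; have [->|P0] := eqVneq P 0; first by left; rewrite /devalB raddf0.
  by right; apply: w_good.
have S0 : S 0 by rewrite -(subrr 1); apply: SB.
have SA x y : S x -> S y -> S (x + y).
  by move=> Sx Sy; rewrite -[y]opprK; apply: (SB) => //; rewrite -sub0r; apply: SB.
have Ssum (I : Type) (r : seq I) (F : I -> B) : (forall i, S (F i)) -> S (\sum_(i <- r) F i).
  by move=> SF; elim: r => [|i r IH]; rewrite ?big_nil ?big_cons //; apply: SA.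
have SD x : S x -> S (d x).
  move=> [n [P ->]]; have [P' [E _]] := der_mmap dP (fun a : A => erefl (val (gf_der a))) P (@jet w n).
  rewrite /devalB E; apply: SA; first by exists n, P'.
  apply: Ssum => j; apply: SM; first by exists n, P^`M(j).
  by exists j.+2, 'X_ord_max; rewrite devalB_var.
have SD' x : S x -> fractions S (d x) by move=> /SD; apply: fractions_sub.
exists (fraction_field S1 SB SM Sgood SD'); split.
- move=> x /gf_val_ex[a ->]; apply: fractions_sub => //.
  by exists 0%N, a%:MP; rewrite devalB_const.
- by apply: fractions_sub => //; exists 1%N, 'X_ord0; rewrite devalB_var.
- move=> T TP KT Tw; apply: (fractions_min TP) => _ [n [P ->]].
  exact: devalB_closed.
Qed.

End Transcendental.

Section Algebraic.
Variables (w : B) (n : nat) (G : {mpoly A[n.+1]}).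
Hypothesis low_order : forall Q : {mpoly A[n]}, Q != 0 -> U (devalB w Q).
Hypothesis low_degree : forall P : {mpoly A[n.+1]}, P != 0 ->
  (size (muni P) < size (muni G))%N -> U (devalB w P).
Hypotheses (G0 : G != 0) (dG0 : G^`M(ord_max) != 0) (Gw : devalB w G = 0).

Let S : set B := [set z | exists P : {mpoly A[n.+1]}, z = devalB w P].

Let ev (p : {poly {mpoly A[n]}}) : B :=
  (map_poly (@devalB w n) p).[jet w (ord_max : 'I_n.+1)].

Let ev_muni (P : {mpoly A[n.+1]}) : devalB w P = ev (muni P).
Proof. by rewrite /devalB mmap_muni. Qed.

(* pseudo-division by G in the last variable *)
Let devalB_good (P : {mpoly A[n.+1]}) : devalB w P = 0 \/ U (devalB w P).
Proof.
set e : {rmorphism {mpoly A[n]} -> B} := mmap (val : A -> B) (@jet w n).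
have evE p : ev p = (map_poly e p).[jet w (ord_max : 'I_n.+1)] by [].
have /(congr1 ev) := Pdiv.Idomain.divp_eq (muni P) (muni G).
set c := _ ^+ _; set q := _ %/ _; set r := _ %% _.
have -> : ev (c *: muni P) = e c * devalB w P by rewrite ev_muni !evE map_polyZ hornerZ.
have -> : ev (q * muni G + r) = ev r.
  rewrite !evE rmorphD rmorphM hornerD hornerM -(evE (muni G)) -ev_muni Gw.
  by rewrite mulr0 add0r.
have Uc : U (e c).
  rewrite /c rmorphXn; elim: (scalp _ _) => [|k IH]; first by rewrite expr0.
  rewrite exprS; apply: UM => //; apply: low_order.
  by rewrite lead_coef_eq0 muni_eq0.
move=> E; have -> : devalB w P = ev r * (e c)^-1.
  by rewrite -E mulrC mulKr // Uunit.
have [r0|r0] := eqVneq r 0; first by left; rewrite r0 evE raddf0 horner0 mul0r.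
right; apply: UM; last exact: UV.
rewrite -[r]muni_surj -ev_muni; apply: low_degree.
  by rewrite -muni_eq0 muni_surj.
by rewrite muni_surj ltn_modp muni_eq0.
Qed.

(** The first n + 1 jets suffice: differentiating G(w) = 0 writes the next derivative of [w] as a
    fraction. Its denominator is the separant, which has lower degree than [G] in the last variable,
    so its value lies in [U]. *)
Lemma extend_algebraic : gf_extension w.
Proof.
have S1 : S 1 by exists 1; rewrite /devalB rmorph1.
have SB x y : S x -> S y -> S (x - y).
  by move=> [P1 ->] [P2 ->]; exists (P1 - P2); rewrite /devalB raddfB.
have SM x y : S x -> S y -> S (x * y).
  by move=> [P1 ->] [P2 ->]; exists (P1 * P2); rewrite /devalB rmorphM.
have Sgood x : S x -> x = 0 \/ U x by move=> [P ->]; apply: devalB_good.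
have Fsub x : S x -> fractions S x by apply: fractions_sub.
have FB x y := @fractionsB S SB SM x y.
have FM x y := @fractionsM S SM x y.
have F0 : fractions S 0 by apply: Fsub; rewrite -(subrr 1); apply: SB.
have FN x : fractions S x -> fractions S (- x) by move=> Fx; rewrite -sub0r; apply: FB.
have FD x y : fractions S x -> fractions S y -> fractions S (x + y).
  by move=> Fx Fy; rewrite -[y]opprK; apply: FB => //; apply: FN.
have Fsum (I : Type) (r : seq I) (F : I -> B) :
    (forall i, fractions S (F i)) -> fractions S (\sum_(i <- r) F i).
  by move=> SF; elim: r => [|i r IH]; rewrite ?big_nil ?big_cons //; apply: FD.
have Sev (P : {mpoly A[n.+1]}) : fractions S (devalB w P) by apply: Fsub; exists P.
have Fjet (i : 'I_n) : fractions S (d (jet w (wid i))).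
  have := Sev 'X_(lift ord0 i); rewrite devalB_var; congr (fractions S _).
have Fmax : fractions S (d (jet w (ord_max : 'I_n.+1))).
  have [G' [E _]] := der_mmap dP (fun a : A => erefl (val (gf_der a))) G (@jet w n.+1).
  move: E; rewrite -/(devalB w G) Gw (is_der0 dP) big_ord_recr /= addrA => /esym/eqP.
  rewrite addrC addr_eq0 => /eqP.
  set s := mmap _ _ G^`M(_); set x := d _; set t := - _ => E.
  have Us : U s.
    apply: low_degree => //; rewrite muni_mderiv_max lt_size_deriv // muni_eq0 //.
  have -> : x = t * s^-1 by rewrite -E mulrC mulKr // Uunit.
  apply: (FM); last by apply: fractionsV => //; apply: (Sev G^`M(ord_max)).
  apply: FN; apply: (FD); first exact: (Sev G').
  by apply: (Fsum) => i; apply: (FM); [exact: (Sev G^`M(wid i)) | exact: Fjet].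
have SD x : S x -> fractions S (d x).
  move=> [P ->].
  have [P' [E _]] := der_mmap dP (fun a : A => erefl (val (gf_der a))) P (@jet w n.+1).
  rewrite /devalB E; apply: FD; first exact: (Sev P').
  apply: Fsum => j; apply: FM; first exact: (Sev P^`M(j)).
  have [i ->|-> //] := unliftP ord_max j.
  rewrite (_ : lift ord_max i = wid i) //.
  by apply: val_inj; rewrite /= /bump leqNgt ltn_ord.
exists (fraction_field S1 SB SM Sgood SD); split.
- by move=> x /gf_val_ex[a ->]; apply: Fsub; exists a%:MP; rewrite devalB_const.
- by apply: Fsub; exists 'X_ord0; rewrite devalB_var.
- move=> T TP KT Tw; apply: (fractions_min TP) => _ [P ->].
  exact: devalB_closed.
Qed.

End Algebraic.
End ExtendGoodSubfields.

Arguments jet {B} d w {n} _.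

Section UnionsAndPrimeFields.
Variables (B : comUnitRingType) (d : B -> B) (dP : is_derivation d) (U : set B).
Hypotheses (U1 : U 1) (UM : forall x y, U x -> U y -> U (x * y)).
Hypotheses (UV : forall x, U x -> U x^-1) (Uunit : forall x, U x -> x \is a GRing.unit).

Lemma gf_chain (F : set (set B)) : F !=set0 -> total_on F subset ->
  (forall S, F S -> exists K : gfield d U, gf_set K = S) ->
  exists K : gfield d U, gf_set K = \bigcup_(X in F) X.
Proof.
move=> [S0 FS0] totF FK.
have FP S : F S -> diff_closed d S by move=> /FK[K <-]; apply: gf_closed.
have pick p q : (\bigcup_(X in F) X) p -> (\bigcup_(X in F) X) q ->
    exists S, [/\ F S, S p & S q].
  move=> [S FS Sp] [S' FS' Sq]; have [SS'|S'S] := totF _ _ FS FS'.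
    by exists S'; split=> //; apply: SS'.
  by exists S; split=> //; apply: S'S.
have cl : diff_closed d (\bigcup_(X in F) X).
  split; first by exists S0 => //; apply: (dc1 (FP _ FS0)).
  - by move=> p q Fp Fq; have [S [FS Sp Sq]] := pick _ _ Fp Fq; exists S => //; apply: (dcB (FP _ FS)).
  - by move=> p q Fp Fq; have [S [FS Sp Sq]] := pick _ _ Fp Fq; exists S => //; apply: (dcM (FP _ FS)).
  - by move=> p [S FS Sp]; exists S => //; apply: (dcV (FP _ FS)).
  - by move=> p [S FS Sp]; exists S => //; apply: (dcD (FP _ FS)).
have gd p : (\bigcup_(X in F) X) p -> p = 0 \/ U p.
  by move=> [S FS Sp]; have [K KS] := FK _ FS; apply: (@gf_good _ _ _ K); rewrite KS.
have un p : (\bigcup_(X in F) X) p -> p != 0 -> p \is a GRing.unit.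
  by move=> [S FS Sp]; have [K KS] := FK _ FS; apply: (@gf_unit _ _ _ K); rewrite KS.
by exists (GField cl gd un).
Qed.

Lemma prime_subfield : (forall z : int, z%:~R = 0 :> B \/ U z%:~R) ->
  exists K : gfield d U, forall p, gf_set K p <->
    exists z w : int, U w%:~R /\ p = z%:~R * (w%:~R)^-1.
Proof.
move=> intU; pose S : set B := range (fun z : int => z%:~R).
have S1 : S 1 by exists 1.
have SB x y : S x -> S y -> S (x - y).
  by move=> [z _ <-] [z' _ <-]; exists (z - z') => //; rewrite rmorphB.
have SM x y : S x -> S y -> S (x * y).
  by move=> [z _ <-] [z' _ <-]; exists (z * z') => //; rewrite rmorphM.
have Sgood x : S x -> x = 0 \/ U x by move=> [z _ <-].
have d0 z : d z%:~R = 0.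
  have dn n : d n%:R = 0.
    by elim: n => [|n IH]; rewrite ?(is_der0 dP) // mulrS (is_derD dP) IH (is_der1 dP) addr0.
  by case: z => n; rewrite ?NegzE ?rmorphN ?(is_derN dP) /= ?dn ?oppr0 //; exact: dn.
have SD x : S x -> fractions U S (d x).
  by move=> [z _ <-]; rewrite d0; apply: fractions_sub => //; exists 0.
exists (fraction_field dP U1 UM UV Uunit S1 SB SM Sgood SD) => p; split.
  by move=> [_ [_ [[z _ <-] [w _ <-] Uw ->]]]; exists z, w.
by move=> [z [w [Uw ->]]]; exists z%:~R, w%:~R; split=> //; [exists z | exists w].
Qed.

End UnionsAndPrimeFields.

(** * Valuations *)

Section Valuations.
Variables (F : fieldType) (v : valuation F).
Local Notation O := (valring_pred v).
Local Notation m := (maxideal_pred v).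
Implicit Types (x y z e : F).

Lemma vO x : x != 0 -> (x \in O) = (0 <= v x).
Proof. by rewrite unfold_in => /negbTE ->. Qed.

Lemma vm x : x != 0 -> (x \in m) = (0 < v x).
Proof. by rewrite unfold_in => /negbTE ->. Qed.

Lemma valV x : x != 0 -> v x^-1 = - v x.
Proof.
move=> x0; apply: (addrI (v x)); rewrite -Defs.valM ?invr_eq0 //.
by rewrite divff // Defs.val1 subrr.
Qed.

Lemma val_le_div x y : y != 0 -> val_le v y x = (x / y \in O).
Proof.
move=> y0; rewrite /val_le y0 /=; have [->|x0] := eqVneq x 0.
  by rewrite mul0r rpred0.
rewrite vO ?mulf_neq0 ?invr_eq0 // Defs.valM ?invr_eq0 // valV //.
by rewrite -[0 <= _](oag_leD2r (v y)) add0r subrK.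
Qed.

Lemma val_lt_div x y : y != 0 -> ~~ val_le v x y = (x / y \in m).
Proof.
move=> y0; rewrite /val_le (negbTE y0) /=; have [->|x0] := eqVneq x 0.
  by rewrite mul0r unfold_in eqxx.
rewrite vm ?mulf_neq0 ?invr_eq0 // Defs.valM ?invr_eq0 // valV //.
by rewrite -oag_ltNge -[0 < _](oag_ltD2r (v y)) add0r subrK.
Qed.

Lemma maxideal0 : 0 \in m. Proof. by rewrite unfold_in eqxx. Qed.

Lemma maxideal_valring x : x \in m -> x \in O.
Proof.
have [->|x0] := eqVneq x 0; first by rewrite rpred0.
by rewrite vm // vO // => /ltW.
Qed.

Lemma maxidealM x y : x \in O -> y \in m -> x * y \in m.
Proof.
have [->|x0] := eqVneq x 0; first by rewrite mul0r maxideal0.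
have [->|y0] := eqVneq y 0; first by rewrite mulr0 maxideal0.
rewrite vO // !vm ?mulf_neq0 // Defs.valM // => vx vy.
by have := oag_ltleD vy vx; rewrite addr0 addrC.
Qed.

Lemma maxidealMr x y : x \in m -> y \in O -> x * y \in m.
Proof. by move=> mx Oy; rewrite mulrC maxidealM. Qed.

Lemma maxidealD x y : x \in m -> y \in m -> x + y \in m.
Proof.
have [->|x0] := eqVneq x 0; first by rewrite add0r.
have [->|y0] := eqVneq y 0; first by rewrite addr0.
have [->|xy0] := eqVneq (x + y) 0; first by rewrite maxideal0.
rewrite !vm // => vx vy; apply: lt_le_trans (Defs.valD v x0 y0 xy0).
by rewrite oag_lt_min vx.
Qed.

Lemma maxidealN x : (- x \in m) = (x \in m).
Proof.
have [->|x0] := eqVneq x 0; first by rewrite oppr0.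
by rewrite !vm ?oppr_eq0 // Defs.valN.
Qed.

Lemma maxidealB x y : x \in m -> y \in m -> x - y \in m.
Proof. by move=> mx my; rewrite maxidealD // maxidealN. Qed.

Lemma maxideal_sum I (r : seq I) (P : pred I) (f : I -> F) :
  (forall i, P i -> f i \in m) -> \sum_(i <- r | P i) f i \in m.
Proof.
by move=> mf; elim/big_rec: _ => [|i y Pi my]; rewrite ?maxideal0 ?maxidealD ?mf.
Qed.

Lemma maxideal1 : 1 \notin m.
Proof. by rewrite vm ?oner_neq0 // Defs.val1 ltxx. Qed.

Lemma valring_inv x : x \notin m -> x^-1 \in O.
Proof.
have [->|x0] := eqVneq x 0; first by rewrite maxideal0.
rewrite vm // vO ?invr_eq0 // valV // -oag_leNgt.
by rewrite -[0 <= _](oag_leD2r (v x)) add0r addNr.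
Qed.

Definition vunit : set F := [set x | x \in O /\ x \notin m].

Lemma vunit_neq0 x : vunit x -> x != 0.
Proof. by move=> [_]; apply: contraNneq => ->; rewrite maxideal0. Qed.

Lemma vunitE x : x != 0 -> vunit x <-> v x = 0.
Proof.
move=> x0; rewrite /vunit /= vO // vm // -oag_leNgt; split=> [[x1 x2]|->].
  by apply/le_anti/andP.
by rewrite lexx.
Qed.

Lemma vunit1 : vunit 1. Proof. by split; rewrite ?rpred1 ?maxideal1. Qed.

Lemma vunitM x y : vunit x -> vunit y -> vunit (x * y).
Proof.
move=> ux uy; have x0 := vunit_neq0 ux; have y0 := vunit_neq0 uy.
move: ux uy; rewrite !vunitE ?mulf_neq0 // => vx vy.
by rewrite Defs.valM // vx vy addr0.
Qed.

Lemma vunitV x : vunit x -> vunit x^-1.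
Proof.
move=> ux; have x0 := vunit_neq0 ux; move: ux.
by rewrite !vunitE ?invr_eq0 // => vx; rewrite valV // vx oppr0.
Qed.

Lemma vunit_addm x e : vunit x -> e \in m -> vunit (x + e).
Proof.
move=> [Ox mx] me; split; first by rewrite rpredD // maxideal_valring.
by apply: contra mx => xe; rewrite -(addrK e x) maxidealB.
Qed.

Lemma vunit_1addm e : e \in m -> vunit (1 + e).
Proof. by apply: vunit_addm; exact: vunit1. Qed.

Lemma vunitMl_m x y : vunit x -> (x * y \in m) = (y \in m).
Proof.
move=> ux; apply/idP/idP; last by apply: maxidealM; case: ux.
move=> xy; rewrite -(mulKf (vunit_neq0 ux) y); apply: maxidealM => //.
by case: (vunitV ux).
Qed.

Lemma vunitMl_O x y : vunit x -> (x * y \in O) = (y \in O).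
Proof.
move=> ux; apply/idP/idP; last by apply: rpredM; case: ux.
move=> xy; rewrite -(mulKf (vunit_neq0 ux) y); apply: rpredM => //.
by case: (vunitV ux).
Qed.

(** Equality in the quotient of the multiplicative group by 1 + m, that is, equality of leading
    terms. *)
Definition sim x y := x != 0 /\ exists2 e, e \in m & y = x * (1 + e).

Lemma sim_neq0r x y : sim x y -> y != 0.
Proof. by move=> [x0 [e me ->]]; rewrite mulf_neq0 // (vunit_neq0 (vunit_1addm me)). Qed.

Lemma sim_refl x : x != 0 -> sim x x.
Proof. by move=> x0; split=> //; exists 0; rewrite ?maxideal0 ?addr0 ?mulr1. Qed.

Lemma simE x y : x != 0 -> sim x y <-> (y - x) / x \in m.
Proof.
move=> x0; split=> [[_ [e me ->]]|mxy].
  by rewrite mulrDr mulr1 addrAC subrr add0r mulrAC divff // mul1r.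
split=> //; exists ((y - x) / x) => //.
by rewrite mulrDr mulr1 mulrCA divff // mulr1 addrC subrK.
Qed.

Lemma one_unitV e : e \in m -> exists2 e', e' \in m & (1 + e)^-1 = 1 + e'.
Proof.
move=> me; have u := vunit_1addm me; have u0 := vunit_neq0 u.
exists (- e / (1 + e)); first by rewrite maxidealMr ?maxidealN //; case: (vunitV u).
apply: (mulIf u0); rewrite mulVf // mulrDl mul1r divfK //.
by rewrite addrK.
Qed.

Lemma sim_sym x y : sim x y -> sim y x.
Proof.
move=> sxy; have y0 := sim_neq0r sxy; split=> //.
have [x0 [e me E]] := sxy; have [e' me' E'] := one_unitV me.
exists e' => //; rewrite E -E' mulfK // (vunit_neq0 (vunit_1addm me)) //.
Qed.

Lemma simM x y x' y' : sim x y -> sim x' y' -> sim (x * x') (y * y').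
Proof.
move=> [x0 [e me ->]] [x'0 [e' me' ->]]; split; first by rewrite mulf_neq0.
exists (e + e' + e * e'); first by rewrite !maxidealD // maxidealM // maxideal_valring.
by ring.
Qed.

Lemma sim_trans y x z : sim x y -> sim y z -> sim x z.
Proof.
move=> [x0 [e me ->]] [_ [e' me' ->]]; split=> //.
exists (e + e' + e * e'); first by rewrite !maxidealD // maxidealM // maxideal_valring.
by ring.
Qed.

Lemma simV x y : sim x y -> sim x^-1 y^-1.
Proof.
move=> [x0 [e me ->]]; split; first by rewrite invr_eq0.
have [e' me' E'] := one_unitV me.
by exists e' => //; rewrite invfM E'.
Qed.

Lemma sim_ratio x y : sim x y -> vunit (y / x).
Proof.
by move=> [x0 [e me ->]]; rewrite mulrC mulrA mulVf // mul1r; apply: vunit_1addm.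
Qed.

Lemma sim_val x y : sim x y -> v x = v y.
Proof.
move=> s; have [x0 _] := s; have y0 := sim_neq0r s.
have := sim_ratio s; rewrite vunitE ?mulf_neq0 ?invr_eq0 //.
by rewrite Defs.valM ?invr_eq0 // valV // => /eqP; rewrite subr_eq0 => /eqP.
Qed.

Lemma val_le_refl x : val_le v x x.
Proof. by rewrite /val_le; case: eqP => //= _; rewrite lexx. Qed.

Lemma val_le_trans y x z : val_le v x y -> val_le v y z -> val_le v x z.
Proof.
rewrite /val_le; have [->|z0] //= := eqVneq z 0.
have [->|y0] //= := eqVneq y 0.
by move=> /andP[-> vxy] vyz; apply: le_trans vyz.
Qed.

Lemma val_le_total x y : val_le v x y || val_le v y x.
Proof.
rewrite /val_le; have [->|x0] //= := eqVneq x 0; first by rewrite orbT.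
by have [->|y0] //= := eqVneq y 0; exact: oag_le_total.
Qed.

Lemma val_le0 x : val_le v x 0. Proof. by rewrite /val_le eqxx. Qed.
Lemma val_ge0 x : val_le v 0 x = (x == 0).
Proof. by rewrite /val_le eqxx /= orbF. Qed.

Lemma val_leN x y : val_le v x (- y) = val_le v x y.
Proof.
have [->|x0] := eqVneq x 0; first by rewrite !val_ge0 oppr_eq0.
by rewrite !val_le_div // mulNr rpredN.
Qed.

Lemma val_leD x y z : val_le v x y -> val_le v x z -> val_le v x (y + z).
Proof.
have [->|x0] := eqVneq x 0; last by rewrite !val_le_div // mulrDl; exact: rpredD.
by rewrite !val_ge0 => /eqP -> /eqP ->; rewrite addr0.
Qed.

Lemma val_leB x y z : val_le v x y -> val_le v x z -> val_le v x (y - z).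
Proof. by move=> xy xz; rewrite val_leD ?val_leN. Qed.

Lemma val_leM z x y : z != 0 -> val_le v (z * x) (z * y) = val_le v x y.
Proof.
move=> z0; have [->|x0] := eqVneq x 0; first by rewrite mulr0 !val_ge0 mulf_eq0 (negbTE z0).
rewrite !val_le_div ?mulf_neq0 //.
by rewrite invfM mulrACA divff // mul1r.
Qed.

Lemma val_le_sim x y z t : sim x z -> sim y t -> val_le v x y = val_le v z t.
Proof.
move=> sx sy; have [x0 _] := sx; have [y0 _] := sy.
rewrite /val_le (negbTE y0) (negbTE (sim_neq0r sy)) x0 (sim_neq0r sx) /=.
by rewrite (sim_val sx) (sim_val sy).
Qed.

Lemma val_le_siml x z y : sim x z -> val_le v x y = val_le v z y.
Proof.
have [->|y0] := eqVneq y 0; first by rewrite !val_le0.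
by move=> /val_le_sim; apply; apply: sim_refl.
Qed.

Lemma val_leMl x y : y \in O -> val_le v x (x * y).
Proof.
have [->|x0] := eqVneq x 0; first by rewrite mul0r val_le0.
by rewrite val_le_div // mulrAC divff // mul1r.
Qed.

Lemma val_ltD x y z : x != 0 -> ~~ val_le v y x -> ~~ val_le v z x -> ~~ val_le v (y + z) x.
Proof. by move=> x0; rewrite !val_lt_div // mulrDl; exact: maxidealD. Qed.

Lemma val_lt_le x y z : ~~ val_le v y x -> val_le v y z -> ~~ val_le v z x.
Proof. move=> yx yz; apply: contra yx; exact: val_le_trans. Qed.

Lemma val_le_lt x y z : val_le v x y -> ~~ val_le v z y -> ~~ val_le v z x.
Proof. by move=> xy zy; apply: contra zy => zx; exact: val_le_trans xy. Qed.

Lemma val_ltW x y : ~~ val_le v y x -> val_le v x y.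
Proof. by have /orP[|->] := val_le_total x y. Qed.

Lemma sim_val_lt x y : x != 0 -> sim x y <-> ~~ val_le v (y - x) x.
Proof. by move=> x0; rewrite simE // val_lt_div. Qed.

End Valuations.

Lemma rmorph_mmap n (R S T : nzRingType) (g : {rmorphism S -> T}) (f : R -> S)
    (h : 'I_n -> S) (P : {mpoly R[n]}) :
  g (mmap f h P) = mmap (g \o f) (g \o h) P.
Proof.
rewrite /mmap raddf_sum /=; apply: eq_bigr => m _.
rewrite rmorphM /mmap1 rmorph_prod /=; congr (_ * _).
by apply: eq_bigr => i _; rewrite rmorphXn.
Qed.

Lemma mmap_ext n (R S : nzRingType) (f f' : R -> S) (h h' : 'I_n -> S) (P : {mpoly R[n]}) :
  f =1 f' -> h =1 h' -> mmap f h P = mmap f' h' P.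
Proof.
move=> ff hh; rewrite /mmap; apply: eq_bigr => m _; rewrite ff; congr (_ * _).
exact: mmap1_eq.
Qed.

Lemma mcoeff0_meval n (R : comNzRingType) (P : {mpoly R[n]}) :
  P@_0 = P.@[fun=> 0].
Proof.
elim/mpolyind: P => [|c m p _ _ IH]; first by rewrite !raddf0.
rewrite raddfD /= mevalD IH; congr (_ + _).
rewrite mcoeffZ mevalZ mcoeffX mevalX; congr (_ * _).
have [->|m0] := eqVneq m 0%MM; first by rewrite big1 // => i _; rewrite mnm0E.
have [i mi] : exists i, m i != 0%N.
  apply/existsP; rewrite -negb_forall; apply: contraNN m0 => /forallP m0.
  by apply/eqP/mnmP => i; rewrite mnm0E; apply/eqP/m0.
by rewrite (bigD1 i) //= expr0n (negbTE mi) mul0r.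
Qed.

Lemma mmap_mwiden n (R S : comNzRingType) (f : {rmorphism R -> S})
    (h : 'I_n.+1 -> S) (Q : {mpoly R[n]}) :
  mmap f h (mwiden Q) = mmap f (h \o @wid n) Q.
Proof. by rewrite mmap_muni muni_mwiden map_polyC hornerC. Qed.

(** * Polynomials on balls: affine substitution and dominant constant terms *)

Section AffineSubstitution.
Variables (F : fieldType) (n : nat).
Implicit Types (P Q : {mpoly F[n]}) (a b : 'I_n -> F) (g h : F).

Definition aff a g P : {mpoly F[n]} :=
  mmap (@mpolyC n F) (fun i => (a i)%:MP + g *: 'X_i) P.

Lemma meval_aff a g P u : (aff a g P).@[u] = P.@[fun i => a i + g * u i].
Proof.
rewrite /meval /aff rmorph_mmap; apply: mmap_ext => [c|i] /=; first by rewrite mmapC.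
by rewrite raddfD /= mmapC mmapZ mmapX mmap1U.
Qed.

Lemma aff_coef0 a g P : (aff a g P)@_0 = P.@[a].
Proof.
rewrite mcoeff0_meval meval_aff; apply: mmap_ext => // i.
by rewrite mulr0 addr0.
Qed.

Lemma aff_comp a g b h P :
  aff b h (aff a g P) = aff (fun i => a i + g * b i) (g * h) P.
Proof.
rewrite /aff rmorph_mmap; apply: mmap_ext => [c|i] /=; first by rewrite mmapC.
rewrite raddfD /= mmapC mmapZ mmapX mmap1U mulrDr addrA; congr (_ + _).
  by rewrite mpolyCD mpolyCM.
by rewrite mul_mpolyC scalerA.
Qed.

(** The chain rule [der_mmap] for the derivation [mderiv i], whose constants include all
    coefficients. *)
Lemma aff_mderiv a g P i : (aff a g P)^`M(i) = g *: aff a g P^`M(i).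
Proof.
have dP : is_derivation (mderiv i : {mpoly F[n]} -> {mpoly F[n]}).
  by split=> x y; [exact: mderivD | exact: mderivM].
have [P' [-> P'0]] := der_mmap dP (dA := fun=> 0)
  (fun c => (esym (mderivC i c) : (0 : F)%:MP = (mderiv i c%:MP))) P (fun j => (a j)%:MP + g *: 'X_j).
rewrite P'0 // raddf0 add0r (bigD1 i) //= big1 => [|j ji].
  rewrite addr0 mderivD mderivC add0r mderivZ mderivX mnm1E eqxx scale1r.
  have -> : (U_(i) - U_(i))%MM = 0%MM by apply/mnmP => j; rewrite mnmBE subnn mnm0E.
  by rewrite mpolyX0 -mul_mpolyC mulr1 mulrC mul_mpolyC.
rewrite mderivD mderivC add0r mderivZ mderivX mnm1E (negbTE ji).
by rewrite scale0r scaler0 mulr0.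
Qed.

Lemma aff_mwiden a' g (Q : {mpoly F[n]}) (a : 'I_n.+1 -> F) :
  a' = a \o @wid n -> mmap (@mpolyC n.+1 F) (fun i => (a i)%:MP + g *: 'X_i) (mwiden Q) =
  mwiden (aff a' g Q).
Proof.
move=> ->; rewrite mmap_mwiden /aff rmorph_mmap.
apply: mmap_ext => [c|i] /=; first by rewrite mwidenC.
by rewrite mwidenD mwidenC mwidenZ mwidenX mnmwiden1.
Qed.

Variable v : valuation F.
Local Notation O := (valring_pred v).
Local Notation m := (maxideal_pred v).

Definition integral P := forall k, P@_k \in O.
Definition infinitesimal P := forall k, P@_k \in m.

(** The constant term strictly dominates. For [aff a g P] this means that [P] keeps a single leading
    term on the polydisc of centre [a] and radius [g]. *)
Definition shape P := P@_0 != 0 /\ forall k, k != 0%MM -> P@_k / P@_0 \in m.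

Lemma integralE P : integral P <-> P \is a mpolyOver n O.
Proof. by split=> [/mpolyOverP|/mpolyOverP]. Qed.

Lemma integral_mmap1 (h : 'I_n -> {mpoly F[n]}) k :
  (forall i, integral (h i)) -> integral (mmap1 h k).
Proof.
move=> hi; apply/integralE; rewrite /mmap1; apply: rpred_prod => i _.
by apply: rpredX; apply/integralE/hi.
Qed.

Lemma integral_aff_var a g i : (forall j, a j \in O) -> g \in O ->
  integral ((a i)%:MP + g *: 'X_i).
Proof.
move=> Oa Og; apply/integralE; rewrite rpredD ?mpolyOverC //.
by rewrite mpolyOverZ // mpolyOverX.
Qed.

Lemma integral_mmap (h : 'I_n -> {mpoly F[n]}) P :
  (forall i, integral (h i)) -> integral P -> integral (mmap (@mpolyC n F) h P).
Proof.
move=> hi iP; apply/integralE; rewrite /mmap; apply: rpred_sum => k _.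
by rewrite rpredM ?mpolyOverC //; apply/integralE/integral_mmap1.
Qed.

Lemma infinitesimal_mmap (h : 'I_n -> {mpoly F[n]}) P :
  (forall i, integral (h i)) -> infinitesimal P -> infinitesimal (mmap (@mpolyC n F) h P).
Proof.
move=> hi iP k; rewrite /mmap raddf_sum /=; apply: maxideal_sum => j _.
by rewrite mcoeffCM maxidealMr //; apply: integral_mmap1.
Qed.

Lemma integral_meval P u : integral P -> (forall i, u i \in O) -> P.@[u] \in O.
Proof.
move=> iP Ou; rewrite mevalE; apply: rpred_sum => k _; rewrite rpredM //.
by apply: rpred_prod => i _; apply: rpredX.
Qed.

Lemma infinitesimal_meval P u : infinitesimal P -> (forall i, u i \in O) -> P.@[u] \in m.
Proof.
move=> iP Ou; rewrite mevalE; apply: maxideal_sum => k _; rewrite maxidealMr //.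
by apply: rpred_prod => i _; apply: rpredX.
Qed.

Lemma shapeE P : shape P <->
  exists c E, [/\ c != 0, infinitesimal E & P = c *: (1 + E)].
Proof.
split=> [[P0 Pm]|[c [E [c0 mE ->]]]].
  exists (P@_0), ((P@_0)^-1 *: P - 1); split=> [//|k|]; last first.
    by rewrite addrC subrK scalerA divff // scale1r.
  rewrite mcoeffB mcoeffZ mcoeff1; have [->|k0] := eqVneq k 0%MM.
    by rewrite mulVf // subrr maxideal0.
  by rewrite subr0 mulrC Pm.
have u := vunit_1addm (mE 0%MM).
have c1 : (c *: (1 + E))@_0 = c * (1 + E@_0) by rewrite mcoeffZ mcoeffD mcoeff1 eqxx.
split; first by rewrite c1 mulf_neq0 // (vunit_neq0 u).
move=> k k0; rewrite c1 mcoeffZ mcoeffD mcoeff1 (negbTE k0) add0r.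
rewrite invfM mulrACA divff // mul1r maxidealMr //.
by case: (vunitV u).
Qed.

Lemma shape_sim P u : shape P -> (forall i, u i \in O) -> sim v P@_0 P.@[u].
Proof.
move=> /shapeE[c [E [c0 mE ->]]] Ou.
have E0 : sim v (1 + E@_0) (1 + E.@[u]).
  have u1 := vunit_1addm (mE 0%MM); apply/simE; first exact: vunit_neq0 u1.
  rewrite maxidealMr //; last by case: (vunitV u1).
  by rewrite opprD addrACA subrr add0r maxidealB // infinitesimal_meval.
rewrite mevalZ mevalD meval1 mcoeffZ mcoeffD mcoeff1 eqxx.
by apply: simM => //; apply: sim_refl.
Qed.

Lemma shape_aff P b h : shape P -> (forall i, b i \in O) -> h \in O -> shape (aff b h P).
Proof.
move=> /shapeE[c [E [c0 mE ->]]] Ob Oh; apply/shapeE; exists c, (aff b h E); split=> //.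
  by apply: infinitesimal_mmap => // i; apply: integral_aff_var.
by rewrite /aff mmapZ raddfD /= rmorph1 mul_mpolyC.
Qed.

End AffineSubstitution.

(** * Zeros of differential polynomials over monotone fields *)

Lemma mnm_neq0 n (k : 'X_{1..n}) : k != 0%MM -> exists i k', k = (k' + U_(i))%MM.
Proof.
move=> k0; have [i ki] : exists i, k i != 0%N.
  apply/existsP; rewrite -negb_forall; apply: contraNN k0 => /forallP k0.
  by apply/eqP/mnmP => i; rewrite mnm0E; apply/eqP/k0.
exists i, (k - U_(i))%MM; rewrite submK //; apply/mnm_lepP => j.
by rewrite mnm1E; case: eqP => [<-|//]; rewrite lt0n.
Qed.

Section LinearPart.
Variables (F : fieldType) (v : valuation F) (n : nat).

Lemma coef_linear (c0 : F) (e : 'I_n -> F) k :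
  (c0%:MP + \sum_i e i *: 'X_i : {mpoly F[n]})@_k =
  c0 * (k == 0%MM)%:R + \sum_i e i * (U_(i) == k)%MM%:R.
Proof.
rewrite mcoeffD mcoeffC (raddf_sum (mcoeff k)) /=; congr (_ + _).
by apply: eq_bigr => j _; rewrite mcoeffZ mcoeffX.
Qed.

Lemma linear_part (P : {mpoly F[n]}) c0 e : P@_0 = c0 -> (forall i, P@_U_(i) = e i) ->
  (forall k, (1 < mdeg k)%N -> P@_k \in maxideal_pred v) ->
  infinitesimal v (P - (c0%:MP + \sum_i e i *: 'X_i)).
Proof.
move=> P0 Pe Pm k; rewrite mcoeffB coef_linear.
have [->|k0] := eqVneq k 0%MM.
  rewrite big1 => [|i _]; last by rewrite mnm1_eq0 mulr0.
  by rewrite mulr1 addr0 P0 subrr maxideal0.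
rewrite mulr0 add0r; have [k2|] := boolP (1 < mdeg k)%N.
  rewrite big1 ?subr0 => [|i _]; first exact: Pm.
  by case: eqP => [E|]; rewrite ?mulr0 //; move: k2; rewrite -E mdeg1.
rewrite -leqNgt leq_eqVlt ltnS leqn0 mdeg_eq0 (negbTE k0) orbF => /mdeg1P[i /eqP ->].
rewrite (bigD1 i) //= eqxx mulr1 big1 ?addr0 => [|j ji]; last by rewrite eq_mnm1 (negbTE ji) mulr0.
by rewrite Pe subrr maxideal0.
Qed.

End LinearPart.

Section ValuedDifferentialFields.
Variable M : valuedDiffField.
Local Notation v := (vdf_val M).
Local Notation O := (valring_pred v).
Local Notation m := (maxideal_pred v).
Implicit Types (x y z g : M).

Lemma reduction_eq0 (x : valring v) : (reduction x == 0) = (val x \in m).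
Proof.
rewrite /reduction -(rmorph0 (\pi_({ideal_quot (maxideal (v := v))})%qT)).
by rewrite -Quotient.idealrBE subr0.
Qed.

(** The least positive integer in the maximal ideal would be prime: a proper divisor is a unit, and
    its cofactor would be a smaller member. The residue field would then have that
    characteristic. *)
Lemma nat_vunit k : vunit v k.+1%:R.
Proof.
split; first by rewrite rpred_nat.
apply/negP => km.
have ex : exists j, ((0 < j)%N && ((j%:R : M) \in m)) by exists k.+1; rewrite km.
case: (ex_minnP ex) => p /andP[p0 pm] minp.
have p1 : (1 < p)%N.
  by case: p p0 pm {minp} => [|[|p]] // _; rewrite (negbTE (maxideal1 v)).
have prp : prime p.
  apply/primeP; split=> // d dp; have d0 := dvdn_gt0 p0 dp.
  have [->|d1] := eqVneq d 1%N; rewrite //= eqn_leq dvdn_leq //=.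
  have [dm|dm] := boolP ((d%:R : M) \in m); first by apply: minp; rewrite d0.
  have ud : vunit v d%:R by split; rewrite ?rpred_nat.
  have := pm; rewrite -{1}(divnK dp) mulnC natrM vunitMl_m // => pdm.
  have /minp : (0 < p %/ d)%N && (((p %/ d)%:R : M) \in m).
    by rewrite pdm divn_gt0 // dvdn_leq.
  rewrite leqNgt ltn_Pdiv // ltn_neqAle eq_sym d1 //.
have := vdf_res_pchar0 M p; rewrite !inE prp /= => /negbT /negP; apply.
have -> : (p%:R : residue v) = reduction (p%:R : valring v).
  by rewrite /reduction rmorph_nat.
by rewrite reduction_eq0 rmorph_nat.
Qed.

Lemma char0_vdf k : (k.+1%:R : M) != 0.
Proof. exact: vunit_neq0 (nat_vunit k). Qed.

Hypothesis Mmon : monotone M.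

Lemma val_le_der x y : val_le v x y -> val_le v x (der y).
Proof. by move=> xy; apply: val_le_trans (Mmon y). Qed.

Lemma val_le_iter x y i : val_le v x y -> val_le v x (iter i der y).
Proof. by move=> xy; elim: i => //= i; apply: val_le_der. Qed.

Lemma derO x : x \in O -> der x \in O.
Proof.
rewrite -[x]divr1 -val_le_div ?oner_neq0 // => /val_le_der.
by rewrite val_le_div ?oner_neq0 // !divr1.
Qed.

Lemma iterO x i : x \in O -> iter i der x \in O.
Proof. by move=> Ox; elim: i => //= i; apply: derO. Qed.

Lemma derm x : x \in m -> der x \in m.
Proof.
move=> mx; have [->|x0] := eqVneq x 0; first by rewrite (is_der0 (derP M)) maxideal0.
have := Mmon x; rewrite val_le_div // => Odx.
by rewrite -(divfK x0 (der x)) maxidealM.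
Qed.

Lemma iter_derD i x y : iter i der (x + y) = iter i der x + iter i der y :> M.
Proof. by elim: i => //= i ->; rewrite (is_derD (derP M)). Qed.

Lemma iter_derB i x y : iter i der (x - y) = iter i der x - iter i der y :> M.
Proof. by elim: i => //= i ->; rewrite (is_derB (derP M)). Qed.

(* By the Leibniz rule, der^i (g z) = \sum_j twist g i j * der^j z. *)
Fixpoint twist g (i j : nat) : M :=
  match i, j with
  | 0, 0 => g
  | 0, _.+1 => 0
  | i'.+1, 0 => der (twist g i' 0)
  | i'.+1, j'.+1 => der (twist g i' j) + twist g i' j'
  end.

Lemma twist_gt g i j : (i < j)%N -> twist g i j = 0.
Proof.
elim: i j => [|i IH] [|j] //= ij; rewrite !IH ?(ltnW ij) // (is_der0 (derP M)).
by rewrite addr0.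
Qed.

Lemma twist_diag g i : twist g i i = g.
Proof. by elim: i => //= i IH; rewrite twist_gt // (is_der0 (derP M)) add0r. Qed.

Lemma val_le_twist g i j : val_le v g (twist g i j).
Proof.
elim: i j => [|i IH] [|j] /=; rewrite ?val_le_refl ?val_le0 //.
  exact: val_le_der.
by apply: val_leD => //; apply: val_le_der.
Qed.

Lemma iter_der_twist g z i n : (i < n)%N ->
  iter i der (g * z) = \sum_(j < n) twist g i j * iter j der z.
Proof.
elim: i n => [|i IH] [|n] // ni.
  by rewrite big_ord_recl big1 ?addr0 // => j _; rewrite mul0r.
rewrite iterS (IH n) ?(leq_trans ni) //.
rewrite (big_morph (@der M) (is_derD (derP M)) (is_der0 (derP M))).
under eq_bigr do rewrite (is_derM (derP M)).
rewrite big_split /= [RHS]big_ord_recl /=.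
under [in RHS]eq_bigr do rewrite mulrDl.
rewrite big_split /= addrA; congr (_ + _).
case: n ni => // n ni; rewrite big_ord_recl [in RHS]big_ord_recr /=.
rewrite (twist_gt g (j := n.+1)) // (is_der0 (derP M)) mul0r addr0.
by congr (_ + _); apply: eq_bigr.
Qed.

Section HenselData.
Variables (n : nat) (G : {mpoly M[n]}) (x g : M).

(* On the ball around x of radius g, each nonzero partial derivative of G is
   constant up to factors in 1 + m, and the one at l0 dominates. *)
Record hensel_partials (l0 : 'I_n) : Prop := HenselPartials {
  hp_shape : forall l, G^`M(l) = 0 \/ shape v (aff (jet der x) g G^`M(l));
  hp_min : forall l, val_le v (G^`M(l0)).@[jet der x] (G^`M(l)).@[jet der x];
  hp_neq0 : (G^`M(l0)).@[jet der x] != 0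
}.

Definition hensel_data l0 := hensel_partials l0 /\
  val_le v (g * (G^`M(l0)).@[jet der x]) G.@[jet der x].

Variable l0 : 'I_n.
Hypotheses (g0 : g != 0) (hp : hensel_partials l0).

Let c l := (G^`M(l)).@[jet der x].
Let h := g * c l0.
Let Q := aff (jet der x) g G.

Let h0 : h != 0. Proof. by rewrite mulf_neq0 // (hp_neq0 hp). Qed.
Let c0 : c l0 != 0. Proof. exact: hp_neq0 hp. Qed.

Let Q_U i : Q@_U_(i) / h = c i / c l0.
Proof.
have : (Q^`M(i))@_0 = g * c i by rewrite aff_mderiv mcoeffZ aff_coef0.
rewrite mcoeff_mderiv add0m mnm0E mulr1n => ->.
by rewrite /h invfM mulrACA divff // mul1r.
Qed.

(** Taylor coefficients are recovered from those of the partial derivatives: the coefficient at k' +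
    U_i, times the positive integer k'_i + 1, is [g] times a coefficient of the i-th partial
    derivative. Positive integers are units, so the division is harmless. *)
Let Q_O k : k != 0%MM -> Q@_k / h \in O.
Proof.
move=> k0; have [i [k' Ek]] := mnm_neq0 k0.
have := mcoeff_mderiv i Q k'; rewrite -Ek aff_mderiv mcoeffZ -mulr_natl => E.
rewrite -(vunitMl_O _ (nat_vunit (k' i))) mulrA -E /h invfM mulrACA divff // mul1r.
case: (hp_shape hp i) => [->|[s0 sm]]; first by rewrite /aff raddf0 mcoeff0 mul0r rpred0.
have ci : (aff (jet der x) g G^`M(i))@_0 / c l0 \in O.
  by rewrite aff_coef0 -val_le_div //; case: hp.
have [->|k'0] := eqVneq k' 0%MM; first exact: ci.
by rewrite -(divfK s0 _@_k') -(mulrA (_ / _)) rpredM // maxideal_valring // sm.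
Qed.

Let Q_m k : (1 < mdeg k)%N -> Q@_k / h \in m.
Proof.
move=> k2; have k0 : k != 0%MM by apply: contraTneq k2 => ->; rewrite mdeg0.
have [i [k' Ek]] := mnm_neq0 k0.
have := mcoeff_mderiv i Q k'; rewrite -Ek aff_mderiv mcoeffZ -mulr_natl => E.
rewrite -(vunitMl_m _ (nat_vunit (k' i))) mulrA -E /h invfM mulrACA divff // mul1r.
case: (hp_shape hp i) => [->|[s0 sm]]; first by rewrite /aff raddf0 mcoeff0 mul0r maxideal0.
have ci : (aff (jet der x) g G^`M(i))@_0 / c l0 \in O.
  by rewrite aff_coef0 -val_le_div //; case: hp.
have k'0 : k' != 0%MM by apply: contraTneq k2 => E'; rewrite Ek E' add0m mdeg1.
by rewrite -(divfK s0 _@_k') -(mulrA (_ / _)) maxidealMr // sm.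
Qed.

(** Used in contrapositive form: where [G] has no constant leading term, v(G(x)) is at least v(h),
    which is the second half of [hensel_data]. *)
Lemma shape_of_dominant_value : ~~ val_le v h G.@[jet der x] -> shape v Q.
Proof.
move=> Gh; have G0 : G.@[jet der x] != 0 by apply: contraNneq Gh => ->; rewrite val_le0.
split; rewrite aff_coef0 // => k k0; rewrite -val_lt_div //.
have := Q_O k0; rewrite -val_le_div //; exact: val_lt_le.
Qed.

Let u (i j : nat) := twist g i j / g.
Let L (i : 'I_n) : {mpoly M[n]} := \sum_(j < n) u i j *: 'X_j.
Let W := mmap (@mpolyC n M) L (h^-1 *: Q).

Let L_coef i k : (L i)@_k = \sum_(j < n) u i j * (U_(j) == k)%MM%:R.
Proof. by rewrite raddf_sum /=; apply: eq_bigr => j _; rewrite mcoeffZ mcoeffX. Qed.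

Let u_O i j : u i j \in O. Proof. by rewrite -val_le_div // val_le_twist. Qed.

Let L_U i l : (L i)@_U_(l) = u i l.
Proof.
rewrite L_coef (bigD1 l) //= eqxx mulr1 big1 ?addr0 // => j jl.
by rewrite eq_mnm1 (negbTE jl) mulr0.
Qed.

Let L_other i k : mdeg k != 1%N -> (L i)@_k = 0.
Proof.
move=> k1; rewrite L_coef big1 // => j _.
by have [E|] := eqVneq U_(j)%MM k; [move: k1; rewrite -E mdeg1 | rewrite mulr0].
Qed.

Let L_int i : integral v (L i).
Proof.
by move=> k; rewrite L_coef rpred_sum // => j _; rewrite rpredM ?u_O ?rpred_nat.
Qed.

Hypothesis hc : val_le v h G.@[jet der x].

(* The affine substitution x + gY is followed by the linear change of variables
   given by der^i (g z) / g, which is unitriangular over the valuation ring. *)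
Lemma hensel_twist : exists W : {mpoly M[n]}, [/\ integral v W,
  forall k, (1 < mdeg k)%N -> W@_k \in m,
  exists l, W@_U_(l) \notin m,
  W@_0 = G.@[jet der x] / h &
  forall z, G.@[jet der (x + g * z)] = h * W.@[jet der z]].
Proof.
pose e i := Q@_U_(i) / h.
pose lin : {mpoly M[n]} := (Q@_0 / h)%:MP + \sum_i e i *: 'X_i.
pose R := h^-1 *: Q - lin.
have Rm : infinitesimal v R.
  apply: linear_part => [|i|k k2]; rewrite mcoeffZ mulrC //; exact: Q_m.
have WE : W = (Q@_0 / h)%:MP + \sum_i e i *: L i + mmap (@mpolyC n M) L R.
  have ER : h^-1 *: Q = lin + R by rewrite addrC subrK.
  rewrite /W ER [LHS]raddfD /=; congr (_ + _); rewrite [LHS]raddfD /= mmapC.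
  congr (_ + _); rewrite [LHS]raddf_sum /=; apply: eq_bigr => i _.
  by rewrite mmapZ mmapX mmap1U mul_mpolyC.
have RLm : infinitesimal v (mmap (@mpolyC n M) L R) by apply: (infinitesimal_mmap L_int).
have Wk k : W@_k = (Q@_0 / h) * (k == 0%MM)%:R + \sum_i e i * (L i)@_k
    + (mmap (@mpolyC n M) L R)@_k.
  rewrite WE !mcoeffD mcoeffC (raddf_sum (mcoeff k)) /=; congr (_ + _ + _).
  by apply: eq_bigr => j _; rewrite mcoeffZ.
have eO i : e i \in O by apply: Q_O; rewrite mnm1_eq0.
exists W; split.
- apply: integral_mmap => // k; rewrite mcoeffZ mulrC; have [->|] := eqVneq k 0%MM; last exact: Q_O.
  by rewrite aff_coef0 -val_le_div.
- move=> k k2; rewrite Wk; have -> : (k == 0%MM) = false.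
    by apply/negP => /eqP E; move: k2; rewrite E mdeg0.
  rewrite mulr0 add0r big1 ?add0r // => i _.
  by rewrite L_other ?mulr0 // neq_ltn k2 orbT.
- have ex : exists l : 'I_n, e l \notin m.
    by exists l0; rewrite /e Q_U divff ?maxideal1.
  (* The last index whose linear coefficient is a unit. In the coefficient of [W] at [l], indices i
     < l contribute nothing by triangularity, indices i > l contribute infinitesimals, and i = l
     contributes [e l] itself since the diagonal entry is 1. *)
  pose l := [arg max_(l > l0 | e l \notin m) (l : nat)].
  have l0m : e l0 \notin m by rewrite /e Q_U divff ?maxideal1.
  have [lm lmax] : e l \notin m /\ forall j, e j \notin m -> (j <= l)%N.
    by rewrite /l; case: arg_maxnP.
  exists l; rewrite Wk mnm1_eq0 mulr0 add0r (bigD1 l) //= L_U /u twist_diag divff // mulr1.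
  apply: contra lm => lm; rewrite -(addrK (\sum_(i < n | i != l) e i * (L i)@_U_(l)
     + (mmap (@mpolyC n M) L R)@_U_(l)) (e l)) addrA maxidealB // maxidealD //.
  apply: maxideal_sum => i il; rewrite L_U.
  have [im|im] := boolP (e i \in m); first by rewrite maxidealMr.
  rewrite /u twist_gt ?mul0r ?mulr0 ?maxideal0 // ltn_neqAle il lmax //.
- rewrite Wk eqxx mulr1 big1 ?addr0 => [|i _]; last first.
    by rewrite L_other ?mulr0 // mdeg0.
  suff -> : (mmap (@mpolyC n M) L R)@_0 = 0 by rewrite addr0 aff_coef0.
  have R0 : R.@[fun=> 0] = 0.
    by rewrite -mcoeff0_meval mcoeffB coef_linear eqxx mulr1 big1 => [|i _];
      rewrite ?mnm1_eq0 ?mulr0 // addr0 mcoeffZ mulrC subrr.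
  rewrite mcoeff0_meval /meval rmorph_mmap -[RHS]R0; apply: mmap_ext => [a|i] /=.
    by rewrite mmapC.
  by rewrite -/(meval _ (L i)) -mcoeff0_meval L_other // mdeg0.
- move=> z; rewrite /W mmapZ.
  have -> : ((h^-1)%:MP_[n] * mmap (@mpolyC n M) L Q).@[jet der z] =
      h^-1 * (mmap (@mpolyC n M) L Q).@[jet der z] by rewrite mevalM mevalC.
  rewrite mulrA divff // mul1r /meval rmorph_mmap.
  transitivity (Q.@[fun i => (L i).@[jet der z]]); last first.
    by apply: mmap_ext => [a|i] //=; rewrite mmapC.
  rewrite meval_aff; apply: mmap_ext => // i; rewrite {1}/jet iter_derD; congr (_ + _).
  rewrite (@iter_der_twist _ _ _ n) // /L raddf_sum /= mulr_sumr; apply: eq_bigr => j _.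
  by rewrite mevalZ mevalXU /u mulrA mulrCA divff // mulr1.
Qed.

End HenselData.

(** The smaller ball arises from the larger one by an integral affine substitution, since the jet of
    a' - a divided by [g] is integral by monotonicity. *)
Lemma shape_near n (P : {mpoly M[n]}) a g a' g' : g != 0 ->
  shape v (aff (jet der a) g P) -> val_le v g (a' - a) -> val_le v g g' ->
  shape v (aff (jet der a') g' P) /\ sim v P.@[jet der a] P.@[jet der a'].
Proof.
move=> g0 sP ga gg.
pose b (i : 'I_n) := iter i der (a' - a) / g.
have Ob i : b i \in O by rewrite -val_le_div // val_le_iter.
have Eb : (fun i => jet der a i + g * b i) = jet der a'.
  apply/funext => i; rewrite /b mulrCA divff // mulr1 /jet -iter_derD.
  by rewrite addrC subrK.
have Oh : g' / g \in O by rewrite -val_le_div.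
split; last by have := shape_sim sP Ob; rewrite meval_aff aff_coef0 Eb.
have Eg : g * (g' / g) = g' by rewrite mulrCA divff // mulr1.
by have := shape_aff sP Ob Oh; rewrite aff_comp Eb Eg.
Qed.

Lemma hensel_partials_near n (G : {mpoly M[n]}) a g a' g' l0 : g != 0 ->
  hensel_partials G a g l0 -> val_le v g (a' - a) -> val_le v g g' ->
  hensel_partials G a' g' l0 /\ sim v (G^`M(l0)).@[jet der a] (G^`M(l0)).@[jet der a'].
Proof.
move=> g0 [sh mn n0] ga gg.
have near l : G^`M(l) = 0 \/ shape v (aff (jet der a') g' G^`M(l)) /\
    sim v (G^`M(l)).@[jet der a] (G^`M(l)).@[jet der a'].
  by case: (sh l) => [->|sl]; [left | right; apply: shape_near ga gg].
have s0 : sim v (G^`M(l0)).@[jet der a] (G^`M(l0)).@[jet der a'].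
  by case: (near l0) => [E|[] //]; move: n0; rewrite E meval0 eqxx.
split; last exact: s0.
split=> [l|l|]; last exact: sim_neq0r s0.
  by case: (near l) => [|[]]; [left | right].
case: (near l) => [->|[_ sl]]; first by rewrite meval0 val_le0.
by rewrite -(val_le_sim s0 sl).
Qed.

(** The Newton form on arbitrary balls. The Hahn field obtains it from spherical completeness, [F]
    and its ultrapower from [zeros_henselian]. *)
Definition henselian := forall n (G : {mpoly M[n]}) x g l0, g != 0 ->
  hensel_data G x g l0 -> exists2 z, z \in O & G.@[jet der (x + g * z)] = 0.

(** Differential-henselianity with coefficients taken in the field, a form that passes to
    ultrapowers coefficient by coefficient. *)
Definition zeros_of_linear_residue := forall n (W : {mpoly M[n]}),
  integral v W -> (forall k, (1 < mdeg k)%N -> W@_k \in m) ->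
  (exists l, W@_U_(l) \notin m) -> exists2 z, z \in O & W.@[jet der z] = 0.

Lemma diff_henselian_zeros : diff_henselian M -> zeros_of_linear_residue.
Proof.
move=> [_ dh] n W iW mW [l Wl].
pose W' : {mpoly (valring v)[n]} := \sum_(k <- msupp W) (ValRing (iW k)) *: 'X_[k].
have W'k k : val (W'@_k) = W@_k.
  rewrite (raddf_sum (mcoeff k)) (raddf_sum (val : valring v -> M)) [in RHS](mpolyE W).
  rewrite (raddf_sum (mcoeff k)) /=; apply: eq_bigr => j _.
  by rewrite !mcoeffZ !mcoeffX; case: (j == k); rewrite ?mulr1 ?mulr0.
have [|y Oy Ey] := dh n W'.
- have red k : (map_mpoly (@reduction M v) W')@_k = reduction W'@_k.
    exact: (mcoeff_map_mpoly (\pi_(residue v)%qT)).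
  apply/eqP; rewrite eqn_leq; apply/andP; split.
    rewrite msizeE; apply/bigmax_leqP_seq => k + _; rewrite mcoeff_msupp red reduction_eq0 W'k.
    by rewrite ltnNge; apply: contra => k2; apply: mW.
  have : (U_(l))%MM \in msupp (map_mpoly (@reduction M v) W').
    by rewrite mcoeff_msupp red reduction_eq0 W'k.
  by move=> /msize_mdeg_lt; rewrite mdeg1.
exists y => //; rewrite -[RHS]Ey; congr (_.@[_]); apply/mpolyP => k.
by rewrite -W'k; apply/esym/(mcoeff_map_mpoly (val : valring v -> M)).
Qed.

Lemma zeros_henselian : zeros_of_linear_residue -> henselian.
Proof.
move=> zM n G x g l0 g0 [hp hc]; have [W [iW mW lW _ E]] := hensel_twist g0 hp hc.
have [z Oz Wz] := zM _ _ iW mW lW.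
by exists z => //; rewrite E Wz mulr0.
Qed.

End ValuedDifferentialFields.

(** * Liftings of the residue field and the value group *)

(* rep lifts the residue field and sec is a cross-section of the valuation. *)
Record lifting (k : diffField) (G : oagType) (c : G -> k) (M : valuedDiffField) := Lifting {
  rep : {rmorphism k -> M};
  sec : G -> M;
  rep_der : forall b, der (rep b) = rep (der b);
  rep_unit : forall b, b != 0 -> vunit (vdf_val M) (rep b);
  sec0 : sec 0 = 1;
  secD : forall a b, sec (a + b) = sec a * sec b;
  sec_der : forall a, der (sec a) = rep (c a) * sec a;
  sec_le : forall a b, val_le (vdf_val M) (sec a) (sec b) = (a <= b);
  lead_exists : forall f, f != 0 ->
    exists b a, b != 0 /\ sim (vdf_val M) (rep b * sec a) f
}.

Section Liftings.
Variables (k : diffField) (G : oagType) (c : G -> k) (M : valuedDiffField).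
Variable L : lifting c M.
Local Notation v := (vdf_val M).

Definition lead b a := rep L b * sec L a.

Lemma sec_neq0 a : sec L a != 0.
Proof.
have : sec L a * sec L (- a) = 1 by rewrite -secD subrr sec0.
by apply: contra_eqN => /eqP ->; rewrite mul0r eq_sym oner_neq0.
Qed.

Lemma secN a : sec L (- a) = (sec L a)^-1.
Proof.
apply: (mulfI (sec_neq0 a)); rewrite divff ?sec_neq0 //.
by rewrite -secD subrr sec0.
Qed.

Lemma lead_neq0 b a : b != 0 -> lead b a != 0.
Proof. by move=> b0; rewrite mulf_neq0 ?sec_neq0 // fmorph_eq0. Qed.

Lemma leadM b a b' a' : lead (b * b') (a + a') = lead b a * lead b' a'.
Proof. by rewrite /lead rmorphM secD mulrACA. Qed.

Lemma leadV b a : lead b^-1 (- a) = (lead b a)^-1.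
Proof. by rewrite /lead fmorphV secN invfM. Qed.

Lemma val_le_lead b a b' a' : b != 0 -> b' != 0 ->
  val_le v (lead b a) (lead b' a') = (a <= a').
Proof.
move=> b0 b'0; rewrite -(sec_le L) !val_le_div ?lead_neq0 ?sec_neq0 //.
rewrite /lead invfM mulrACA; apply: vunitMl_O.
by apply: vunitM; [|apply: vunitV]; apply: rep_unit.
Qed.

Lemma lead_inj b a b' a' : b != 0 -> b' != 0 -> sim v (lead b a) (lead b' a') ->
  b = b' /\ a = a'.
Proof.
move=> b0 b'0 s; have aa : a = a'.
  have e x y : sim v x y -> val_le v x y /\ val_le v y x.
    move=> sxy; have x0 := proj1 sxy; rewrite -(val_le_sim (sim_refl v x0) sxy) val_le_refl.
    by rewrite -(val_le_sim sxy (sim_refl v x0)) val_le_refl.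
  by have [] := e _ _ s; rewrite !val_le_lead // => h1 h2; apply/le_anti/andP.
split=> //; apply/eqP; rewrite eq_sym -subr_eq0; apply/negPn/negP => bb.
move: s; rewrite -aa simE ?lead_neq0 // /lead -mulrBl -rmorphB.
rewrite invfM mulrACA mulfV ?sec_neq0 // mulr1 vunitMl_m; last exact: rep_unit.
by case: (vunitV (rep_unit L b0)) => _ /negP.
Qed.

End Liftings.

(** A pair is a ball: its centre, and an element whose value is the radius, with 0 giving a single
    point. The condition on two pairs says that their balls meet. *)
Definition countably_complete (M : valuedDiffField) :=
  forall C : set (M * M), countable C ->
    (forall p q, C p -> C q -> val_le (vdf_val M) p.2 (p.1 - q.1) ||
                               val_le (vdf_val M) q.2 (p.1 - q.1)) ->
  exists y, forall p, C p -> val_le (vdf_val M) p.2 (y - p.1).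

Section MapPolynomials.
Variables (A : fieldType) (M : valuedDiffField) (i : {rmorphism A -> M}) (dA : A -> A).
Hypothesis i_der : forall a, i (dA a) = der (i a).
Local Notation v := (vdf_val M).

Lemma i_iter a j : i (iter j dA a) = iter j der (i a).
Proof. by elim: j => //= j IH; rewrite i_der IH. Qed.

Lemma map_mpoly_aff n (a : 'I_n -> A) g (P : {mpoly A[n]}) :
  map_mpoly i (aff a g P) = aff (i \o a) (i g) (map_mpoly i P).
Proof.
rewrite /aff rmorph_mmap /map_mpoly rmorph_mmap.
apply: mmap_ext => [b|j] /=; first by rewrite -/(map_mpoly i _) map_mpolyC mmapC.
rewrite -!/(map_mpoly i _) raddfD /= map_mpolyC map_mpolyZ map_mpolyX.
by rewrite mmapX mmap1U.
Qed.

Lemma map_mpoly_mderiv n (P : {mpoly A[n]}) l :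
  map_mpoly i P^`M(l) = (map_mpoly i P)^`M(l).
Proof.
apply/mpolyP => m; rewrite !(mcoeff_map_mpoly, mcoeff_mderiv).
by rewrite raddfMn.
Qed.

Lemma meval_map_mpoly n (P : {mpoly A[n]}) h : (map_mpoly i P).@[h] = mmap i h P.
Proof.
rewrite /meval /map_mpoly rmorph_mmap; apply: mmap_ext => [b|j] /=; first by rewrite mmapC.
by rewrite mmapX mmap1U.
Qed.

Lemma meval_map_mpoly_jet n (P : {mpoly A[n]}) a :
  (map_mpoly i P).@[jet der (i a)] = i P.@[jet dA a].
Proof.
rewrite meval_map_mpoly /meval rmorph_mmap; apply: mmap_ext => // j.
by rewrite /jet /= i_iter.
Qed.

Lemma aff_jet n (P : {mpoly A[n]}) a g :
  map_mpoly i (aff (jet dA a) g P) = aff (jet der (i a)) (i g) (map_mpoly i P).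
Proof.
have -> : jet der (i a) = i \o jet dA a.
  by move=> n'; apply/funext => j; rewrite /jet /= i_iter.
exact: map_mpoly_aff.
Qed.

Lemma map_mpoly_eq0 n (P : {mpoly A[n]}) : (map_mpoly i P == 0) = (P == 0).
Proof.
apply/eqP/eqP => [E|->]; last exact: raddf0.
apply/mpolyP => m; apply: (fmorph_inj i).
by rewrite -mcoeff_map_mpoly E !mcoeff0 raddf0.
Qed.

Lemma map_mpoly_mwiden n (P : {mpoly A[n]}) :
  map_mpoly i (mwiden P) = mwiden (map_mpoly i P).
Proof.
rewrite {1}/map_mpoly mmap_mwiden /map_mpoly rmorph_mmap.
apply: mmap_ext => [b|j] /=; first by rewrite mwidenC.
by rewrite mwidenX mnmwiden1.
Qed.

Hypothesis Mmon : monotone M.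

(* [Adm a g] says that the ball around a with radius g belongs to the cut. *)
Lemma zero_near n (P : {mpoly A[n]}) (N : set M) (Adm : A -> A -> Prop) l0 a0 g0 x :
  diff_closed der N -> (forall a, N (i a)) -> N x ->
  (forall x' g l, N x' -> N g -> g != 0 -> hensel_data (map_mpoly i P) x' g l ->
     exists2 z, N z & z \in valring_pred v /\ (map_mpoly i P).@[jet der (x' + g * z)] = 0) ->
  (forall a g, Adm a g -> g != 0) ->
  (forall a g a' g', Adm a g -> Adm a' g' -> exists a2 g2, [/\ Adm a2 g2,
     val_le v (i g) (i a2 - i a), val_le v (i g) (i g2),
     val_le v (i g') (i a2 - i a') & val_le v (i g') (i g2)]) ->
  Adm a0 g0 -> hensel_partials (map_mpoly i P) (i a0) (i g0) l0 ->
  (forall a g, Adm a g -> ~ shape v (aff (jet der (i a)) (i g) (map_mpoly i P))) ->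
  (forall a g, Adm a g -> val_le v (i g) (x - i a)) ->
  exists2 z, N z & (map_mpoly i P).@[jet der z] = 0 /\
    forall a g, Adm a g -> val_le v (i g) (z - i a).
Proof.
set Q := map_mpoly i P => NP Ni Nx hN Adm0 dir A0 hp0 nsh nearx.
have ig0 a g : Adm a g -> i g != 0 by move=> /Adm0; rewrite fmorph_eq0.
pose c := (Q^`M(l0)).@[jet der x].
have [hpx sx] := hensel_partials_near Mmon (ig0 _ _ A0) hp0 (nearx _ _ A0) (val_le_refl _ _).
have c0 : c != 0 by apply: sim_neq0r sx.
(* On no ball of the cut does [Q] have a constant leading term, so [hensel_twist] applies there and
   writes Q(x) as an integral multiple of radius times derivative. *)
have big a g : Adm a g -> val_le v (i g * c) Q.@[jet der x].
  move=> Ag; have [a2 [g2 [A2 _ gg2 aa2 gg02]]] := dir _ _ _ _ Ag A0.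
  have [hp2 s2] := hensel_partials_near Mmon (ig0 _ _ A0) hp0 aa2 gg02.
  have [_ s2x] := hensel_partials_near Mmon (ig0 _ _ A2) hp2 (nearx _ _ A2) (val_le_refl _ _).
  have c2 : val_le v (i g2 * (Q^`M(l0)).@[jet der (i a2)]) Q.@[jet der (i a2)].
    by apply: contrapT => /negP/(shape_of_dominant_value (ig0 _ _ A2) hp2); apply: nsh.
  have [W [iW _ _ _ EW]] := hensel_twist Mmon (ig0 _ _ A2) hp2 c2.
  pose z := (x - i a2) / i g2.
  have Oz : z \in valring_pred v by rewrite -val_le_div ?(ig0 _ _ A2) // nearx.
  have := EW z; rewrite mulrCA divff ?(ig0 _ _ A2) // mulr1 addrC subrK => ->.
  apply: (val_le_trans (y := i g2 * c)); first by rewrite ![_ * c]mulrC val_leM.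
  rewrite -(val_le_siml _ (simM (sim_refl v (ig0 _ _ A2)) s2x)).
  by apply/val_leMl/integral_meval => // j; apply: iterO.
have [Q0|Q0] := eqVneq Q.@[jet der x] 0; first by exists x.
(* With this radius [g * c] is exactly Q(x), so the Newton condition holds at [x]; and x + gO stays
   inside every ball of the cut, hence so does the zero found in it. *)
pose g := Q.@[jet der x] / c; have g_neq0 : g != 0 by rewrite mulf_neq0 ?invr_eq0.
have Adm_g a g' : Adm a g' -> val_le v (i g') g.
  by move=> /big Ag; rewrite -(val_leM _ _ _ c0) mulrC [c * g]mulrC divfK.
have [hpg sg] := hensel_partials_near Mmon (ig0 _ _ A0) hp0 (nearx _ _ A0) (Adm_g _ _ A0).
have Ng : N g.
  have Nev n' (R : {mpoly A[n']}) : N (map_mpoly i R).@[jet der x].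
    rewrite meval_map_mpoly /mmap; elim: (msupp R) => [|m s IH]; first by rewrite big_nil; apply: dc0 NP.
    rewrite big_cons; apply: (dcAdd NP) => //; apply: (dcM NP) => //.
    rewrite /mmap1; elim/big_rec: _ => [|j y _ Ny]; first exact: (dc1 NP).
    apply: (dcM NP) => //; elim: (m j) => [|e IHe]; first exact: (dc1 NP).
    by rewrite exprS; apply: (dcM NP) => //; apply: (dc_iter _ NP).
  apply: (dcM NP); first exact: Nev.
  by apply: (dcV NP); rewrite /c -map_mpoly_mderiv; apply: Nev.
have [|w Nw [Ow Qw]] := hN x g l0 Nx Ng g_neq0.
  by split=> //; rewrite -/c /g divfK // val_le_refl.
exists (x + g * w).
  apply: (dcAdd NP) => //; exact: (dcM NP).
split=> // a g' Ag; rewrite addrAC; apply: val_leD; first exact: nearx.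
apply: val_le_trans (Adm_g _ _ Ag) _; exact: val_leMl.
Qed.

End MapPolynomials.

(** * Back and forth *)

(** [Zorn_bigcup] also asks for the union of the empty chain, so the family is enlarged by the empty
    set and that case is removed afterwards. *)
Lemma Zorn_above (T : Type) (P : set (set T)) (R0 : set T) : P R0 ->
  (forall F : set (set T), F `<=` P -> F !=set0 -> total_on F subset ->
     P (\bigcup_(X in F) X)) ->
  exists2 A, P A /\ R0 `<=` A & forall B, A `<=` B -> P B -> B `<=` A.
Proof.
move=> P0 chainP.
have [F F0 totF|A [PA maxA]] := @Zorn_bigcup T [set X | X = set0 \/ R0 `<=` X /\ P X].
  have [[Y [FY Y0]]|nY] := pselect (exists Y, F Y /\ Y != set0); last first.
    left; rewrite -subset0 => x [X FX Xx]; apply: nY; exists X; split=> //.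
    by apply/set0P; exists x.
  right; have RY : R0 `<=` Y by case: (F0 _ FY) Y0 => [->|[]//]; rewrite eqxx.
  split; first by move=> x Rx; exists Y => //; apply: RY.
  have -> : \bigcup_(X in F) X = \bigcup_(X in F `&` [set X | X != set0]) X.
    apply/seteqP; split=> x [X FX Xx]; exists X => //; last by case: FX.
    by split=> //; apply/set0P; exists x.
  apply: chainP; first by move=> X [/F0[->|[]//]] /=; rewrite eqxx.
    by exists Y.
  by move=> X X' [FX _] [FX' _]; apply: totF.
have maxA' B : A `<=` B -> R0 `<=` B -> P B -> B `<=` A.
  move=> AB RB PB; apply: contrapT => BA; apply: (maxA B); last by right.
  by split.
case: PA => [A0|[RA PA]]; last first.
  exists A => // B AB PB; apply: maxA' => //.
  exact: subset_trans AB.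
have R00 : R0 `<=` A by apply: maxA' => //; rewrite A0; apply: sub0set.
have AR : A = R0 by apply/seteqP; split=> //; rewrite A0; apply: sub0set.
exists A; first by rewrite AR; split.
by move=> B AB PB; apply: maxA' => //; apply: subset_trans AB.
Qed.

Section PartialIsomorphisms.
Variables (k : diffField) (G : oagType) (c : G -> k) (M1 M2 : valuedDiffField).
Variables (L1 : lifting c M1) (L2 : lifting c M2).
Hypotheses (mon1 : monotone M1) (mon2 : monotone M2).
Local Notation v1 := (vdf_val M1).
Local Notation v2 := (vdf_val M2).
Local Notation B := (M1 * M2)%type.

Definition der2 (p : B) : B := (der p.1, der p.2).

Lemma der2P : is_derivation der2.
Proof.
split=> [[x1 x2] [y1 y2]|[x1 x2] [y1 y2]]; congr (_, _);
  by rewrite /= ?(is_derD (derP _)) ?(is_derM (derP _)).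
Qed.

(* A subfield of M1 * M2 with nonzero elements in same_lead is the graph of an
   isomorphism that preserves leading terms. *)
Definition same_lead : set B := [set p | exists b a,
  [/\ b != 0, sim v1 (lead L1 b a) p.1 & sim v2 (lead L2 b a) p.2]].

Lemma same_lead_sim p q1 q2 : same_lead p -> sim v1 p.1 q1 -> sim v2 p.2 q2 ->
  same_lead (q1, q2).
Proof.
move=> [b [a [b0 s1 s2]]] t1 t2; exists b, a; split=> //=.
  exact: sim_trans t1.
exact: sim_trans t2.
Qed.

Lemma same_lead1 : same_lead 1.
Proof.
exists 1, 0; split; rewrite ?oner_neq0 // /lead rmorph1 sec0 mulr1;
  by apply: sim_refl; rewrite oner_neq0.
Qed.

Lemma same_leadM p q : same_lead p -> same_lead q -> same_lead (p * q).
Proof.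
move=> [b [a [b0 s1 s2]]] [b' [a' [b'0 s'1 s'2]]]; exists (b * b'), (a + a').
by split; rewrite ?mulf_neq0 // leadM; apply: simM.
Qed.

Lemma same_lead_neq0 p : same_lead p -> p.1 != 0 /\ p.2 != 0.
Proof. by move=> [b [a [b0 s1 s2]]]; split; apply: sim_neq0r; eassumption. Qed.

Lemma same_lead_unit p : same_lead p -> p \is a GRing.unit.
Proof. by move=> /same_lead_neq0[p1 p2]; rewrite unfold_in /= !unitfE p1 p2. Qed.

Lemma same_leadV p : same_lead p -> same_lead p^-1.
Proof.
move=> sp; have pu := same_lead_unit sp.
have [p1 p2] := same_lead_neq0 sp.
have -> : p^-1 = (p.1^-1, p.2^-1).
  apply: (mulrI pu); rewrite divrr //; apply/esym.
  by congr (_, _); rewrite /= divff.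
case: sp => b [a [b0 s1 s2]]; exists b^-1, (- a).
by split; rewrite ?invr_eq0 // leadV; apply: simV.
Qed.

Section PartialIsomorphism.
Variable K : gfield der2 same_lead.
Notation A := (gf_type K).

Definition pr1 : {rmorphism A -> M1} := fst \o val.
Definition pr2 : {rmorphism A -> M2} := snd \o val.

Lemma pr1_der (a : A) : pr1 (gf_der a) = der (pr1 a). Proof. by []. Qed.
Lemma pr2_der (a : A) : pr2 (gf_der a) = der (pr2 a). Proof. by []. Qed.

Lemma gf_same_lead (a : A) : a != 0 -> same_lead (pr1 a, pr2 a).
Proof.
move=> a0; have := gf_good (gf_valP a).
have -> : (pr1 a, pr2 a) = val a by rewrite /=; case: (gf_val a).
case=> // E; case/negP: a0; apply/eqP/val_inj; rewrite rmorph0; exact: E.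
Qed.

Lemma pr_le (a b : A) : val_le v1 (pr1 a) (pr1 b) = val_le v2 (pr2 a) (pr2 b).
Proof.
have [->|b0] := eqVneq b 0; first by rewrite !raddf0 !val_le0.
have [->|a0] := eqVneq a 0; first by rewrite !raddf0 !val_ge0 !fmorph_eq0.
have [x [g [x0 sx1 sx2]]] := gf_same_lead a0.
have [y [h [y0 sy1 sy2]]] := gf_same_lead b0.
by rewrite -(val_le_sim sx1 sy1) -(val_le_sim sx2 sy2) !val_le_lead.
Qed.

Lemma pr_shape n (P : {mpoly A[n]}) :
  shape v1 (map_mpoly pr1 P) <-> shape v2 (map_mpoly pr2 P).
Proof.
rewrite /shape !mcoeff_map_mpoly !fmorph_eq0.
split=> -[P0 Pm]; split=> // m m0; have := Pm m m0.
  by rewrite !mcoeff_map_mpoly -!val_lt_div ?fmorph_eq0 // pr_le.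
by rewrite !mcoeff_map_mpoly -!val_lt_div ?fmorph_eq0 // pr_le.
Qed.

Lemma devalB_pair n (P : {mpoly A[n]}) x y : devalB (d := der2) (x, y) P =
  ((map_mpoly pr1 P).@[jet der x], (map_mpoly pr2 P).@[jet der y]).
Proof.
have jetE j : iter j der2 (x, y) = (iter j der x, iter j der y).
  by elim: j => //= j ->.
rewrite [LHS]surjective_pairing !meval_map_mpoly /devalB.
congr (_, _).
  rewrite -[LHS]/((fst : {rmorphism B -> M1}) _) rmorph_mmap; apply: mmap_ext => // j.
  by rewrite /jet /= jetE.
rewrite -[LHS]/((snd : {rmorphism B -> M2}) _) rmorph_mmap; apply: mmap_ext => // j.
by rewrite /jet /= jetE.
Qed.

End PartialIsomorphism.
End PartialIsomorphisms.

Lemma shape_mwiden (F : fieldType) (v : valuation F) n (P : {mpoly F[n]}) :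
  shape v P -> shape v (mwiden P).
Proof.
move=> /shapeE[c [E [c0 mE ->]]]; apply/shapeE; exists c, (mwiden E); split=> //.
  move=> k; rewrite (mpolyE E) (raddf_sum (@mwiden n F)) (raddf_sum (mcoeff k)) /=.
  apply: maxideal_sum => j _.
  by rewrite mwidenZ mwidenX mcoeffZ maxidealMr // mcoeffX rpred_nat.
by rewrite mwidenZ mwidenD mwiden1.
Qed.

Lemma shape_mpoly0 (F : fieldType) (v : valuation F) (P : {mpoly F[0]}) :
  P != 0 -> shape v P.
Proof.
move=> P0; have all0 (m : 'X_{1..0}) : m = 0%MM by apply/mnmP => -[].
split=> [|m]; last by rewrite (all0 m) eqxx.
by apply: contraNneq P0 => E; apply/eqP/mpolyP => m; rewrite (all0 m) E mcoeff0.
Qed.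

(** * Immediate extensions: adjoining a pseudolimit on both sides *)

Section ImmediateStep.
Variables (k : diffField) (G : oagType) (c : G -> k) (M1 M2 : valuedDiffField).
Variables (L1 : lifting c M1) (L2 : lifting c M2).
Hypotheses (mon1 : monotone M1) (mon2 : monotone M2).
Local Notation v1 := (vdf_val M1).
Local Notation v2 := (vdf_val M2).
Variable K : gfield (@der2 M1 M2) (same_lead L1 L2).
Local Notation A := (gf_type K).
Local Notation i1 := (pr1 K).
Local Notation i2 := (pr2 K).
Local Notation dA := (@gf_der _ _ _ K).

Variable N : set M1.
Hypotheses (NP : diff_closed der N) (NA : forall a : A, N (i1 a)).
Hypothesis Nhensel : forall n (P : {mpoly A[n]}) x g l, N x -> N g -> g != 0 ->
  hensel_data (map_mpoly i1 P) x g l ->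
  exists2 z, N z & z \in valring_pred v1 /\ (map_mpoly i1 P).@[jet der (x + g * z)] = 0.
Hypothesis Nimm : forall f, N f -> f != 0 -> exists e : A, sim v1 (i1 e) f.
Hypotheses (Kcountable : countable (gf_set K)) (hens2 : henselian M2).
Hypothesis complete2 : countably_complete M2.
Variable x : M1.
Hypotheses (Nx : N x) (xA : forall a, i1 a != x).

(** The cut of [x] over [K]. By [Adm_close] these balls have no point of [K] in common. *)
Let Adm (a g : A) := g != 0 /\ val_le v1 (i1 g) (x - i1 a).

Let Adm_neq0 a g : Adm a g -> g != 0. Proof. by case. Qed.

Let Adm_refine a g a' g' : Adm a g -> Adm a' g' ->
  val_le v1 (i1 g) (i1 g') -> val_le v1 (i1 g) (i1 a' - i1 a).
Proof.
move=> [_ Aa] [_ Aa'] gg; have -> : i1 a' - i1 a = (x - i1 a) - (x - i1 a').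
  by rewrite opprB [RHS]addrC addrA subrK.
by apply: val_leB => //; apply: val_le_trans Aa'.
Qed.

Let Adm_dir a g a' g' : Adm a g -> Adm a' g' -> exists a2 g2, [/\ Adm a2 g2,
  val_le v1 (i1 g) (i1 a2 - i1 a), val_le v1 (i1 g) (i1 g2),
  val_le v1 (i1 g') (i1 a2 - i1 a') & val_le v1 (i1 g') (i1 g2)].
Proof.
move=> Ag Ag'; have [gg|gg] := orP (val_le_total v1 (i1 g) (i1 g')).
  exists a', g'; split; rewrite ?subrr ?val_le0 ?val_le_refl //.
  exact: Adm_refine Ag'  gg.
exists a, g; split; rewrite ?subrr ?val_le0 ?val_le_refl //.
exact: Adm_refine Ag gg.
Qed.

(** Two successive approximations: e1 has the leading term of x - a and e2 that of x - a - e1, so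
    the ball around a + e1 of radius e2 excludes [a]. *)
Let Adm_close a : exists a2 e, [/\ Adm a2 e, i1 (a2 - a) != 0 & ~~ val_le v1 (i1 e) (i1 (a2 - a))].
Proof.
have close b : exists e, sim v1 (i1 e) (x - i1 b).
  apply: Nimm; first exact: (dcB NP).
  by rewrite subr_eq0 eq_sym xA.
have [e1 s1] := close a; have [e2 s2] := close (a + e1).
have [e10 _] := s1; have [e20 _] := s2.
exists (a + e1), e2; rewrite addrAC subrr add0r; split=> //.
  split; first by rewrite -(fmorph_eq0 i1).
  by rewrite (val_le_siml _ s2) val_le_refl.
rewrite (val_le_siml _ s2) (raddfD i1) opprD addrA.
by apply/(sim_val_lt _ _ e10).
Qed.

Let Adm_ex a : exists e, Adm a e.
Proof.
have [e s] : exists e, sim v1 (i1 e) (x - i1 a).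
  apply: Nimm; first exact: (dcB NP).
  by rewrite subr_eq0 eq_sym xA.
have [e0 _] := s; exists e; split; first by rewrite -(fmorph_eq0 i1).
by rewrite (val_le_siml _ s) val_le_refl.
Qed.

Let shape1 n (P : {mpoly A[n]}) := shape v1 (map_mpoly i1 P).
Let shape1_fwd n (P : {mpoly A[n]}) a g : shape1 (aff (jet dA a) g P) ->
  shape v1 (aff (jet der (i1 a)) (i1 g) (map_mpoly i1 P)).
Proof. by rewrite /shape1 (aff_jet (@pr1_der _ _ _ _ _ _ _ K)). Qed.

Let shape1_bwd n (P : {mpoly A[n]}) a g :
  shape v1 (aff (jet der (i1 a)) (i1 g) (map_mpoly i1 P)) -> shape1 (aff (jet dA a) g P).
Proof. by rewrite /shape1 (aff_jet (@pr1_der _ _ _ _ _ _ _ K)). Qed.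

Let shape2_fwd n (P : {mpoly A[n]}) a g : shape1 (aff (jet dA a) g P) ->
  shape v2 (aff (jet der (i2 a)) (i2 g) (map_mpoly i2 P)).
Proof. by rewrite -(aff_jet (@pr2_der _ _ _ _ _ _ _ K)) => /pr_shape. Qed.

Let shape2_bwd n (P : {mpoly A[n]}) a g :
  shape v2 (aff (jet der (i2 a)) (i2 g) (map_mpoly i2 P)) -> shape1 (aff (jet dA a) g P).
Proof. by rewrite -(aff_jet (@pr2_der _ _ _ _ _ _ _ K)) => /pr_shape. Qed.

Let stable n (P : {mpoly A[n]}) := exists a g, Adm a g /\ shape1 (aff (jet dA a) g P).

Let stable0 (P : {mpoly A[0]}) : P != 0 -> ~ ~ stable P.
Proof.
move=> P0; apply; have [e Ae] := Adm_ex 0; exists 0, e; split=> //.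
apply: shape_mpoly0; rewrite map_mpoly_eq0; apply: contra_neq P0 => E.
have -> : P = aff (jet dA 0) e P; last exact: E.
rewrite {1}(mpolyE P) /aff /mmap; apply: eq_bigr => m _.
by rewrite -mul_mpolyC mpolyXE_id /mmap1 !big_ord0.
Qed.

Let stable_mwiden n (Q : {mpoly A[n]}) : ~ stable (mwiden Q) -> ~ stable Q.
Proof.
apply: contra_not => -[a [g [Ag sQ]]]; exists a, g; split=> //.
rewrite /shape1 /aff (@aff_mwiden _ _ (jet dA a)); last by apply/funext.
by rewrite map_mpoly_mwiden; apply: shape_mwiden.
Qed.

Definition pseudo_limits z y := (forall a g, Adm a g -> val_le v1 (i1 g) (z - i1 a)) /\
  (forall a g, Adm a g -> val_le v2 (i2 g) (y - i2 a)).

(** On each side the value of [P] has the leading term of P(a), and P(a) is an element of [K], whose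
    leading terms already correspond. *)
Let stable_good z y n (P : {mpoly A[n]}) : pseudo_limits z y -> stable P ->
  same_lead L1 L2 (devalB (d := @der2 M1 M2) (z, y) P).
Proof.
move=> [Pz Py] [a [g [Ag sP]]]; rewrite devalB_pair.
have g1 : i1 g != 0 by rewrite fmorph_eq0; case: Ag.
have g2 : i2 g != 0 by rewrite fmorph_eq0; case: Ag.
have [_ s1] := shape_near mon1 g1 (shape1_fwd sP) (Pz _ _ Ag) (val_le_refl _ _).
have [_ s2] := shape_near mon2 g2 (shape2_fwd sP) (Py _ _ Ag) (val_le_refl _ _).
apply: (same_lead_sim (p := (i1 P.@[jet dA a], i2 P.@[jet dA a]))).
- apply: gf_same_lead; rewrite -(fmorph_eq0 i1) -(meval_map_mpoly_jet (@pr1_der _ _ _ _ _ _ _ K)).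
  by case: s1.
- by move: s1; rewrite (meval_map_mpoly_jet (@pr1_der _ _ _ _ _ _ _ K)).
- by move: s2; rewrite (meval_map_mpoly_jet (@pr2_der _ _ _ _ _ _ _ K)).
Qed.

Let pseudo_limit_exists : exists y, pseudo_limits x y.
Proof.
pose C : set (M2 * M2) := [set p | exists a g, Adm a g /\ p = (i2 a, i2 g)].
have [||y yP] := complete2 (C := C).
- pose f (q : (M1 * M2) * (M1 * M2)) : M2 * M2 := (q.1.2, q.2.2).
  apply: (@sub_countable _ _ _ (gf_set K `*` gf_set K)); last exact: countableX.
  apply: (card_le_trans (B := f @` (gf_set K `*` gf_set K))); last exact: card_image_le.
  apply: subset_card_le => _ [a [g [_ ->]]].
  by exists (val a, val g) => //; split; apply: gf_valP.
- move=> p q [a [g [Ag ->]]] [a' [g' [Ag' ->]]].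
  suff : val_le v2 (i2 g) (i2 a - i2 a') || val_le v2 (i2 g') (i2 a - i2 a') by [].
  rewrite -(raddfB i2) -!pr_le (raddfB i1).
  have [gg|gg] := orP (val_le_total v1 (i1 g) (i1 g')).
    by rewrite -val_leN opprB (Adm_refine Ag Ag' gg).
  by rewrite (Adm_refine Ag' Ag gg) orbT.
exists y; split=> [a g []//|a g Ag].
by apply: (yP (i2 a, i2 g)); exists a, g.
Qed.

Let pseudo_limit_new z : (forall a g, Adm a g -> val_le v1 (i1 g) (z - i1 a)) ->
  forall a, i1 a != z.
Proof.
move=> Pz a; apply/eqP => E; have [a2 [e [Ae n0]]] := Adm_close a.
by apply/negP/negPn; have := Pz _ _ Ae; rewrite -E -val_leN opprB -(raddfB i1).
Qed.

(** Kaplansky's dichotomy. If every nonzero polynomial is stable, [x] itself is adjoined. Otherwise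
    a minimal unstable polynomial has zeros in the cut on both sides, but [x] need not be one of
    them: what is adjoined is such a zero [z] in [N], and [x] is reached only later, through
    maximality. *)
Lemma immediate_step : exists z y, [/\ N z, forall a, i1 a != z & gf_extension K (z, y)].
Proof.
have Usub := @same_lead_unit _ _ _ _ _ L1 L2.
have [y0 Py0] := pseudo_limit_exists.
have [nobad|] := pselect (forall n (P : {mpoly A[n]}), P != 0 -> stable P).
  exists x, y0; split=> //; apply: extend_transcendental => //.
  - exact: der2P.
  - exact: same_lead1.
  - exact: same_leadM.
  - exact: same_leadV.
  - by move=> n P P0; apply: stable_good => //; apply: nobad.
move=> /existsNP[n0 /existsNP[P0 /not_implyP[P00 badP0]]].
have charA n : (n.+1%:R : A) != 0.
  by rewrite -(fmorph_eq0 i1) rmorph_nat char0_vdf.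
have [n [P [[[Pn0 badP] low_order low_degree sP dP] partials]]] :=
  minimal_bad charA stable0 stable_mwiden P00 badP0.
have stable_order (Q : {mpoly A[n]}) : Q != 0 -> stable Q.
  by move=> Q0; apply: contrapT; exact: (low_order Q Q0).
have stable_degree (Q : {mpoly A[n.+1]}) : Q != 0 -> (size (muni Q) < size (muni P))%N -> stable Q.
  by move=> Q0 sQ; apply: contrapT; exact: (low_degree Q Q0 sQ).
have stable_partial l : P^`M(l) != 0 -> stable P^`M(l).
  by move=> Pl; apply: contrapT; exact: (partials l Pl).
have der1 := @pr1_der _ _ _ _ _ _ _ K; have der2 := @pr2_der _ _ _ _ _ _ _ K.
(* Since the cut is directed, one ball serves for all nonzero partial derivatives together. *)
have [a0 [g0 [A0 sh0]]] : exists a0 g0, Adm a0 g0 /\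
    forall l, P^`M(l) != 0 -> shape1 (aff (jet dA a0) g0 P^`M(l)).
  have : forall s : seq 'I_n.+1, exists a0 g0, Adm a0 g0 /\
    forall l, l \in s -> P^`M(l) != 0 -> shape1 (aff (jet dA a0) g0 P^`M(l)).
    elim=> [|l s [a [g [Ag IH]]]]; first by have [e Ae] := Adm_ex 0; exists 0, e.
    have [l0|/stable_partial[a' [g' [Ag' sh']]]] := eqVneq P^`M(l) 0.
      exists a, g; split=> // l'; rewrite inE => /orP[/eqP ->|]; last exact: IH.
      by rewrite l0 eqxx.
    have [a2 [g2 [A2 aa2 gg2 aa2' gg2']]] := Adm_dir Ag Ag'.
    have g10 : i1 g != 0 by rewrite fmorph_eq0 (Adm_neq0 Ag).
    have g'10 : i1 g' != 0 by rewrite fmorph_eq0 (Adm_neq0 Ag').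
    exists a2, g2; split; first exact: A2.
    move=> l'; rewrite inE => /orP[/eqP -> _|ls Pl].
      have [sh2 _] := shape_near mon1 g'10 (shape1_fwd sh') aa2' gg2'.
      exact: shape1_bwd sh2.
    have [sh2 _] := shape_near mon1 g10 (shape1_fwd (IH l' ls Pl)) aa2 gg2.
    exact: shape1_bwd sh2.
  move=> /(_ (enum 'I_n.+1))[a [g [Ag sh]]]; exists a, g; split=> // l.
  by apply: sh; rewrite mem_enum.
pose cl l : A := P^`M(l).@[jet dA a0].
have cl0 l : P^`M(l) != 0 -> cl l != 0.
  by move=> Pl; have [+ _] := shape1_fwd (sh0 l Pl); rewrite aff_coef0 (meval_map_mpoly_jet der1) fmorph_eq0.
(* The partial derivative of least value at the centre. It is nonzero because the derivative in the
   last variable is. *)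
have [l0 [Pl0 l0min]] : exists l0, cl l0 != 0 /\ forall l, val_le v1 (i1 (cl l0)) (i1 (cl l)).
  pose l0 := extremum (fun a b : M1 => val_le v1 a b) ord_max xpredT (fun l => i1 (cl l)).
  have l0min l : val_le v1 (i1 (cl l0)) (i1 (cl l)).
    rewrite /l0; case: extremumP => [a|a b d|a b||l1 _ H] //; last exact: (H l isT).
    - exact: val_le_refl.
    - exact: val_le_trans.
    - exact: val_le_total.
  exists l0; split=> //; apply: contraNneq (cl0 _ dP) => l00.
  by have := l0min ord_max; rewrite l00 raddf0 val_ge0 fmorph_eq0.
have g10 : i1 g0 != 0 by rewrite fmorph_eq0 (Adm_neq0 A0).
have hp1 : hensel_partials (map_mpoly i1 P) (i1 a0) (i1 g0) l0.
  have E l : ((map_mpoly i1 P)^`M(l)).@[jet der (i1 a0)] = i1 (cl l).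
    by rewrite -map_mpoly_mderiv (meval_map_mpoly_jet der1).
  split=> [l|l|]; [rewrite -map_mpoly_mderiv|by rewrite !E; apply: l0min|by rewrite E fmorph_eq0].
  have [->|Pl] := eqVneq P^`M(l) 0; first by left; rewrite raddf0.
  by right; apply: shape1_fwd; apply: sh0.
have hp2 : hensel_partials (map_mpoly i2 P) (i2 a0) (i2 g0) l0.
  have E l : ((map_mpoly i2 P)^`M(l)).@[jet der (i2 a0)] = i2 (cl l).
    by rewrite -map_mpoly_mderiv (meval_map_mpoly_jet der2).
  split=> [l|l|]; [rewrite -map_mpoly_mderiv|by rewrite !E -pr_le; apply: l0min|by rewrite E fmorph_eq0].
  have [->|Pl] := eqVneq P^`M(l) 0; first by left; rewrite raddf0.
  by right; apply: shape2_fwd; apply: sh0.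
have [z Nz [Pz nz]] : exists2 z, N z & (map_mpoly i1 P).@[jet der z] = 0 /\
    forall a g, Adm a g -> val_le v1 (i1 g) (z - i1 a).
  apply: (zero_near mon1 (x := x) NP NA Nx _ Adm_neq0 Adm_dir A0 hp1) => //.
  - by move=> x' g l; apply: Nhensel.
  - by move=> a g Ag /shape1_bwd sP'; apply: badP; exists a, g.
  - by move=> a g [].
have [y _ [Py ny]] : exists2 y, [set: M2] y & (map_mpoly i2 P).@[jet der y] = 0 /\
    forall a g, Adm a g -> val_le v2 (i2 g) (y - i2 a).
  apply: (zero_near mon2 (x := y0) _ _ _ _ Adm_neq0 _ A0 hp2) => //.
  - by move=> x' g l _ _ g'0 hd; have [w Ow Ew] := hens2 g'0 hd; exists w.
  - move=> a g a' g' Ag Ag'; have [a2 [g2 [A2]]] := Adm_dir Ag Ag'.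
    rewrite -!(raddfB i1) !pr_le !(raddfB i2) => h1 h2 h3 h4; exists a2, g2; split=> //.
  - by move=> a g Ag /shape2_bwd sP'; apply: badP; exists a, g.
  - by case: Py0.
exists z, y; split=> //; first exact: pseudo_limit_new.
have pzy : pseudo_limits z y by [].
apply: (extend_algebraic (@der2P M1 M2) (@same_lead1 _ _ _ _ _ L1 L2)
  (@same_leadM _ _ _ _ _ L1 L2) (@same_leadV _ _ _ _ _ L1 L2) Usub (G := P)) => //.
- by move=> Q Q0; apply: stable_good => //; apply: stable_order.
- by move=> Q Q0 sQ; apply: stable_good => //; apply: stable_degree.
- by rewrite devalB_pair Pz Py.
Qed.

End ImmediateStep.

Lemma seq_min (T : eqType) (G : oagType) (f : T -> G) (s : seq T) : s != [::] ->
  exists2 t, t \in s & forall t', t' \in s -> f t <= f t'.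
Proof.
elim: s => // t [|t1 s] IH _.
  by exists t; rewrite ?mem_head // => t'; rewrite inE => /eqP ->.
have [//|t2 t2s tmin] := IH; have [tt|tt] := orP (oag_le_total (f t) (f t2)).
  exists t; first exact: mem_head.
  move=> t'; rewrite inE => /orP[/eqP -> //|/tmin]; exact: le_trans.
exists t2; first by rewrite inE t2s orbT.
by move=> t'; rewrite inE => /orP[/eqP -> //|/tmin].
Qed.

(** * Adjoining countably many lifted residues and monomials *)

Section AdjoinLeadingTerms.
Variables (k : diffField) (G : oagType) (c : G -> k) (M1 M2 : valuedDiffField).
Variables (L1 : lifting c M1) (L2 : lifting c M2).
Local Notation v1 := (vdf_val M1).
Local Notation v2 := (vdf_val M2).
Local Notation B := (M1 * M2)%type.
Local Notation der2 := (@der2 M1 M2).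
Local Notation same_lead := (same_lead L1 L2).

Definition rep2 (b : k) : B := (rep L1 b, rep L2 b).
Definition sec2 (a : G) : B := (sec L1 a, sec L2 a).
Definition lead2 b a : B := rep2 b * sec2 a.

Lemma rep2D b b' : rep2 (b + b') = rep2 b + rep2 b'.
Proof. by congr (_, _); rewrite rmorphD. Qed.
Lemma rep2M b b' : rep2 (b * b') = rep2 b * rep2 b'.
Proof. by congr (_, _); rewrite rmorphM. Qed.
Lemma rep2N b : rep2 (- b) = - rep2 b.
Proof. by congr (_, _); rewrite rmorphN. Qed.
Lemma rep20 : rep2 0 = 0.
Proof. by congr (_, _); rewrite rmorph0. Qed.
Lemma rep21 : rep2 1 = 1.
Proof. by congr (_, _); rewrite rmorph1. Qed.
Lemma rep2_sum I (r : seq I) (P : pred I) (f : I -> k) :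
  rep2 (\sum_(i <- r | P i) f i) = \sum_(i <- r | P i) rep2 (f i).
Proof. exact: (big_morph rep2 rep2D rep20). Qed.
Lemma sec2D a a' : sec2 (a + a') = sec2 a * sec2 a'.
Proof. by congr (_, _); rewrite secD. Qed.
Lemma sec20 : sec2 0 = 1.
Proof. by congr (_, _); rewrite sec0. Qed.
Lemma lead2M b a b' a' : lead2 (b * b') (a + a') = lead2 b a * lead2 b' a'.
Proof. by rewrite /lead2 rep2M sec2D mulrACA. Qed.
Lemma lead2_same b a : b != 0 -> same_lead (lead2 b a).
Proof. by move=> b0; exists b, a; split=> //; apply: sim_refl; apply: lead_neq0. Qed.

Lemma pair_inv (p : B) : p^-1 = p \/ p^-1 = (p.1^-1, p.2^-1).
Proof.
have [pu|pu] := boolP (p \is a GRing.unit); last by left; rewrite invr_out.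
right; apply: (mulrI pu); rewrite divrr //; move: pu; rewrite unfold_in /= !unitfE => /andP[p1 p2].
by congr (_, _); rewrite /= divff.
Qed.

(** Ensures that the linear relations between leading coefficients met in [span_lead] have their
    coefficients in [K]. *)
Definition lead_closed (K : gfield der2 same_lead) := forall p, gf_set K p -> p != 0 ->
  exists b a, [/\ b != 0, sim v1 (lead L1 b a) p.1, sim v2 (lead L2 b a) p.2,
    gf_set K (rep2 b) & gf_set K (sec2 a)].

Variables (K : gfield der2 same_lead) (N : set M1).
Hypotheses (Klead : lead_closed K) (NP : diff_closed der N).
Hypothesis KN : forall p, gf_set K p -> N p.1.

(** A triple stands for the product of an element of [K], a lifted residue and a monomial; the sums
    of such products form the ring [span]. *)
Let T := (B * k * G)%type.
Let val2 (t : T) : B := t.1.1 * lead2 t.1.2 t.2.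
Let ok (t : T) := [/\ gf_set K t.1.1, N (rep L1 t.1.2) & N (sec L1 t.2)].
Let span : set B := [set z | exists2 s : seq T, (forall t, t \in s -> ok t) &
  z = \sum_(t <- s) val2 t].
Let has_lead (z : B) := z = 0 \/ exists b a, [/\ b != 0, N (rep L1 b), N (sec L1 a),
  sim v1 (lead L1 b a) z.1 & sim v2 (lead L2 b a) z.2].

Let KP := gf_closed K.

Let N_sum I (r : seq I) (P : pred I) (f : I -> k) :
  (forall i, P i -> N (rep L1 (f i))) -> N (rep L1 (\sum_(i <- r | P i) f i)).
Proof.
move=> Nf; elim/big_rec: _ => [|i y Pi Ny]; first by rewrite raddf0; apply: dc0 NP.
by rewrite raddfD; apply: (dcAdd NP) => //; apply: Nf.
Qed.

(** Each summand equals its part at exponent [d] up to an error of value greater than [d]; such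
    errors cannot disturb a nonzero leading coefficient [sg]. *)
Let dominated (M : valuedDiffField) (L : lifting c M) (p : M) (b0 b : k) (a0 a d : G) (sg : k) :
  b0 != 0 -> sg != 0 -> sim (vdf_val M) (lead L b0 a0) p -> d <= a0 + a ->
  ~~ val_le (vdf_val M) (p * lead L b a - (if a0 + a == d then lead L (b0 * b) d else 0)) (lead L sg d).
Proof.
move=> b00 sg0 sp da; have l0 := lead_neq0 L d sg0.
have [->|b_neq0] := eqVneq b 0.
  by rewrite /lead mulr0 raddf0 !(mul0r, mulr0) if_same subr0 val_ge0.
have bb0 : b0 * b != 0 by rewrite mulf_neq0.
have s : sim (vdf_val M) (lead L (b0 * b) (a0 + a)) (p * lead L b a).
  by rewrite leadM; apply: simM => //; apply/sim_refl/lead_neq0.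
have [E|ne] := eqVneq (a0 + a) d.
  rewrite -E in l0 *; apply: (@val_le_lt _ _ _ (lead L (b0 * b) (a0 + a))).
    by rewrite val_le_lead.
  by apply/sim_val_lt => //; apply: lead_neq0.
rewrite subr0 -(val_le_siml _ s) val_le_lead //.
by rewrite -oag_ltNge lt_neqAle eq_sym ne.
Qed.

Let rem_ok (s : seq T) t : (forall t', t' \in s -> ok t') ->
  forall t', t' \in rem t s -> ok t'.
Proof. by move=> sok t' /mem_rem; apply: sok. Qed.

(* A sum whose naive leading coefficient vanishes can be rewritten with fewer
   terms: the linear relation between leading coefficients is over K. *)
Let span_lead n : forall s : seq T, (size s <= n)%N -> (forall t, t \in s -> ok t) ->
  has_lead (\sum_(t <- s) val2 t).
Proof.
have /choice[f fP] : forall p : B, exists y : k * G, gf_set K p -> p != 0 ->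
    [/\ y.1 != 0, sim v1 (lead L1 y.1 y.2) p.1, sim v2 (lead L2 y.1 y.2) p.2,
      gf_set K (rep2 y.1) & gf_set K (sec2 y.2)].
  move=> p; have [[Kp p0]|nK] := pselect (gf_set K p /\ p != 0).
    by have [b [a H]] := Klead Kp p0; exists (b, a).
  by exists (0, 0) => Kp p0; case: nK.
elim: n => [|n IH] s sn sok.
  by left; move: sn; rewrite leqn0 size_eq0 => /eqP ->; rewrite big_nil.
have drop t : t \in s -> val2 t = 0 -> has_lead (\sum_(t <- s) val2 t).
  move=> ts t0; rewrite (perm_big _ (perm_to_rem ts)) /= big_cons t0 add0r.
  by apply: IH; [rewrite size_rem // -subn1 leq_subLR add1n | apply: rem_ok].
have [[t [ts t0]]|nz] := pselect (exists t, t \in s /\ (t.1.1 = 0 \/ t.1.2 = 0)).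
  by apply: (drop t ts); rewrite /val2 /lead2; case: t0 => ->; rewrite ?rep20 !(mul0r, mulr0).
have p0 t : t \in s -> t.1.1 != 0.
  by move=> ts; apply/eqP => t0; apply: nz; exists t; split; [|left].
have b0 t : t \in s -> t.1.2 != 0.
  by move=> ts; apply/eqP => t0; apply: nz; exists t; split; [|right].
have [->|s0] := eqVneq s [::]; first by left; rewrite big_nil.
pose h (t : T) := (f t.1.1).2 + t.2.
have [t0 t0s t0min] := seq_min h s0.
pose d := h t0; pose bt (t : T) := (f t.1.1).1.
pose sg := \sum_(t <- s | h t == d) bt t * t.1.2.
have fok t : t \in s -> [/\ bt t != 0, sim v1 (lead L1 (bt t) (f t.1.1).2) t.1.1.1,
    sim v2 (lead L2 (bt t) (f t.1.1).2) t.1.1.2, gf_set K (rep2 (bt t)) &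
    gf_set K (sec2 (f t.1.1).2)].
  by move=> ts; apply: fP; [case: (sok _ ts) | apply: p0].
(* [sg] is the naive leading coefficient, at the least exponent [d]. If it is nonzero, [lead sg d]
   is the leading term of the sum on both sides. *)
have [sg0|sg0] := eqVneq sg 0; last first.
  have Nsg : N (rep L1 sg).
    rewrite /sg big_seq_cond; apply: N_sum => t /andP[ts _]; rewrite rmorphM.
    by apply: (dcM NP); [have [_ _ _ /KN] := fok _ ts | case: (sok _ ts)].
  have Nd : N (sec L1 d).
    rewrite secD; apply: (dcM NP); [by have [_ _ _ _ /KN] := fok _ t0s | by case: (sok _ t0s)].
  have key (M : valuedDiffField) (L : lifting c M) (pr : {rmorphism B -> M}) :
      (forall b a, pr (lead2 b a) = lead L b a) ->
      (forall t, t \in s -> sim (vdf_val M) (lead L (bt t) (f t.1.1).2) (pr t.1.1)) ->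
      sim (vdf_val M) (lead L sg d) (pr (\sum_(t <- s) val2 t)).
    move=> prl prs; apply/sim_val_lt; first exact: lead_neq0.
    have -> : pr (\sum_(t <- s) val2 t) - lead L sg d =
        \sum_(t <- s) (pr t.1.1 * lead L t.1.2 t.2 - (if h t == d then lead L (bt t * t.1.2) d else 0)).
      rewrite raddf_sum sumrB; congr (_ - _).
        by apply: eq_bigr => t _; rewrite /= rmorphM prl.
      rewrite -big_mkcond /= /lead /sg raddf_sum mulr_suml /=.
      by apply: eq_bigr.
    rewrite big_seq; elim/big_rec: _ => [|t y ts Hy]; first by rewrite val_ge0 lead_neq0.
    apply: val_ltD => //; first exact: lead_neq0.
    apply: dominated => //; [by case: (fok _ ts) | exact: prs | exact: t0min].
  right; exists sg, d; split=> //.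
    by apply: (key _ L1 (fst : {rmorphism B -> M1})) => // t /fok[].
  by apply: (key _ L2 (snd : {rmorphism B -> M2})) => // t /fok[].
(* If [sg] vanishes, the residue of [t0] is minus the sum of [bt t / bt t0] times the residues of
   the other terms of exponent [d]. Substituting this distributes [t0] over those terms and shortens
   the sum. *)
pose s' := rem t0 s.
pose q (t : T) : B := t.1.1 * rep2 (bt t / bt t0) * sec2 (t0.2 - t.2).
have [bt00 _ _ Kbt0 Kal0] := fok _ t0s; have [Kp0 Nb0 Ng0] := sok _ t0s.
pose g (t : T) : T := (if h t == d then t.1.1 - t0.1.1 * (rep2 (bt t / bt t0) * sec2 (t0.2 - t.2)) else t.1.1,
  t.1.2, t.2).
have Kcoef t : t \in s -> h t == d -> gf_set K (rep2 (bt t / bt t0) * sec2 (t0.2 - t.2)).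
  move=> ts /eqP htd; have [_ _ _ Kb Ka] := fok _ ts.
  (* Both terms have total exponent [d], so their monomials differ by exponents of elements of [K],
     and the corresponding monomials lie in [K]. *)
  have -> : t0.2 - t.2 = (f t.1.1).2 - (f t0.1.1).2.
    by apply/eqP; rewrite subr_eq addrAC eq_sym subr_eq -/(h t) htd addrC.
  apply: (dcM KP).
    rewrite rep2M; apply: (dcM KP) => //.
    have -> : rep2 (bt t0)^-1 = (rep2 (bt t0))^-1; last exact: (dcV KP).
    have u : rep2 (bt t0) \is a GRing.unit by rewrite unfold_in /= !unitfE !fmorph_eq0 bt00.
    by apply: (mulrI u); rewrite divrr // -rep2M divff // rep21.
  rewrite sec2D; apply: (dcM KP) => //.
  have u : sec2 (f t0.1.1).2 \is a GRing.unit by rewrite unfold_in /= !unitfE !sec_neq0.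
  have -> : sec2 (- (f t0.1.1).2) = (sec2 (f t0.1.1).2)^-1; last exact: (dcV KP).
  by apply: (mulrI u); rewrite divrr // -sec2D subrr sec20.
have -> : \sum_(t <- s) val2 t = \sum_(t <- [seq g t | t <- s']) val2 t; last first.
  apply: IH.
    by rewrite size_map size_rem // -subn1 leq_subLR add1n.
  move=> t' /mapP[t /mem_rem ts ->]; have [Kt Nt1 Nt2] := sok _ ts; split=> //=.
  case: ifP => // htd; apply: (dcB KP) => //; apply: (dcM KP) => //.
  exact: Kcoef.
rewrite (perm_big _ (perm_to_rem t0s)) /= big_cons big_map -/s'.
have -> : \sum_(t <- s') val2 (g t) = \sum_(t <- s') val2 t -
    \sum_(t <- s' | h t == d) t0.1.1 * (rep2 (bt t / bt t0) * sec2 (t0.2 - t.2)) * lead2 t.1.2 t.2.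
  rewrite [in X in _ - X]big_mkcond /= -sumrB; apply: eq_bigr => t _.
  by rewrite /val2 /g /=; case: ifP; rewrite ?subr0 // mulrBl.
rewrite addrC; congr (_ + _).
have -> : \sum_(t <- s' | h t == d) t0.1.1 * (rep2 (bt t / bt t0) * sec2 (t0.2 - t.2)) * lead2 t.1.2 t.2
    = t0.1.1 * sec2 t0.2 * rep2 (\sum_(t <- s' | h t == d) (bt t / bt t0) * t.1.2).
  rewrite rep2_sum mulr_sumr; apply: eq_bigr => t _.
  have -> : sec2 t0.2 = sec2 (t0.2 - t.2) * sec2 t.2 by rewrite -sec2D subrK.
  rewrite /lead2 (rep2M (bt t / bt t0)) -!mulrA; congr (_ * _).
  by rewrite [LHS]mulrCA; congr (_ * _); rewrite [RHS]mulrC mulrA.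
have -> : \sum_(t <- s' | h t == d) (bt t / bt t0) * t.1.2 = - t0.1.2.
  move: sg0; rewrite /sg (perm_big _ (perm_to_rem t0s)) /= big_cons eqxx -/s' => /eqP.
  rewrite addrC addr_eq0 => /eqP E.
  transitivity ((bt t0)^-1 * \sum_(t <- s' | h t == d) bt t * t.1.2).
    by rewrite mulr_sumr; apply: eq_bigr => t _; rewrite mulrAC mulrC.
  by rewrite E mulrN mulKf.
by rewrite rep2N mulrN opprK /val2 /lead2 -mulrA [rep2 _ * _]mulrC.
Qed.

Let N0 : N 0 := dc0 NP.
Let N1 : N 1 := dc1 NP.

Let span_term t : ok t -> span (val2 t).
Proof.
move=> okt; exists [:: t]; first by move=> t'; rewrite inE => /eqP ->.
by rewrite big_seq1.
Qed.

Let spanD x y : span x -> span y -> span (x + y).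
Proof.
move=> [s sok ->] [s' s'ok ->]; exists (s ++ s'); last by rewrite big_cat.
by move=> t; rewrite mem_cat => /orP[/sok|/s'ok].
Qed.

Let spanN x : span x -> span (- x).
Proof.
move=> [s sok ->]; exists [seq (- t.1.1, t.1.2, t.2) | t <- s].
  by move=> _ /mapP[t /sok[Kt N1t N2t] ->]; split=> //=; apply: (dcN KP).
by rewrite big_map -sumrN; apply: eq_bigr => t _; rewrite /val2 /= mulNr.
Qed.

Let spanB x y : span x -> span y -> span (x - y).
Proof. by move=> sx sy; apply: spanD => //; apply: spanN. Qed.

Let span0 : span 0. Proof. by exists [::] => //; rewrite big_nil. Qed.

Let ok_mul t t' : ok t -> ok t' -> ok (t.1.1 * t'.1.1, t.1.2 * t'.1.2, t.2 + t'.2).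
Proof.
move=> [? ? ?] [? ? ?]; split=> /=; first exact: (dcM KP).
  by rewrite rmorphM; apply: (dcM NP).
by rewrite secD; apply: (dcM NP).
Qed.

Let spanM x y : span x -> span y -> span (x * y).
Proof.
move=> [s sok ->] [s' s'ok ->]; rewrite mulr_suml big_seq.
elim/big_rec: _ => [|t z ts sz]; first exact: span0.
apply: spanD => //; rewrite mulr_sumr big_seq.
elim/big_rec: _ => [|t' z' ts' sz']; first exact: span0.
apply: spanD => //; have := span_term (ok_mul (sok _ ts) (s'ok _ ts')).
by rewrite /val2 /= lead2M mulrACA.
Qed.

Let span1 : span 1.
Proof.
have := @span_term (1, 1, 0); rewrite /val2 /= /lead2 rep21 sec20 !mulr1; apply.
by split; rewrite /= ?rmorph1 ?sec0 //; apply: (dc1 KP).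
Qed.

Let span_good x : span x -> x = 0 \/ same_lead x.
Proof.
move=> [s sok ->]; case: (span_lead (leqnn (size s)) sok) => [->|]; first by left.
by move=> [b [a [b0 _ _ s1 s2]]]; right; exists b, a.
Qed.

(** [rep (c a)] is the logarithmic derivative of the monomial [sec a]. *)
Let N_c a : N (sec L1 a) -> N (rep L1 (c a)).
Proof.
move=> Na; have -> : rep L1 (c a) = der (sec L1 a) / sec L1 a.
  by rewrite sec_der mulfK ?sec_neq0.
by apply: (dcM NP); [apply: (dcD NP) | apply: (dcV NP)].
Qed.

Lemma der_lead2 b a : der2 (lead2 b a) = lead2 (der b + c a * b) a.
Proof.
by congr (_, _); rewrite /= (is_derM (derP _)) sec_der rep_der !(rmorphD, rmorphM) mulrDl;
  congr (_ + _); rewrite mulrCA mulrA.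
Qed.

Let span_der x : span x -> span (der2 x).
Proof.
have dP := @der2P M1 M2.
move=> [s sok ->]; rewrite (big_morph der2 (is_derD dP) (is_der0 dP)) big_seq.
elim/big_rec: _ => [|t z ts sz]; first exact: span0.
apply: spanD => //; have [Kt Nb Na] := sok _ ts.
rewrite /val2 (is_derM dP) der_lead2; apply: spanD.
  by apply: (@span_term (der2 t.1.1, t.1.2, t.2)); split=> //; apply: (dcD KP).
apply: (@span_term (t.1.1, der t.1.2 + c t.2 * t.1.2, t.2)); split=> //=.
rewrite rmorphD rmorphM -rep_der; apply: (dcAdd NP); first exact: (dcD NP).
by apply: (dcM NP) => //; apply: N_c.
Qed.

Lemma adjoin_leads : exists K' : gfield der2 same_lead, [/\ gf_set K `<=` gf_set K',
  forall b, N (rep L1 b) -> gf_set K' (rep2 b),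
  forall a, N (sec L1 a) -> gf_set K' (sec2 a) &
  forall p, gf_set K' p -> N p.1].
Proof.
have U1 := @same_lead1 _ _ _ _ _ L1 L2; have UM := @same_leadM _ _ _ _ _ L1 L2.
have UV := @same_leadV _ _ _ _ _ L1 L2; have Uu := @same_lead_unit _ _ _ _ _ L1 L2.
have SD x : span x -> fractions same_lead span (der2 x).
  by move=> /span_der; apply: fractions_sub.
exists (fraction_field (@der2P M1 M2) U1 UM UV Uu span1 spanB spanM span_good SD); split=> /=.
- move=> p Kp; apply: fractions_sub => //.
  have := @span_term (p, 1, 0); rewrite /val2 /= /lead2 rep21 sec20 !mulr1; apply.
  by split; rewrite /= ?rmorph1 ?sec0.
- move=> b Nb; apply: fractions_sub => //.
  have := @span_term (1, b, 0); rewrite /val2 /= /lead2 sec20 mulr1 mul1r; apply.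
  by split; rewrite /= ?sec0 //; apply: (dc1 KP).
- move=> a Na; apply: fractions_sub => //.
  have := @span_term (1, 1, a); rewrite /val2 /= /lead2 rep21 !mul1r; apply.
  by split; rewrite /= ?rmorph1 //; apply: (dc1 KP).
move=> p [x [y [Sx Sy Uy ->]]].
have Nspan z : span z -> N z.1.
  move=> [s sok ->]; rewrite (raddf_sum (fst : {rmorphism B -> M1})) /= big_seq.
  elim/big_rec: _ => [|t w ts Nw]; first exact: N0.
  apply: (dcAdd NP) => //; have [Kt Nb Na] := sok _ ts.
  by apply: (dcM NP); [exact: KN | exact: (dcM NP)].
apply: (dcM NP); first exact: Nspan.
by case: (pair_inv y) => -> /=; [|apply: (dcV NP)]; apply: Nspan.
Qed.

End AdjoinLeadingTerms.

(** * Countable hulls closed under Newton zeros and leading terms *)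

Section CountableClosure.
Variables (k : diffField) (G : oagType) (c : G -> k) (M : valuedDiffField).
Variables (L : lifting c M) (hens : henselian M).
Local Notation v := (vdf_val M).

Let zero_of n (P : {mpoly M[n]}) (x g : M) : M :=
  xget 0 [set z | z \in valring_pred v /\ P.@[jet der (x + g * z)] = 0].

(** The number of variables and the exponents of a polynomial are packed into one natural number,
    and its coefficients are passed as arguments. Zero finding thus becomes a countable family of
    operations. *)
Let zero_coded (code : nat) (s : seq M) (x g : M) : M :=
  if (unpickle code : option (nat * seq (seq nat))) is Some (n, ms) then
    @zero_of n (\sum_(j < size ms)
      nth 0 s j *: 'X_[[multinom nth 0%N (nth [::] ms j) i | i < n]]) x g
  else 0.

(** Elements of [N] are the values of finite trees whose leaves name elements of [X] and whose nodes
    carry codes of operations; there are only countably many such trees. *)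
Lemma countable_closure (X : set M) : countable X -> exists N : set M,
  [/\ countable N, X `<=` N, diff_closed der N,
    forall n (P : {mpoly M[n]}) x g l, (forall m, N P@_m) -> N x -> N g -> g != 0 ->
      hensel_data P x g l ->
      exists2 z, N z & z \in valring_pred v /\ P.@[jet der (x + g * z)] = 0 &
    forall f, N f -> f != 0 -> exists b a,
      [/\ b != 0, sim v (lead L b a) f, N (rep L b) & N (sec L a)]].
Proof.
move=> /countable_injP[f finj].
have /choice[ld ldP] : forall y : M, exists ba : k * G, y != 0 ->
    ba.1 != 0 /\ sim v (lead L ba.1 ba.2) y.
  move=> y; have [->|y0] := eqVneq y 0; first by exists (0, 0).
  by have [b [a [b0 s]]] := lead_exists L y0; exists (b, a).
pose f0 n := xget 0 [set x | X x /\ f x = n].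
pose op (code : nat) (s : seq M) : M := match code with
  | 0 => s`_0 - s`_1
  | 1 => s`_0 * s`_1
  | 2 => (s`_0)^-1
  | 3 => der s`_0
  | 4 => rep L (ld s`_0).1
  | 5 => sec L (ld s`_0).2
  | 6 => 1
  | code'.+4.+3 => zero_coded code' (drop 2 s) s`_0 s`_1
  end.
pose ev := fix ev (t : GenTree.tree nat) : M := match t with
  | GenTree.Leaf i => f0 i
  | GenTree.Node code ts => op code (map ev ts)
  end.
pose N : set M := range ev.
have Nop code s : (forall y, y \in s -> N y) -> N (op code s).
  move=> Ns; suff [ts ->] : exists ts, s = map ev ts by exists (GenTree.Node code ts).
  elim: s Ns => [|y s IH] Ns; first by exists [::].
  have [t _ ty] : N y by apply: Ns; exact: mem_head.
  have [|ts ->] := IH; first by move=> y' y's; apply: Ns; rewrite inE y's orbT.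
  by exists (t :: ts); rewrite /= ty.
have N1op code y : N y -> N (op code [:: y]) by move=> Ny; apply: Nop => y'; rewrite inE => /eqP ->.
have N2op code y y' : N y -> N y' -> N (op code [:: y; y']).
  by move=> Ny Ny'; apply: Nop => z; rewrite !inE => /orP[] /eqP ->.
exists N; split.
- apply: sub_countable (countableP [set: GenTree.tree nat]); exact: card_image_le.
- move=> x Xx; exists (GenTree.Leaf (f x)) => //=; rewrite /f0.
  case: xgetP => [y _ [Xy E]|/(_ x) /= nx]; last by case: nx.
  by apply: finj; rewrite ?inE.
- split.
  + exact: (Nop 6 [::]).
  + by move=> y y' Ny Ny'; apply: (N2op 0).
  + by move=> y y' Ny Ny'; apply: (N2op 1).
  + by move=> y Ny; apply: (N1op 2).
  + by move=> y Ny; apply: (N1op 3).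
- move=> n P x g l NP Nx Ng g0 hd; exists (zero_of P x g); last first.
    have [z Oz Pz] := hens g0 hd.
    by rewrite /zero_of; case: xgetP => [y _ []//|/(_ z)[]].
  pose ms := [seq [seq (m : 'X_{1..n}) i | i <- enum 'I_n] | m <- msupp P].
  pose cs := [seq P@_m | m <- msupp P].
  have : N (op (pickle (n, ms)).+4.+3 [:: x, g & cs]).
    apply: Nop => y; rewrite !inE => /or3P[/eqP -> //|/eqP -> //|/mapP[m _ ->]].
    exact: NP.
  rewrite /= /zero_coded drop0 pickleK /=.
  suff -> : \sum_(j < size ms) nth 0 cs j *:
      'X_[[multinom nth 0%N (nth [::] ms j) i | i < n]] = P by [].
  rewrite [RHS]mpolyE (big_nth 0%MM) big_mkord size_map; apply: eq_bigr => j _.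
  rewrite (nth_map 0%MM) // (nth_map 0%MM) //; congr (_ *: 'X_[_]).
  apply/mnmP => i; rewrite mnmE (nth_map i) ?size_enum_ord //.
  by rewrite nth_ord_enum.
- move=> y Ny y0; have [b0 s] := ldP y y0; exists (ld y).1, (ld y).2; split=> //.
    exact: (N1op 4).
  exact: (N1op 5).
Qed.

End CountableClosure.

Section ExtensionStep.
Variables (k : diffField) (G : oagType) (c : G -> k) (M1 M2 : valuedDiffField).
Variables (L1 : lifting c M1) (L2 : lifting c M2).
Hypotheses (mon1 : monotone M1) (mon2 : monotone M2).
Hypotheses (hens1 : henselian M1) (hens2 : henselian M2).
Hypothesis complete2 : countably_complete M2.
Local Notation v1 := (vdf_val M1).
Local Notation v2 := (vdf_val M2).
Local Notation B := (M1 * M2)%type.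
Local Notation der2 := (@der2 M1 M2).
Local Notation same_lead := (same_lead L1 L2).
Implicit Types K : gfield der2 same_lead.

Lemma gf_fst_inj K p q : gf_set K p -> gf_set K q -> p.1 = q.1 -> p = q.
Proof.
move=> Kp Kq E; apply/eqP; rewrite -subr_eq0; apply/eqP.
have [//|/same_lead_neq0[]] := gf_good (dcB (gf_closed K) Kp Kq).
by rewrite /= E subrr eqxx.
Qed.

(** The first projection is injective on [K], because a nonzero element of [K] has both components
    nonzero. *)
Lemma gf_countable K (N : set M1) : countable N -> (forall p, gf_set K p -> N p.1) ->
  countable (gf_set K).
Proof.
move=> /countable_injP[f finj] KN; apply/countable_injP; exists (f \o fst) => p q.
rewrite !inE => Kp Kq E; apply: (gf_fst_inj Kp Kq); apply: finj => //; rewrite inE;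
  exact: KN.
Qed.

Lemma diff_closed_fst (N : set M1) : diff_closed der N ->
  diff_closed der2 [set p | N p.1].
Proof.
move=> NP; split=> /=; first exact: (dc1 NP).
- by move=> p q; apply: (dcB NP).
- by move=> p q; apply: (dcM NP).
- by move=> p Np; case: (pair_inv p) => -> //=; apply: (dcV NP).
- by move=> p; apply: (dcD NP).
Qed.

(** A maximal field of pairs with first components in [N] projects onto [N]: otherwise
    [immediate_step] would enlarge it, the minimality clause of the extension keeping the new first
    components in [N]. *)
Lemma extension_step K x : countable (gf_set K) -> lead_closed K ->
  exists K' y, [/\ gf_set K `<=` gf_set K', countable (gf_set K'), lead_closed K' &
    gf_set K' (x, y)].
Proof.
move=> Kc Kl.
have [|N [Nc XN NP Nhens Nlead]] := @countable_closure _ _ _ _ L1 hens1 (fst @` gf_set K `|` [set x]).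
  rewrite (_ : _ `|` _ = \bigcup_(i in [set: bool]) (if i then fst @` gf_set K else [set x])).
    apply: bigcup_countable => // -[] _; last exact: countable1.
    exact: sub_countable (card_image_le _ _) Kc.
  apply/seteqP; split=> y /=; first by move=> [Ky|->]; [exists true | exists false].
  by move=> [[] _ Hy]; [left | right].
have Nx : N x by apply: XN; right.
have KN p : gf_set K p -> N p.1 by move=> Kp; apply: XN; left; exists p.
have [K1 [KK1 K1rep K1sec K1N]] := adjoin_leads Kl NP KN.
have [|F FP F0 totF|S [[K' [K'S K'N]] K1K'] maxS] := @Zorn_above B
    [set S | exists K, gf_set K = S /\ forall p, gf_set K p -> N p.1] (gf_set K1).
- by exists K1.
- have [|K' E] := @gf_chain _ der2 same_lead F F0 totF.
    by move=> S /FP[K' [E _]]; exists K'.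
  exists K'; split=> // p; rewrite E => -[S FS Sp].
  by have [K'' [E' K''N]] := FP _ FS; apply: K''N; rewrite E'.
subst S; have K'c := gf_countable Nc K'N.
have onto f : N f -> exists a : gf_type K', pr1 K' a = f.
  move=> Nf; apply: contrapT => nf.
  have [||||z [y [Nz new [K'' [K'K'' K''zy K''min]]]]] :=
    @immediate_step _ _ _ _ _ L1 L2 mon1 mon2 K' N NP _ _ _ K'c hens2 complete2 f Nf.
  - by move=> a; apply/K'N/gf_valP.
  - move=> n P x' g l Nx' Ng g0 hd; apply: (Nhens _ _ _ _ l) => // m.
    by rewrite mcoeff_map_mpoly; apply/K'N/gf_valP.
  - move=> h Nh h0; have [b [a [b0 s Nb Na]]] := Nlead h Nh h0.
    have : gf_set K' (lead2 L1 L2 b a).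
      apply: (dcM (gf_closed K')); apply: K1K'; [exact: K1rep | exact: K1sec].
    move=> /gf_val_ex[e E]; exists e.
    suff -> : pr1 K' e = lead L1 b a by [].
    by rewrite -[pr1 K' e]/((val e).1) -E.
  - by move=> a; apply/eqP => E; apply: nf; exists a.
  have K''N p : gf_set K'' p -> N p.1.
    move: p; apply: (K''min [set p | N p.1]) => //; exact: diff_closed_fst.
  have /gf_val_ex[a E] : gf_set K' (z, y).
    by apply: (maxS (gf_set K'')) => //; exists K''.
  by have /eqP := new a; apply; rewrite -[pr1 K' a]/((val a).1) -E.
have [a Ea] := onto x Nx; exists K', (pr2 K' a); split=> //.
- exact: subset_trans K1K'.
- move=> p Kp p0; have [//|[b [a' [b0 s1 s2]]]] : p = 0 \/ same_lead p by apply: gf_good Kp.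
    by move=> E; rewrite E eqxx in p0.
  have [p10 _] : p.1 != 0 /\ p.2 != 0 by apply: (@same_lead_neq0 _ _ _ _ _ L1 L2); exists b, a'.
  (* The leading pair found in [N] is the common one by uniqueness, so its lifts were already
     adjoined in [K1]. *)
  have [b' [a'' [b'0 s' Nb Na]]] := Nlead _ (K'N _ Kp) p10.
  have [Eb Ea'] := lead_inj b'0 b0 (sim_trans s' (sim_sym s1)).
  exists b, a'; split=> //; apply: K1K'; [apply: K1rep | apply: K1sec].
    by rewrite -Eb.
  by rewrite -Ea'.
- by have := gf_valP a; rewrite -Ea [X in _ X -> _]surjective_pairing.
Qed.

End ExtensionStep.

Section PrimeField.
Variables (k : diffField) (G : oagType) (c : G -> k) (M1 M2 : valuedDiffField).
Variables (L1 : lifting c M1) (L2 : lifting c M2).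
Local Notation B := (M1 * M2)%type.
Local Notation der2 := (@der2 M1 M2).
Local Notation same_lead := (same_lead L1 L2).

(** The start of the back and forth: the rational elements are lifts of those of [k], with exponent
    0. *)
Lemma prime_gfield : exists K : gfield der2 same_lead, countable (gf_set K) /\ lead_closed K.
Proof.
have Uu := @same_lead_unit _ _ _ _ _ L1 L2.
have repz z : (z%:~R : B) = rep2 L1 L2 z%:~R.
  by rewrite [LHS]surjective_pairing /rep2 !rmorph_int -!(rmorph_int (fst : {rmorphism B -> M1}))
     -!(rmorph_int (snd : {rmorphism B -> M2})).
have Sgood z : z%:~R = 0 :> B \/ same_lead z%:~R.
  have [z0|z0] := eqVneq (z%:~R : k) 0.
    by left; apply: (etrans (repz z)); rewrite z0 rep20.
  by right; rewrite repz; have := lead2_same L1 L2 0 z0; rewrite /lead2 sec20 mulr1.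
have [K KE] := prime_subfield (@der2P M1 M2) (@same_lead1 _ _ _ _ _ L1 L2)
  (@same_leadM _ _ _ _ _ L1 L2) (@same_leadV _ _ _ _ _ L1 L2) Uu Sgood.
exists K; split.
  apply: (@sub_countable _ _ _ ((fun zw : int * int => (zw.1%:~R * (zw.2%:~R)^-1 : B)) @` setT)).
    by apply: subset_card_le => p /KE[z [w [_ ->]]]; exists (z, w).
  exact: sub_countable (card_image_le _ _) (countableP _).
move=> p Kp p0; have [z [w [Uy Ep]]] := proj1 (KE p) Kp.
have repq : p = rep2 L1 L2 (z%:~R / w%:~R).
  rewrite Ep !repz rep2M; congr (_ * _).
  have w0 : (w%:~R : k) != 0.
    by apply: contraTneq (Uu _ Uy) => w0; rewrite repz w0 rep20 unitr0.
  have u : rep2 L1 L2 w%:~R \is a GRing.unit by rewrite -repz Uu.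
  by apply: (mulrI u); rewrite divrr // -rep2M divff // rep21.
have q0 : z%:~R / w%:~R != 0 :> k by apply: contra_neq p0 => q0; rewrite repq q0 rep20.
exists (z%:~R / w%:~R), 0; split=> //.
- by rewrite repq /lead /= sec0 mulr1; apply: sim_refl; rewrite fmorph_eq0.
- by rewrite repq /lead /= sec0 mulr1; apply: sim_refl; rewrite fmorph_eq0.
- by rewrite -repq.
- by rewrite sec20; apply: (dc1 (gf_closed K)).
Qed.

End PrimeField.

Section Swap.
Variables (k : diffField) (G : oagType) (c : G -> k) (M1 M2 : valuedDiffField).
Variables (L1 : lifting c M1) (L2 : lifting c M2).

Lemma swap_gfield (K : gfield (@der2 M1 M2) (same_lead L1 L2)) :
  countable (gf_set K) -> lead_closed K ->
  exists K' : gfield (@der2 M2 M1) (same_lead L2 L1),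
    [/\ countable (gf_set K'), lead_closed K' &
      forall x y, gf_set K' (y, x) <-> gf_set K (x, y)].
Proof.
move=> Kc Kl; have KP := gf_closed K.
pose sw (p : M2 * M1) : M1 * M2 := (p.2, p.1).
have gd p : gf_set K (sw p) -> p = 0 \/ same_lead L2 L1 p.
  case/gf_good => [E|[b [a [b0 s1 s2]]]]; last by right; exists b, a.
  by left; rewrite [p]surjective_pairing -[p.1]/((sw p).2) -[p.2]/((sw p).1) E.
have cl : diff_closed (@der2 M2 M1) [set p | gf_set K (sw p)].
  split=> /=; first exact: (dc1 KP).
  - by move=> p q; apply: (dcB KP).
  - by move=> p q; apply: (dcM KP).
  - move=> p Kp; case: (gd _ Kp) => [->|sp]; first by rewrite invr0; apply: dc0 KP.
    have [p1 p2] := same_lead_neq0 sp.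
    have u : sw p \is a GRing.unit by rewrite unfold_in /= !unitfE p1 p2.
    have -> : sw p^-1 = (sw p)^-1; last exact: (dcV KP).
    have -> : p^-1 = (p.1^-1, p.2^-1).
      apply: (mulrI (same_lead_unit sp)); rewrite divrr ?(same_lead_unit sp) //.
      by congr (_, _); rewrite /= divff.
    by apply: (mulrI u); rewrite divrr //; congr (_, _); rewrite /= divff.
  - by move=> p; apply: (dcD KP).
have un p : gf_set K (sw p) -> p != 0 -> p \is a GRing.unit.
  by case/gd => [->|/same_lead_unit //]; rewrite eqxx.
exists (GField cl gd un); split=> //=.
  apply: (@sub_countable _ _ _ ((fun p : M1 * M2 => (p.2, p.1)) @` gf_set K)).
    by apply: subset_card_le => -[y x] Kp; exists (x, y).
  exact: sub_countable (card_image_le _ _) Kc.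
move=> p Kp p0; have [|b [a [b0 s1 s2 Kb Ka]]] := Kl _ Kp.
  apply: contra_neq p0 => E.
  by rewrite [p]surjective_pairing -[p.1]/((sw p).2) -[p.2]/((sw p).1) E.
by exists b, a; split.
Qed.

End Swap.

(** * The back-and-forth system *)

Section BackAndForth.
Variables (k : diffField) (G : oagType) (c : G -> k).

Definition related (M1 M2 : valuedDiffField) (L1 : lifting c M1) (L2 : lifting c M2)
    n (e1 : 'I_n -> M1) (e2 : 'I_n -> M2) :=
  exists K : gfield (@der2 M1 M2) (same_lead L1 L2),
    [/\ countable (gf_set K), lead_closed K & forall i, gf_set K (e1 i, e2 i)].

Definition tame (M : valuedDiffField) := [/\ monotone M, henselian M & countably_complete M].

Section TwoStructures.
Variables (M1 M2 : valuedDiffField) (L1 : lifting c M1) (L2 : lifting c M2).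

Lemma related_sym n (e1 : 'I_n -> M1) (e2 : 'I_n -> M2) :
  related L1 L2 e1 e2 -> related L2 L1 e2 e1.
Proof.
move=> [K [Kc Kl Ke]]; have [K' [K'c K'l K'K]] := swap_gfield Kc Kl.
by exists K'; split=> // i; apply/K'K.
Qed.

Lemma related_extend n (e1 : 'I_n -> M1) (e2 : 'I_n -> M2) x : tame M1 -> tame M2 ->
  related L1 L2 e1 e2 -> exists y, related L1 L2 (env_cons x e1) (env_cons y e2).
Proof.
move=> [m1 h1 _] [m2 h2 c2] [K [Kc Kl Ke]].
have [K' [y [KK' K'c K'l K'xy]]] := extension_step m1 m2 h1 h2 c2 x Kc Kl.
exists y, K'; split=> // i; rewrite /env_cons.
by case: (unlift ord0 i) => // j; apply: KK'.
Qed.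

Lemma related_teval n (e1 : 'I_n -> M1) (e2 : 'I_n -> M2)
    (K : gfield (@der2 M1 M2) (same_lead L1 L2)) :
  (forall i, gf_set K (e1 i, e2 i)) -> forall t, gf_set K (teval e1 t, teval e2 t).
Proof.
have KP := gf_closed K; move=> Ke; elim=> //=.
- exact: dc0 KP.
- exact: (dc1 KP).
- by move=> t1 K1 t2 K2; apply: (dcAdd KP K1 K2).
- by move=> t1 K1; apply: (dcN KP K1).
- by move=> t1 K1 t2 K2; apply: (dcM KP K1 K2).
- by move=> t1 K1; apply: (dcD KP K1).
Qed.

End TwoStructures.

(** The structures and liftings are quantified inside the induction because the converse of the
    existential case uses the induction hypothesis with the two sides exchanged. *)
Lemma related_holds n (p : formula n) : forall (M1 M2 : valuedDiffField)
    (L1 : lifting c M1) (L2 : lifting c M2) (e1 : 'I_n -> M1) (e2 : 'I_n -> M2),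
  tame M1 -> tame M2 -> related L1 L2 e1 e2 -> holds p e1 <-> holds p e2.
Proof.
elim: p => {n} [n t1 t2|n t|n q IH|n q IHq r IHr|n q IH] M1 M2 L1 L2 e1 e2 T1 T2 rel /=.
- have [K [_ _ Ke]] := rel; have Kt := related_teval Ke.
  have := dcB (gf_closed K) (Kt t1) (Kt t2) => /gf_good[|/same_lead_neq0[]] /=.
    by move=> [/eqP + /eqP]; rewrite !subr_eq0 => /eqP -> /eqP ->.
  by rewrite !subr_eq0 => /eqP n1 /eqP n2; split.
- have [K [_ _ Ke]] := rel; have /gf_val_ex[a Ea] := related_teval Ke t.
  have inO (M : valuedDiffField) (x : M) : (x \in valring_pred (vdf_val M)) = val_le (vdf_val M) 1 x.
    by rewrite val_le_div ?oner_neq0 // divr1.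
  have -> : teval e1 t = pr1 K a by rewrite -[pr1 K a]/((val a).1) -Ea.
  have -> : teval e2 t = pr2 K a by rewrite -[pr2 K a]/((val a).2) -Ea.
  by rewrite !inO -(rmorph1 (pr1 K)) pr_le rmorph1.
- by have := IH _ _ L1 L2 e1 e2 T1 T2 rel; tauto.
- by have := IHq _ _ L1 L2 e1 e2 T1 T2 rel; have := IHr _ _ L1 L2 e1 e2 T1 T2 rel; tauto.
- split=> -[x qx].
    have [y rel'] := related_extend x T1 T2 rel; exists y.
    by apply/(IH _ _ L1 L2 _ _ T1 T2 rel').
  have [y rel'] := related_extend x T2 T1 (related_sym rel); exists y.
  by apply/(IH _ _ L2 L1 _ _ T2 T1 rel').
Qed.

Theorem tame_equivalent (M1 M2 : valuedDiffField) (L1 : lifting c M1) (L2 : lifting c M2) :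
  tame M1 -> tame M2 -> elementarily_equivalent M1 M2.
Proof.
move=> T1 T2 p; have [K [Kc Kl]] := prime_gfield L1 L2.
by apply: (related_holds p T1 T2 (L1 := L1) (L2 := L2)); exists K; split=> // -[].
Qed.

End BackAndForth.

(** * Hahn fields *)

Definition spherically_complete (M : valuedDiffField) :=
  forall C : set (M * M),
    (forall p q, C p -> C q -> val_le (vdf_val M) p.2 (p.1 - q.1) ||
                               val_le (vdf_val M) q.2 (p.1 - q.1)) ->
  exists y, forall p, C p -> val_le (vdf_val M) p.2 (y - p.1).

Section CompleteHenselian.
Variables (k : diffField) (G : oagType) (c : G -> k) (M : valuedDiffField).
Variables (L : lifting c M) (mon : monotone M) (ls : linearly_surjective k).
Hypothesis complete : spherically_complete M.
Local Notation v := (vdf_val M).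
Local Notation O := (valring_pred v).
Local Notation m := (maxideal_pred v).

Lemma rep_O b : rep L b \in O.
Proof.
have [->|b0] := eqVneq b 0; first by rewrite raddf0 rpred0.
by case: (rep_unit L b0).
Qed.

Lemma rep_m b : rep L b \in m -> b = 0.
Proof. by move=> mb; apply/eqP; apply: contraT => /(rep_unit L)[_ /negP]. Qed.

Lemma rep_iter b i : iter i der (rep L b) = rep L (iter i der b).
Proof. by elim: i => //= i ->; rewrite rep_der. Qed.

Lemma rep_residue x : x \in O -> exists b, x - rep L b \in m.
Proof.
move=> Ox; have [mx|mx] := boolP (x \in m); first by exists 0; rewrite raddf0 subr0.
have ux : vunit v x by split.
have x0 := vunit_neq0 ux; have [b [a [b0 s]]] := lead_exists L x0.
exists b; have a0 : a = 0.
  apply/le_anti; rewrite -!(sec_le L) sec0.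
  have e1 : val_le v 1 x by rewrite val_le_div ?oner_neq0 // divr1.
  have e2 : val_le v x 1 by rewrite val_le_div // mul1r; case: (vunitV ux).
  have s1 : sim v (lead L b a) x := s.
  have e3 z : val_le v (lead L b a) z = val_le v (sec L a) z.
    have [->|z0] := eqVneq z 0; first by rewrite !val_le0.
    rewrite /lead -(val_leM _ _ _ (_ : (rep L b)^-1 != 0)) ?invr_eq0 ?fmorph_eq0 //.
    rewrite mulKf ?fmorph_eq0 // !val_le_div ?sec_neq0 // -mulrA vunitMl_O //.
    exact/vunitV/rep_unit.
  rewrite -e3 (val_le_siml _ s1) e2 /= -(val_le_siml _ (sim_refl v (oner_neq0 M))).
  have e4 : val_le v 1 (lead L b a).
    by rewrite (val_le_sim (sim_refl v (oner_neq0 M)) s1).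
  move: e4; rewrite val_le_div ?oner_neq0 // divr1 /lead vunitMl_O; last exact: rep_unit.
  by rewrite val_le_div ?oner_neq0 // divr1.
rewrite a0 in s; move: s; rewrite /lead sec0 mulr1 simE ?fmorph_eq0 // mulrC.
by rewrite vunitMl_m //; apply/vunitV/rep_unit.
Qed.

Lemma linear_approx n (W : {mpoly M[n]}) : integral v W ->
  (forall j, (1 < mdeg j)%N -> W@_j \in m) -> (exists l, W@_U_(l) \notin m) ->
  exists2 z, z \in O & W.@[jet der z] \in m.
Proof.
move=> iW mW [l lW].
have /choice[r rP] : forall j, exists b, W@_j - rep L b \in m by move=> j; apply: rep_residue.
pose P : {poly k} := \poly_(i < n) (if insub i is Some j then r U_(j)%MM else 0).
have Pi (i : 'I_n) : P`_i = r U_(i)%MM.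
    by rewrite coef_poly ltn_ord insubT //= => Hi; congr (r U_(_)%MM); apply: val_inj.
have Pl : P`_l != 0.
  rewrite Pi; apply: contra lW => /eqP rl; have := rP U_(l)%MM.
  by rewrite rl raddf0 subr0.
have P0 : P != 0 by apply: contraNneq Pl => ->; rewrite coef0.
have [y Ey] := ls P0 (- r 0%MM).
have {}Ey : \sum_(i < n) r U_(i)%MM * iter i der y = - r 0%MM.
  rewrite -Ey /lin_diff_op.
  have sP : (size P <= n)%N := size_poly _ _.
  rewrite (big_ord_widen n (fun i => P`_i * iter i der y) sP) [RHS]big_mkcond /=.
  apply: eq_bigr => i _; rewrite -Pi; case: ssrnat.ltnP => // si.
  by rewrite nth_default // mul0r.
exists (rep L y); first exact: rep_O.
have Oy (i : 'I_n) : jet der (rep L y) i \in O by apply: iterO => //; apply: rep_O.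
have RW := linear_part (P := W) erefl (fun=> erefl) mW.
rewrite -(subrK ((W@_0)%:MP + \sum_i W@_U_(i) *: 'X_i) W) mevalD.
apply: maxidealD; first exact: infinitesimal_meval.
rewrite mevalD mevalC (raddf_sum (meval _)) /=.
have -> : \sum_(i < n) (W@_U_(i) *: 'X_i).@[jet der (rep L y)] =
    \sum_(i < n) (W@_U_(i) - rep L (r U_(i)%MM)) * jet der (rep L y) i
    + rep L (\sum_(i < n) r U_(i)%MM * iter i der y).
  rewrite raddf_sum -big_split /=; apply: eq_bigr => i _.
  by rewrite mevalZ mevalXU rmorphM -rep_iter mulrBl subrK.
rewrite Ey raddfN addrCA /=; apply: maxidealD; last exact: rP.
by apply: maxideal_sum => i _; rewrite maxidealMr.
Qed.

(** Zorn's lemma replaces a transfinite Newton iteration. Suppose that the ball contains no zero. A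
    point [a] carries the ball of radius P(a)/cx; along a chain of improvements these balls have a
    common point by spherical completeness, and at a maximal point one more Newton step still
    improves. *)
Lemma complete_henselian : henselian M.
Proof.
move=> n P x g l0 g0 [hp hc].
(* The derivative at the centre serves at all points of the ball, where it changes only by a factor
   in 1 + m. *)
pose cx := (P^`M(l0)).@[jet der x].
have cx0 : cx != 0 := hp_neq0 hp.
pose T := {a : M | val_le v g (a - x)}.
pose e (a : M) := P.@[jet der a] / cx.
have [[a [Ta ea]]|nz] := pselect (exists a, val_le v g (a - x) /\ P.@[jet der a] = 0).
  exists ((a - x) / g); first by rewrite -val_le_div.
  by rewrite mulrCA divff // mulr1 addrC subrK.
have e0 (a : T) : e (val a) != 0.
  rewrite mulf_neq0 ?invr_eq0 //; apply/eqP => E; apply: nz; exists (val a).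
  by split=> //; exact: valP a.
(* Newton approximation inside the ball of radius e a around a *)
have local (a : T) : val_le v g (e (val a)) -> exists W : {mpoly M[n]}, [/\ integral v W,
    forall j, (1 < mdeg j)%N -> W@_j \in m, exists l, W@_U_(l) \notin m &
    exists2 u, vunit v u & forall z, e (val a + e (val a) * z) = e (val a) * u * W.@[jet der z]].
  move=> ge; have [hpa sa] := hensel_partials_near mon g0 hp (valP a) ge.
  have ca0 := hp_neq0 hpa.
  have hca : val_le v (e (val a) * (P^`M(l0)).@[jet der (val a)]) P.@[jet der (val a)].
    have s : sim v P.@[jet der (val a)] (e (val a) * (P^`M(l0)).@[jet der (val a)]).
      rewrite -{1}(divfK cx0 P.@[jet der (val a)]); apply: simM => //.
      exact/sim_refl/e0.
    by rewrite -(val_le_siml _ s) val_le_refl.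
  have [W [iW mW lW _ EW]] := hensel_twist mon (e0 a) hpa hca.
  exists W; split=> //; exists ((P^`M(l0)).@[jet der (val a)] / cx); first exact: sim_ratio.
  by move=> z; rewrite {1}/e EW mulrAC -!mulrA.
have ge (a : T) : val_le v g (e (val a)).
  have [W [iW _ _ _ EW]] := hensel_twist mon g0 hp hc.
  pose z := (val a - x) / g.
  have Oz : z \in O by rewrite -val_le_div //; exact: valP a.
  have := EW z; rewrite mulrCA divff // mulr1 addrC subrK => E.
  rewrite /e E mulrAC mulrK ?unitfE //; apply: val_leMl.
  by apply: integral_meval => // j; apply: iterO.
pose R (a b : T) := (a == b) || (val_le v (e (val a)) (val b - val a) && ~~ val_le v (e (val b)) (e (val a))).
have Rlt (a b d : T) : val_le v (e (val a)) (val b - val a) -> ~~ val_le v (e (val b)) (e (val a)) ->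
    R b d -> val_le v (e (val a)) (val d - val a) /\ ~~ val_le v (e (val d)) (e (val a)).
  move=> ab ab'; rewrite /R => /orP[/eqP <-//|/andP[bd bd']]; split.
    rewrite -(subrK (val b) (val d)) -addrA; apply: val_leD => //.
    by apply: val_le_trans bd; apply: val_ltW.
  by apply: val_le_lt bd'; apply: val_ltW.
have Tx : val_le v g (x - x) by rewrite subrr val_le0.
have [a|b a d|C totC|a amax] := @ZL_preorder T (exist _ x Tx) R.
- by rewrite /R eqxx.
- move=> /orP[/eqP -> //|/andP[ab ab'] bd]; have [h1 h2] := Rlt _ _ _ ab ab' bd.
  by rewrite /R h1 h2 orbT.
(* A chain with a largest element needs no limit. In the other case each element has a strictly
   better successor in the chain, which makes the comparison with the limit strict. *)
- have [[a Ca amax]|nomax] := pselect (exists2 a, C a & forall b, C b -> R b a).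
    by exists a.
  pose D : set (M * M) := [set p | exists2 a : T, C a & p = (val a, e (val a))].
  have [|y yD] := complete (C := D).
    move=> _ _ [a Ca ->] [b Cb ->] /=.
    have [/orP[/eqP ->|/andP[ab _]]|/orP[/eqP ->|/andP[ba _]]] := totC _ _ Ca Cb.
    - by rewrite subrr val_le0.
    - by rewrite -val_leN opprB ab.
    - by rewrite subrr val_le0.
    - by rewrite ba orbT.
  have [C0|C0] := pselect (C !=set0); last first.
    by exists (exist _ x Tx) => b Cb; case: C0; exists b.
  have [a0 Ca0] := C0.
  have Ty : val_le v g (y - x).
    rewrite -(subrK (val a0) y) -addrA; apply: val_leD; last exact: valP a0.
    by apply: val_le_trans (ge a0) _; apply: (yD (val a0, e (val a0))); exists a0.
  pose y' : T := exist _ y Ty.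
  have ey a : C a -> val_le v (e (val a)) (e y).
    move=> Ca; have [W [iW _ _ [u uu EW]]] := local a (ge a).
    pose z := (y - val a) / e (val a).
    have Oz : z \in O.
      by rewrite -val_le_div ?e0 //; apply: (yD (val a, e (val a))); exists a.
    have := EW z; rewrite mulrCA divff ?e0 // mulr1 addrC subrK => ->.
    rewrite -mulrA; apply: val_leMl; rewrite vunitMl_O //.
    by apply: integral_meval => // j; apply: iterO.
  exists y' => a Ca; apply/orP; right; apply/andP; split.
    by apply: (yD (val a, e (val a))); exists a.
  have [b Cb nba] : exists2 b, C b & ~~ R b a.
    apply: contrapT => nb; apply: nomax; exists a => // b Cb.
    by apply: contrapT => /negP nba; apply: nb; exists b.
  have [ab|ba] := totC _ _ Ca Cb; last by rewrite ba in nba.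
  have /orP[/eqP Eab|/andP[_ ab']] := ab; first by rewrite Eab /R eqxx in nba.
  exact: val_lt_le ab' (ey b Cb).
- have [W [iW mW lW [u uu EW]]] := local a (ge a).
  have [z Oz Wz] := linear_approx iW mW lW.
  pose b := val a + e (val a) * z.
  have ab : val_le v (e (val a)) (b - val a) by rewrite /b addrAC subrr add0r; apply: val_leMl.
  have Tb : val_le v g (b - x).
    rewrite -(subrK (val a) b) -addrA; apply: val_leD; last exact: valP a.
    exact: val_le_trans (ge a) ab.
  have eb : ~~ val_le v (e b) (e (val a)).
    rewrite val_lt_div ?e0 // /b EW -mulrA mulrAC divff ?e0 // mul1r.
    by rewrite vunitMl_m.
  have /amax : R a (exist _ b Tb) by apply/orP; right; rewrite /= ab eb.
  move=> /orP[/eqP E|/andP[_ /= ba]].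
    by move: eb; rewrite -E /= val_le_refl.
  by case/negP: ba; apply: val_ltW.
Qed.

End CompleteHenselian.

Section HahnFieldTame.
Variables (k : diffField) (G : oagType) (c : {additive G -> k}).
Local Notation H := (hahn k G).
Local Notation K := (hahn_vdf c).
Local Notation v := (hahn_val k G).
Implicit Types (f g : H).

Lemma hahn_le f g : f != 0 -> val_le v f g <-> forall d, d < hval f -> g d = 0.
Proof.
move=> f0; rewrite /val_le f0 /=; split=> [/orP[/eqP -> //|fg] d df|fg].
  have [->//|g0] := eqVneq g 0; exact/(hcoef_lt g0)/(lt_le_trans df).
have [//|g0] := eqVneq g 0; have [gv _] := hvalP g0.
by rewrite /= oag_leNgt; apply: contra gv => /fg ->.
Qed.

Lemma hahn_monotone : monotone K.
Proof.
move=> f; have [->|f0] := eqVneq f 0.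
  by rewrite (_ : der 0 = 0) ?val_le_refl //; apply: (is_der0 (derP K)).
apply/hahn_le => // d df; rewrite -[der f]/(hder c f) hcoef_der.
by rewrite (hcoef_lt f0) // der_add0 mulr0 addr0.
Qed.

(** The coefficient of the common point at [d] is read off from any centre whose radius lies beyond
    [d]. The support is well ordered because each initial segment of it agrees with the support of
    some centre. *)
Lemma hahn_complete : spherically_complete K.
Proof.
move=> C compat.
pose below (d : G) g := g = 0 \/ d < hval g.
have agree p q d : C p -> C q -> below d p.2 -> below d q.2 -> (p.1 : H) d = (q.1 : H) d.
  move=> Cp Cq dp dq; apply/eqP; rewrite -subr_eq0 -hcoefN -hcoefD; apply/eqP.
  have key g : below d g -> val_le v g (p.1 - q.1) -> (p.1 - q.1 : H) d = 0.
    have [->|g0] := eqVneq g 0; first by rewrite val_ge0 => _ /eqP ->; rewrite hcoef0.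
    by move=> [g00|dg]; [rewrite g00 eqxx in g0 | move=> /(hahn_le _ g0); apply].
  by have [] := orP (compat _ _ Cp Cq); apply: key.
pose y d := xget 0 [set x | exists p, [/\ C p, below d p.2 & x = (p.1 : H) d]].
have yE p d : C p -> below d p.2 -> y d = (p.1 : H) d.
  move=> Cp dp; rewrite /y; case: xgetP => [x _ [q [Cq dq ->]]|/(_ ((p.1 : H) d))[]].
    exact: agree.
  by exists p.
have ysupp d : y d != 0 -> exists p, C p /\ below d p.2.
  rewrite /y; case: xgetP => [x _ [q [Cq dq _]] _|_]; last by rewrite eqxx.
  by exists q.
have below_le d d' g : d' <= d -> below d g -> below d' g.
  by move=> dd [->|dg]; [left | right; apply: le_lt_trans dg].
have yH : y \in @hahn_pred k G.
  apply/asboolP => B sB [x Bx]; have [p [Cp xp]] := ysupp _ (sB _ Bx).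
  have [||m [Bm mx] mmin] := hahnP (f := p.1 : H) (B := B `&` [set d | d <= x]).
  - by move=> d [Bd dx]; have := sB _ Bd; rewrite /supp /mkset /= (yE p d Cp (below_le _ _ _ dx xp)).
  - by exists x; split=> /=.
  exists m => // d Bd; have [dx|] := boolP (d <= x); first exact: mmin.
  by rewrite -oag_ltNge => /ltW; apply: le_trans.
exists (Hahn yH) => p Cp.
have [p0|p0] := eqVneq p.2 0.
  rewrite p0 val_ge0 subr_eq0; apply/eqP/hahn_eqP => d /=.
  by apply: yE => //; left.
apply/hahn_le => // d dp; rewrite hcoefD hcoefN /=; apply/eqP; rewrite subr_eq0; apply/eqP.
by apply: yE => //; right.
Qed.

Definition hahn_rep (b : k) : H := hmono 0 b.

Lemma hahn_rep_additive : zmod_morphism hahn_rep.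
Proof.
move=> x y; apply: hahn_eqP => a; rewrite hcoefD hcoefN !hcoef_mono.
by case: eqP => _; rewrite ?subr0.
Qed.

Lemma hahn_rep_multiplicative : monoid_morphism hahn_rep.
Proof.
split=> [|x y]; first by [].
apply: hahn_eqP => a; rewrite -[RHS]/(hmul _ _ a) hmul_mono subr0 !hcoef_mono.
by case: eqP => _; rewrite ?mul0r.
Qed.

HB.instance Definition _ := GRing.isZmodMorphism.Build k H hahn_rep hahn_rep_additive.
HB.instance Definition _ := GRing.isMonoidMorphism.Build k H hahn_rep hahn_rep_multiplicative.

Lemma hahn_lead b a : hahn_rep b * hmono a 1 = hmono a b.
Proof.
apply: hahn_eqP => d; rewrite -[LHS]/(hmul _ _ d) hmul_mono mulr1 !hcoef_mono subr_eq0.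
by [].
Qed.

Lemma hmono_neq0 a (b : k) : b != 0 -> hmono a b != 0 :> H.
Proof.
apply: contra_neq => E; have := hcoef_mono a b a.
by rewrite E eqxx hcoef0.
Qed.

Lemma hahn_lifting : lifting c K.
Proof.
exists (hahn_rep : {rmorphism k -> H}) (fun a => hmono a 1 : H).
- move=> b; apply: hahn_eqP => a; rewrite -[LHS]/(hder c (hahn_rep b) a) hcoef_der !hcoef_mono.
  have [->|_] := eqVneq a 0; first by rewrite raddf0 mul0r addr0.
  by rewrite der_add0 mulr0 addr0.
- move=> b b0; apply/vunitE; first exact: hmono_neq0.
  exact: hval_mono.
- by [].
- move=> a b; apply: hahn_eqP => d; rewrite -[RHS]/(hmul _ _ d) hmul_mono mulr1 !hcoef_mono.
  by rewrite subr_eq.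
- move=> a; apply: hahn_eqP => d; rewrite -[LHS]/(hder c (hmono a 1) d) hcoef_der hahn_lead !hcoef_mono.
  have [->|_] := eqVneq d a; last by rewrite der_add0 mulr0 addr0.
  by rewrite mulr1 (is_der1 (derP k)) add0r.
- move=> a b; have n x := hmono_neq0 x (oner_neq0 k).
  by rewrite /val_le !(negbTE (n _)) /= -[_ <= _]/(hval _ <= hval _) !hval_mono ?oner_neq0.
- move=> f f0; have [fv fmin] := hvalP f0; exists (f (hval f)), (hval f); split=> //.
  rewrite /= hahn_lead; have n := hmono_neq0 (hval f) fv.
  apply/sim_val_lt => //; apply/negP; rewrite /val_le (negbTE n) /= => /andP[h0].
  have [hv _] := hvalP h0; rewrite -[_ <= _]/(hval _ <= hval _) hval_mono // => hle.
  move/negP: hv; apply; rewrite hcoefD hcoefN hcoef_mono.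
  move: hle; rewrite le_eqVlt => /orP[/eqP ->|hlt]; first by rewrite eqxx subrr.
  by rewrite lt_eqF // subr0 (hcoef_lt f0).
Qed.

Lemma hahn_tame : linearly_surjective k -> tame K.
Proof.
move=> ls; split; [exact: hahn_monotone | | ].
  exact: complete_henselian hahn_lifting hahn_monotone ls hahn_complete.
by move=> C _; apply: hahn_complete.
Qed.

End HahnFieldTame.

(** * Lifting the residue field and logarithmic derivatives *)

Section ResidueFieldLift.
Variables (M : valuedDiffField) (mon : monotone M) (hens : henselian M).
Local Notation v := (vdf_val M).
Local Notation O := (valring_pred v).
Local Notation m := (maxideal_pred v).

Lemma vunit_unit (x : M) : vunit v x -> x \is a GRing.unit.
Proof. by move=> /vunit_neq0; rewrite unitfE. Qed.

(** By Taylor expansion each nonconstant coefficient carries a factor [g], up to division by a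
    positive integer, which is a unit. *)
Lemma infinitesimal_aff n (P : {mpoly M[n]}) (a : 'I_n -> M) g : integral v P ->
  (forall i, a i \in O) -> g \in m -> forall j, j != 0%MM -> (aff a g P)@_j \in m.
Proof.
move=> iP Oa mg j /mnm_neq0[i [j' ->]].
have := mcoeff_mderiv i (aff a g P) j'; rewrite aff_mderiv mcoeffZ -mulr_natl => E.
rewrite -(vunitMl_m _ (nat_vunit M (j' i))) -E maxidealMr //.
have : integral v (aff a g P^`M(i)); last exact.
apply: integral_mmap => [l|l]; first by apply: integral_aff_var => //; apply: maxideal_valring.
by rewrite mcoeff_mderiv -mulr_natl rpredM // rpred_nat.
Qed.

Lemma vunit_int (z : int) : z%:~R = 0 :> M \/ vunit v z%:~R.
Proof.
case: z => [[|n]|n]; [by left | by right; apply: nat_vunit | right].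
rewrite NegzE rmorphN /=; split; first by rewrite rpredN rpred_nat.
by rewrite maxidealN; case: (nat_vunit M n).
Qed.

Section Step.
Variable K : gfield der (vunit v).
Local Notation A := (gf_type K).
Local Notation i0 := (val : A -> M).

Lemma gf_integral n (P : {mpoly A[n]}) : integral v (map_mpoly i0 P).
Proof.
move=> j; rewrite mcoeff_map_mpoly /=.
by case: (gf_good (gf_valP P@_j)) => [/= ->|[]//]; apply: rpred0.
Qed.

(** A minimal polynomial with infinitesimal value [g] at [x] has nonzero partial derivatives of unit
    value there, so the Newton property with radius [g] moves [x] to an exact zero [z] of the same
    residue class. No element of [K] has this residue, so [z] is new. *)
Lemma lift_step x : x \in O -> (forall b, gf_set K b -> x - b \notin m) ->
  exists2 z, ~ gf_set K z & gf_extension K z.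
Proof.
move=> Ox xK.
have Oj n (y : M) (i : 'I_n) : y \in O -> jet der y i \in O by apply: iterO.
have i0_der : forall a : A, i0 (gf_der a) = der (i0 a) by [].
have evE y n (P : {mpoly A[n]}) : devalB y P = (map_mpoly i0 P).@[jet der y].
  by rewrite /devalB meval_map_mpoly.
have evO y n (P : {mpoly A[n]}) : y \in O -> devalB y P \in O.
  by move=> Oy; rewrite evE; apply: integral_meval; [exact: gf_integral | move=> i; apply: Oj].
have dP := derP M; have vM := @vunitM _ v; have vV := @vunitV _ v.
pose bad n (P : {mpoly A[n]}) : Prop := devalB x P \in m.
have good n (P : {mpoly A[n]}) : ~ bad n P -> vunit v (devalB x P).
  by move=> /negP nb; split=> //; apply: evO.
have [nobad|] := pselect (forall n (P : {mpoly A[n]}), P != 0 -> ~ bad n P).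
  exists x; first by move=> Kx; have := xK x Kx; rewrite subrr maxideal0.
  apply: (extend_transcendental dP (vunit1 v) vM vV vunit_unit) => n P P0.
  exact/good/nobad.
move=> /existsNP[n0 /existsNP[P0 /not_implyP[P00 /contrapT badP0]]].
have charA n : (n.+1%:R : A) != 0.
  by rewrite -(fmorph_eq0 (val : {rmorphism A -> M})) rmorph_nat char0_vdf.
have bad0 (P : {mpoly A[0]}) : P != 0 -> ~ bad 0%N P.
  move=> P'0; apply/negP.
  have EP : P = (P@_0)%:MP.
    apply: msize1_polyC; rewrite msizeE; apply/bigmax_leqP_seq => j _ _.
    by rewrite mdegE big_ord0.
  have c0 : P@_0 != 0 by apply: contra_neq P'0 => c0; rewrite EP c0.
  rewrite EP devalB_const; case: (gf_good (gf_valP P@_0)) => [E|[]//].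
  by case/negP: c0; apply/eqP/val_inj; rewrite rmorph0.
have bad_widen n (Q : {mpoly A[n]}) : bad n.+1 (mwiden Q) -> bad n Q.
  by rewrite /bad devalB_mwiden.
have [n [P [[[Pn0 badP] low_order low_degree sP dmax] partials]]] :=
  minimal_bad charA bad0 bad_widen P00 badP0.
pose g := devalB x P.
have shape_at n' (Q : {mpoly A[n']}) : vunit v (devalB x Q) ->
    shape v (aff (jet der x) g (map_mpoly i0 Q)).
  move=> [OQ mQ]; have Q0 := @vunit_neq0 _ v _ (conj OQ mQ).
  split; rewrite aff_coef0 -evE // => j j0; rewrite maxidealMr //.
    by apply: infinitesimal_aff => //; [exact: gf_integral | move=> i; apply: Oj].
  exact: valring_inv.
(* If [g] is 0 then [x] is already a zero; this case is kept apart because a ball for the Newton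
   property has nonzero radius. *)
have [z [zx Pz]] : exists z, z - x \in m /\ devalB z P = 0 /\
    (g = 0 -> z = x) /\ (g != 0 -> val_le v g (z - x)).
  have [g0|g0] := eqVneq g 0; first by exists x; rewrite subrr maxideal0.
  have Q := hens (G := map_mpoly i0 P) (x := x) (l0 := ord_max) g0.
  have [|w Ow Pw] := Q.
    have um : vunit v (devalB x P^`M(ord_max)) by apply: good; apply: partials.
    have der_ev l : devalB x P^`M(l) = ((map_mpoly i0 P)^`M(l)).@[jet der x].
      by rewrite evE map_mpoly_mderiv.
    split; [split|].
    + move=> l; rewrite -map_mpoly_mderiv; have [->|Pl] := eqVneq P^`M(l) 0; first by left; rewrite raddf0.
      by right; apply: shape_at; apply: good; apply: partials.
    + move=> l; suff : val_le v (devalB x P^`M(ord_max)) (devalB x P^`M(l)) by rewrite !der_ev.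
      rewrite val_le_div; last exact: vunit_neq0 um.
      by apply: rpredM; [exact: evO | case: (vunitV um)].
    + by rewrite -map_mpoly_mderiv -evE (vunit_neq0 um).
    + rewrite -map_mpoly_mderiv -!evE val_le_div ?mulf_neq0 ?(vunit_neq0 um) //.
      by rewrite invfM mulrA divff // mul1r; case: (vunitV um).
  exists (x + g * w); rewrite addrAC subrr add0r evE Pw; split; first by rewrite maxidealMr.
  by split=> //; split=> [g00|_]; [rewrite g00 eqxx in g0 | apply: val_leMl].
case: Pz => Pz [gz gz'].
have low_z n' (Q : {mpoly A[n']}) : ~ bad n' Q -> vunit v (devalB z Q).
  move=> /good uQ; have [g0|g0] := eqVneq g 0; first by rewrite gz.
  have [_ s] := shape_near mon g0 (shape_at _ _ uQ) (gz' g0) (val_le_refl _ _).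
  have Q0 := vunit_neq0 uQ; rewrite evE -(divfK Q0 (_.@[_])); apply: vunitM => //.
  by rewrite evE; apply: sim_ratio.
exists z; first by move=> Kz; have := xK z Kz; rewrite -maxidealN opprB zx.
apply: (extend_algebraic dP (vunit1 v) vM vV vunit_unit (G := P)) => //.
- by move=> Q Q0; apply: low_z; apply: low_order.
- by move=> Q Q0 sQ; apply: low_z; apply: low_degree.
Qed.

End Step.

Theorem residue_field_lift : exists K : gfield der (vunit v),
  forall x, x \in O -> exists2 b, gf_set K b & x - b \in m.
Proof.
have dP := derP M; have vM := @vunitM _ v; have vV := @vunitV _ v.
have [K0 _] := prime_subfield dP (vunit1 v) vM vV vunit_unit vunit_int.
have [|F FP F0 totF|S [[K <-] _] maxK] := @Zorn_above M
    [set S | exists K : gfield der (vunit v), gf_set K = S] (gf_set K0).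
- by exists K0.
- exact: (@gf_chain _ der (vunit v)).
exists K => x Ox; apply: contrapT => nb.
have [|z Kz [K' [KK' K'z _]]] := @lift_step K x Ox.
  by move=> b Kb; apply/negP => xb; apply: nb; exists b.
by apply: Kz; apply: (maxK (gf_set K')) => //; exists K'.
Qed.

(* Solves der u = - e u in 1 + m, with e the infinitesimal part of the
   logarithmic derivative of x. *)
Lemma log_derivative_lift (K : gfield der (vunit v)) x :
  (forall y, y \in O -> exists2 b, gf_set K b & y - b \in m) -> x != 0 ->
  exists y, [/\ y != 0, v y = v x & exists2 b, gf_set K b & der y = b * y].
Proof.
move=> Klift x0; have Olog : der x / x \in O by rewrite -val_le_div.
have [b Kb mb] := Klift _ Olog; set e := _ - b in mb.
have Ex : der x = (b + e) * x by rewrite /e addrC subrK divfK.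
have [e0|e0] := eqVneq e 0; first by exists x; split=> //; exists b; rewrite // Ex e0 addr0.
(* For u = 1 + y the equation u' = - e u becomes y' + e y + e = 0. Its value at 0 is [e], which is
   taken as radius and makes y infinitesimal. *)
pose P : {mpoly M[2]} := 'X_ord_max + (e *: 'X_ord0 + e%:MP).
have P0 : P^`M(ord0) = e%:MP.
  rewrite /P !mderivD mderivC mderivZ !mderivX !mnm1E /= scale0r add0r addr0 scale1r.
  have -> : (U_(ord0) - U_(ord0))%MM = 0%MM :> 'X_{1..2} by apply/mnmP => j; rewrite mnmBE subnn mnm0E.
  by rewrite mpolyX0 alg_mpolyC.
have P1 : P^`M(ord_max) = 1.
  rewrite /P !mderivD mderivC mderivZ !mderivX !mnm1E /= scale0r scaler0 !addr0 scale1r.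
  have -> : (U_(ord_max) - U_(ord_max))%MM = 0%MM :> 'X_{1..2} by apply/mnmP => j; rewrite mnmBE subnn mnm0E.
  by rewrite mpolyX0.
have Pl (l : 'I_2) : P^`M(l) = e%:MP \/ P^`M(l) = 1.
  by case: l => -[|[|//]] l2; [left; rewrite -P0 | right; rewrite -P1]; congr P^`M(_); apply: val_inj.
have Pev y : P.@[jet der y] = der y + e * y + e.
  by rewrite !mevalD mevalZ !mevalXU mevalC addrA.
have shC a : a != 0 -> shape v (a%:MP : {mpoly M[2]}).
  move=> a0; split; first by rewrite mcoeffC eqxx mulr1.
  by move=> j j0; rewrite !mcoeffC (negbTE j0) mulr0 mul0r maxideal0.
have [|w Ow] := hens (G := P) (x := 0) (l0 := ord_max) e0.
  split; [split|].
  - move=> l; right; case: (Pl l) => ->; rewrite /aff ?mmapC; first exact: shC.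
    exact/shC/oner_neq0.
  - move=> l; rewrite P1 meval1 val_le_div ?oner_neq0 // divr1; case: (Pl l) => ->.
      by rewrite mevalC maxideal_valring.
    by rewrite meval1 rpred1.
  - by rewrite P1 meval1 oner_neq0.
  - by rewrite P1 meval1 mulr1 Pev (is_der0 (derP M)) mulr0 !add0r val_le_refl.
rewrite add0r Pev => E; pose u := 1 + e * w.
have uu : vunit v u by apply: vunit_1addm; rewrite maxidealMr.
have u0 := vunit_neq0 uu.
exists (x * u); split; first by rewrite mulf_neq0.
  by rewrite Defs.valM //; move/(vunitE _ u0): uu => ->; rewrite addr0.
exists b => //; rewrite (is_derM (derP M)) Ex.
have -> : der u = - (e * u).
  rewrite /u (is_derD (derP M)) (is_der1 (derP M)) add0r.
  by apply/eqP; rewrite -addr_eq0 mulrDr mulr1 [e + _]addrC addrA E.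
ring.
Qed.

End ResidueFieldLift.

(** * Ultrapowers *)

Section UltrafilterOnNat.

Lemma ultrafilter_exists : exists U : set_system nat,
  UltraFilter U /\ forall N, U [set n | (N <= n)%N].
Proof.
have [U [UU sub]] := @ultraFilterLemma nat \oo _.
by exists U; split=> // N; apply: sub; exists N.
Qed.

Definition ult : set_system nat := projT1 (cid ultrafilter_exists).

Lemma ult_ultra : UltraFilter ult.
Proof. by rewrite /ult; case: cid => U /= []. Qed.

Lemma ult_ge N : ult [set n | (N <= n)%N].
Proof. by rewrite /ult; case: cid => U /= []. Qed.

Lemma ultT : ult setT.
Proof. by have H := @ultra_proper _ _ ult_ultra; exact: filterT. Qed.

Lemma ultI A B : ult A -> ult B -> ult (A `&` B).
Proof. by have H := @ultra_proper _ _ ult_ultra; exact: filterI. Qed.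

Lemma ultS A B : A `<=` B -> ult A -> ult B.
Proof. by have H := @ultra_proper _ _ ult_ultra; exact: filterS. Qed.

Lemma ult_not A : ~ ult A <-> ult (~` A).
Proof.
have H := @ultra_proper _ _ ult_ultra; split; first by have [] := in_ultra_setVsetC A ult_ultra.
move=> nA uA; have := ultI uA nA; rewrite setICr => u0; exact: (@filter_not_empty _ ult _ u0).
Qed.

Lemma ult_all : forall A : set nat, (forall n, A n) -> ult A.
Proof. by move=> A An; apply: ultS ultT. Qed.

Lemma ult0 : ~ ult set0.
Proof. by apply/ult_not; rewrite setC0; apply: ultT. Qed.

Lemma ult_bigI n (A : nat -> set nat) : (forall i, (i < n)%N -> ult (A i)) ->
  ult [set t | forall i, (i < n)%N -> A i t].
Proof.
elim: n => [|n IH] An; first exact: ult_all.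
have := ultI (An n (ltnSn n)) (IH (fun i Hi => An i (ltnW Hi))).
by apply: ultS => t [Ant IHt] i; rewrite ltnS leq_eqVlt => /orP[/eqP -> //|/IHt].
Qed.

Lemma ult_all_in (T : eqType) (s : seq T) (A : T -> set nat) :
  (forall x, x \in s -> ult (A x)) -> ult [set t | forall x, x \in s -> A x t].
Proof.
elim: s => [|a s IH] As; first exact: ult_all.
have H1 := As a (mem_head _ _).
have H2 : ult [set t | forall x, x \in s -> A x t].
  by apply: IH => x xs; apply: As; rewrite inE xs orbT.
have := ultI H1 H2; apply: ultS => t [At IHt] x.
by rewrite inE => /orP[/eqP -> //|/IHt].
Qed.

(* Countable saturation of ultrapowers comes from this diagonal argument. *)
Lemma ult_diagonal (X : nat -> set nat) : (forall i, ult (X i)) ->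
  exists N : nat -> nat, (forall i, ult [set t | (i < N t)%N]) /\
    forall t i, (i < N t)%N -> X i t.
Proof.
move=> uX; pose p t n := `[< (n <= t)%N /\ forall i, (i < n)%N -> X i t >].
have p0 t : exists n, p t n by exists 0%N; apply/asboolP.
have pb t n : p t n -> (n <= t)%N by move=> /asboolP[].
pose N t := ex_maxn (p0 t) (pb t).
have Np t : p t (N t) /\ forall n, p t n -> (n <= N t)%N by rewrite /N; case: ex_maxnP.
exists N; split=> [i|t i]; last by have [/asboolP[_ +] _] := Np t; apply.
have uXi : ult [set t | forall j, (j < i.+1)%N -> X j t] by apply: ult_bigI.
apply: ultS (ultI (ult_ge i.+1) uXi) => t [it Xt].
by have [_] := Np t; apply; apply/asboolP.
Qed.

End UltrafilterOnNat.

Section Ultrapower.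
Variable T : Type.

Definition uclass (f : nat -> T) : set (nat -> T) := [set g | ult [set n | f n = g n]].
(** Elements are the equivalence classes themselves, as sets of sequences, so that equality in the
    ultrapower is plain equality. *)
Record upow := UPow { upow_set : set (nat -> T); _ : exists f, upow_set = uclass f }.

HB.instance Definition _ := gen_eqMixin upow.
HB.instance Definition _ := gen_choiceMixin upow.

Definition upi (f : nat -> T) : upow := UPow (ex_intro _ f erefl).

Lemma upi_surj x : exists f, x = upi f.
Proof. by case: x => A [f E]; exists f; subst A. Qed.

Lemma upiE f g : upi f = upi g <-> ult [set n | f n = g n].
Proof.
split=> [[E]|fg].
  have : uclass g g by apply: ult_all.
  by rewrite -E.
suff E : uclass f = uclass g.
  rewrite /upi; move: (ex_intro _ _ _) (ex_intro _ _ _); rewrite E => e1 e2.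
  by congr UPow; apply: Prop_irrelevance.
apply/seteqP; split=> h /= H; have := ultI fg H; apply: ultS => n [/= -> //].
Qed.

Definition urep (x : upow) : nat -> T := projT1 (cid (upi_surj x)).

Lemma urepK x : upi (urep x) = x.
Proof. by rewrite /urep; case: cid. Qed.

Lemma urep_upi f : ult [set n | urep (upi f) n = f n].
Proof. by apply/upiE; rewrite urepK. Qed.

End Ultrapower.

Section UltrapowerMaps.

Definition umap (T T' : Type) (h : T -> T') (x : upow T) : upow T' :=
  upi (h \o urep x).

Definition umap2 (T1 T2 T' : Type) (h : T1 -> T2 -> T') x y : upow T' :=
  upi (fun n => h (urep x n) (urep y n)).

Lemma umapE T T' (h : T -> T') f : umap h (upi f) = upi (fun n => h (f n)).
Proof. by apply/upiE; apply: ultS (urep_upi f) => n /= ->. Qed.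

Lemma umap2E T1 T2 T' (h : T1 -> T2 -> T') f g :
  umap2 h (upi f) (upi g) = upi (fun n => h (f n) (g n)).
Proof.
by apply/upiE; apply: ultS (ultI (urep_upi f) (urep_upi g)) => n /= [-> ->].
Qed.

End UltrapowerMaps.

Section UltrapowerZmodule.
Variable V : zmodType.
Implicit Types x y z : upow V.

Let uadd := umap2 (fun a b : V => a + b).
Let uopp := umap (fun a : V => - a).
Let uzero : upow V := upi (fun=> 0).

Lemma uaddA : associative uadd.
Proof.
move=> x y z; have [f ->] := upi_surj x; have [g ->] := upi_surj y; have [h ->] := upi_surj z.
by rewrite /uadd !umap2E; congr upi; apply/funext => n; rewrite addrA.
Qed.
Lemma uaddC : commutative uadd.
Proof.
move=> x y; have [f ->] := upi_surj x; have [g ->] := upi_surj y.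
by rewrite /uadd !umap2E; congr upi; apply/funext => n; rewrite addrC.
Qed.
Lemma uadd0 : left_id uzero uadd.
Proof.
move=> x; have [f ->] := upi_surj x.
by rewrite /uadd !umap2E; congr upi; apply/funext => n; rewrite add0r.
Qed.
Lemma uaddN : left_inverse uzero uopp uadd.
Proof.
move=> x; have [f ->] := upi_surj x.
by rewrite /uadd /uopp umapE !umap2E; congr upi; apply/funext => n; rewrite addNr.
Qed.

HB.instance Definition _ := GRing.isZmodule.Build (upow V) uaddA uaddC uadd0 uaddN.

Lemma upiD (f g : nat -> V) : upi f + upi g = upi (fun n => f n + g n).
Proof. exact: umap2E. Qed.
Lemma upiN (f : nat -> V) : - upi f = upi (fun n => - f n).
Proof. exact: umapE. Qed.
Lemma upi0 : 0 = upi (fun=> 0 : V). Proof. by []. Qed.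

Lemma upi_eq0 (f : nat -> V) : upi f = 0 <-> ult [set n | f n = 0].
Proof. exact: upiE. Qed.

Lemma upi_neq0 (f : nat -> V) : upi f != 0 <-> ult [set n | f n != 0].
Proof.
split=> [/eqP n0|u0].
  have /ult_not : ~ ult [set n | f n = 0] by move=> /upi_eq0.
  by apply: ultS => n /= /eqP.
apply/eqP => /upi_eq0; apply/ult_not; apply: ultS u0 => n /= /eqP; exact.
Qed.

End UltrapowerZmodule.

Section UltrapowerField.
Variable F : fieldType.

Let umul := umap2 (fun a b : F => a * b).
Let uone : upow F := upi (fun=> 1).
Let uinv := umap (fun a : F => a^-1).

Lemma umulA : associative umul.
Proof.
move=> x y z; have [f ->] := upi_surj x; have [g ->] := upi_surj y; have [h ->] := upi_surj z.
by rewrite /umul !umap2E; congr upi; apply/funext => n; rewrite mulrA.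
Qed.
Lemma umulC : commutative umul.
Proof.
move=> x y; have [f ->] := upi_surj x; have [g ->] := upi_surj y.
by rewrite /umul !umap2E; congr upi; apply/funext => n; rewrite mulrC.
Qed.
Lemma umul1 : left_id uone umul.
Proof.
move=> x; have [f ->] := upi_surj x.
by rewrite /umul !umap2E; congr upi; apply/funext => n; rewrite mul1r.
Qed.
Lemma umulDl : left_distributive umul +%R.
Proof.
move=> x y z; have [f ->] := upi_surj x; have [g ->] := upi_surj y; have [h ->] := upi_surj z.
by rewrite upiD /umul !umap2E upiD; congr upi; apply/funext => n; rewrite mulrDl.
Qed.
Lemma uone_neq0 : uone != 0.
Proof. by apply/upi_neq0/ult_all => n /=; exact: oner_neq0. Qed.

HB.instance Definition _ := GRing.Zmodule_isComNzRing.Build (upow F)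
  umulA umulC umul1 umulDl uone_neq0.

Lemma umulV x : x != 0 -> uinv x * x = 1.
Proof.
have [f ->] := upi_surj x => /upi_neq0 f0; rewrite /uinv umapE -[LHS]/(umul _ _) /umul umap2E.
by apply/upiE; apply: ultS f0 => n /= f0; rewrite mulVf.
Qed.
Lemma uinv0 : uinv 0 = 0.
Proof. by rewrite /uinv umapE; congr upi; apply/funext => n; rewrite invr0. Qed.

HB.instance Definition _ := GRing.ComNzRing_isField.Build (upow F) umulV uinv0.

Lemma upiM (f g : nat -> F) : upi f * upi g = upi (fun n => f n * g n).
Proof. exact: umap2E. Qed.
Lemma upi1 : 1 = upi (fun=> 1 : F). Proof. by []. Qed.

Lemma upi_nat n : n%:R = upi (fun=> n%:R : F).
Proof.
elim: n => [|n IH]; rewrite ?mulr0n // mulrS IH upi1 upiD.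
by congr upi; apply/funext => t; rewrite -mulrS.
Qed.

Lemma upi_sum I (r : seq I) (f : I -> nat -> F) :
  \sum_(i <- r) upi (f i) = upi (fun n => \sum_(i <- r) f i n).
Proof.
elim: r => [|i r IH]; first by rewrite big_nil upi0; congr upi; apply/funext => n; rewrite big_nil.
by rewrite big_cons IH upiD; congr upi; apply/funext => n; rewrite big_cons.
Qed.

Lemma upiX (f : nat -> F) e : upi f ^+ e = upi (fun n => f n ^+ e).
Proof.
elim: e => [|e IH]; first by rewrite expr0 upi1.
by rewrite exprS IH upiM; congr upi; apply/funext => n; rewrite exprS.
Qed.

Lemma upi_prod I (r : seq I) (f : I -> nat -> F) :
  \prod_(i <- r) upi (f i) = upi (fun n => \prod_(i <- r) f i n).
Proof.
elim: r => [|i r IH]; first by rewrite big_nil upi1; congr upi; apply/funext => n; rewrite big_nil.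
by rewrite big_cons IH upiM; congr upi; apply/funext => n; rewrite big_cons.
Qed.

End UltrapowerField.

Section UltrapowerOrderedGroup.
Variable G : oagType.
Implicit Types x y z : upow G.

Definition ule x y : bool := `[< ult [set n | urep x n <= urep y n] >].

Lemma uleE (f g : nat -> G) : ule (upi f) (upi g) <-> ult [set n | f n <= g n].
Proof.
have H := ultI (urep_upi f) (urep_upi g); rewrite /ule; split.
  by move=> /asboolP fg; apply: ultS (ultI H fg) => n /= [[-> ->]].
by move=> fg; apply/asboolP; apply: ultS (ultI H fg) => n /= [[-> ->]].
Qed.

Lemma ule_refl : reflexive ule.
Proof. by move=> x; have [f ->] := upi_surj x; apply/uleE/ult_all => n /=. Qed.
Lemma ule_anti : antisymmetric ule.
Proof.
move=> x y; have [f ->] := upi_surj x; have [g ->] := upi_surj y => /andP[/uleE fg /uleE gf].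
by apply/upiE; apply: ultS (ultI fg gf) => n /= [h1 h2]; apply/le_anti/andP.
Qed.
Lemma ule_trans : transitive ule.
Proof.
move=> y x z; have [f ->] := upi_surj x; have [g ->] := upi_surj y; have [h ->] := upi_surj z.
by move=> /uleE fg /uleE gh; apply/uleE; apply: ultS (ultI fg gh) => n /= [h1]; apply: le_trans.
Qed.

HB.instance Definition _ := Order.Le_isPOrder.Build ring_display (upow G)
  ule_refl ule_anti ule_trans.

Lemma upi_le (f g : nat -> G) : upi f <= upi g <-> ult [set n | f n <= g n].
Proof. exact: uleE. Qed.

Lemma ule_leD2r z x y : x <= y -> x + z <= y + z.
Proof.
have [f ->] := upi_surj x; have [g ->] := upi_surj y; have [h ->] := upi_surj z.
by move=> /upi_le fg; rewrite !upiD; apply/upi_le; apply: ultS fg => n /=; rewrite oag_leD2r.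
Qed.

Lemma ule_total x y : (x <= y) || (y <= x).
Proof.
have [f ->] := upi_surj x; have [g ->] := upi_surj y.
have [fg|/ult_not fg] := pselect (ult [set n | f n <= g n]).
  by apply/orP; left; apply/upi_le.
apply/orP; right; apply/upi_le; apply: ultS fg => n /= /negP.
by case/orP: (oag_le_total (f n) (g n)) => ->.
Qed.

HB.instance Definition _ := isOrderedAbelianGroup.Build (upow G) ule_leD2r ule_total.

End UltrapowerOrderedGroup.

Section UltrapowerDifferentialField.
Variable D : diffField.

Definition uder : upow D -> upow D := umap (@der D).

Lemma upi_der (f : nat -> D) : uder (upi f) = upi (fun n => der (f n)).
Proof. exact: umapE. Qed.

Lemma uderP : is_derivation uder.
Proof.
split=> x y; have [f ->] := upi_surj x; have [g ->] := upi_surj y.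
  by rewrite upiD !upi_der upiD; congr upi; apply/funext => n; rewrite (is_derD (derP D)).
by rewrite upiM !upi_der !upiM upiD; congr upi; apply/funext => n; rewrite (is_derM (derP D)).
Qed.

Lemma upow_pchar0 : [pchar upow D] =i pred0.
Proof.
move=> p; have := df_pchar0 D p; rewrite !inE upi_nat => pD; apply/negP => /andP[pp /eqP/upi_eq0 p0].
suff : ult set0 by move=> /ult0.
by apply: ultS p0 => n /= /eqP p0; rewrite pp p0 in pD.
Qed.

Definition upow_df : diffField := DiffField uderP upow_pchar0.

End UltrapowerDifferentialField.

Section UltrapowerValuation.
Variables (F : fieldType) (v : valuation F).

Definition uval : upow F -> upow (vgroup v) := umap v.

Lemma upi_val (f : nat -> F) : uval (upi f) = upi (fun n => v (f n)).
Proof. exact: umapE. Qed.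

Lemma uvalM x y : x != 0 -> y != 0 -> uval (x * y) = uval x + uval y.
Proof.
have [f ->] := upi_surj x; have [g ->] := upi_surj y => /upi_neq0 f0 /upi_neq0 g0.
rewrite upiM !upi_val upiD; apply/upiE; apply: ultS (ultI f0 g0) => n /= [? ?].
exact: Defs.valM.
Qed.

Lemma uvalD x y : x != 0 -> y != 0 -> x + y != 0 ->
  Num.min (uval x) (uval y) <= uval (x + y).
Proof.
have [f ->] := upi_surj x; have [g ->] := upi_surj y => /upi_neq0 f0 /upi_neq0 g0.
rewrite upiD => /upi_neq0 fg0.
have key : ult [set n | Num.min (v (f n)) (v (g n)) <= v (f n + g n)].
  by apply: ultS (ultI (ultI f0 g0) fg0) => n /= [[? ?] ?]; apply: Defs.valD.
have [fg|gf] := orP (oag_le_total (uval (upi f)) (uval (upi g))).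
  rewrite min_l //; move: fg; rewrite !upi_val => /upi_le fg; apply/upi_le.
  by apply: ultS (ultI key fg) => n /= [+ fg']; rewrite min_l.
rewrite min_r //; move: gf; rewrite !upi_val => /upi_le gf; apply/upi_le.
by apply: ultS (ultI key gf) => n /= [+ gf']; rewrite min_r.
Qed.

Lemma uval_surj g : exists2 x, x != 0 & uval x = g.
Proof.
have [f ->] := upi_surj g.
have /choice[h hP] : forall n, exists x, x != 0 /\ v x = f n.
  by move=> n; have [x x0 vx] := val_surj (f n); exists x.
exists (upi h); first by apply/upi_neq0/ult_all => n /=; case: (hP n).
by rewrite upi_val; congr upi; apply/funext => n; case: (hP n).
Qed.

Definition upow_val : valuation (upow F) := Valuation uvalM uvalD uval_surj.

Lemma upi_val_le (f g : nat -> F) :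
  val_le upow_val (upi f) (upi g) <-> ult [set n | val_le v (f n) (g n)].
Proof.
rewrite /val_le; have [/upi_eq0 g0|g0] := eqVneq (upi g) 0.
  by split=> // _; apply: ultS g0 => n /= ->; rewrite eqxx.
have /upi_neq0 g0' := g0.
have [/upi_eq0 f0|f0] /= := eqVneq (upi f) 0.
  split=> // H; suff : ult set0 by move=> /ult0.
  by apply: ultS (ultI (ultI H f0) g0') => n /= [[h1 h2] h3]; move: h1; rewrite h2 (negbTE h3) eqxx.
have /upi_neq0 f0' := f0.
rewrite -[(_ <= _)]/(uval _ <= uval _) !upi_val; split=> [/upi_le H|H].
  by apply: ultS (ultI f0' H) => n /= [-> ->]; rewrite orbT.
apply/upi_le; apply: ultS (ultI g0' H) => n /= [gn]; rewrite (negbTE gn) /=.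
by case/andP.
Qed.

Lemma valringE x : (x \in valring_pred v) = val_le v 1 x.
Proof. by rewrite val_le_div ?oner_neq0 // divr1. Qed.

Lemma maxidealE x : (x \in maxideal_pred v) = ~~ val_le v x 1.
Proof. by rewrite val_lt_div ?oner_neq0 // divr1. Qed.

End UltrapowerValuation.

Section UltrapowerValuedDifferentialField.
Variable F : valuedDiffField.
Local Notation v := (vdf_val F).
Local Notation uv := (upow_val v).

Lemma upi_valring (f : nat -> F) :
  upi f \in valring_pred uv <-> ult [set n | f n \in valring_pred v].
Proof.
rewrite valringE upi1; split=> [/upi_val_le|H]; first by apply: ultS => n /=; rewrite valringE.
by apply/upi_val_le; apply: ultS H => n /=; rewrite valringE.
Qed.

Lemma upi_maxideal (f : nat -> F) :
  upi f \in maxideal_pred uv <-> ult [set n | f n \in maxideal_pred v].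
Proof.
rewrite maxidealE upi1; split=> [/negP H|H].
  have /ult_not : ~ ult [set n | val_le v (f n) 1] by move=> /upi_val_le.
  by apply: ultS => n /= /negP; rewrite maxidealE.
apply/negP => /upi_val_le; apply/ult_not; apply: ultS H => n /=.
by rewrite maxidealE => /negP.
Qed.

Lemma upow_res_pchar0 : [pchar (residue uv)] =i pred0.
Proof.
move=> p; rewrite !inE; apply/negP => /andP[p_pr].
have -> : (p%:R : residue uv) = reduction (p%:R : valring uv).
  by rewrite /reduction rmorph_nat.
rewrite /reduction -(rmorph0 (\pi_({ideal_quot (maxideal (v := uv))})%qT)).
rewrite -Quotient.idealrBE subr0 -[_ \in _]/(val (p%:R : valring uv) \in _) rmorph_nat upi_nat.
move=> /upi_maxideal H; suff : ult set0 by move=> /ult0.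
by apply: ultS H => n /=; case: p p_pr => // p _; case: (nat_vunit F p) => _ /negbTE ->.
Qed.

Definition upow_vdf : valuedDiffField := @ValuedDiffField (upow_df F) uv upow_res_pchar0.

Lemma upi_iter (f : nat -> F) i : iter i (@der upow_vdf) (upi f) = upi (fun n => iter i der (f n)).
Proof. by elim: i => //= i ->; apply: upi_der. Qed.

Lemma upow_teval n (e : 'I_n -> nat -> F) t :
  teval (F := upow_vdf) (fun i => upi (e i)) t = upi (fun s => teval (fun i => e i s) t).
Proof.
elim: t => //= [t1 -> t2 ->|t1 ->|t1 -> t2 ->|t1 ->].
- exact: upiD.
- exact: upiN.
- exact: upiM.
- exact: upi_der.
Qed.

(** The theorem of Łoś. In the existential case witnesses are chosen at all coordinates that have
    one, with 0 as default elsewhere. *)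
Lemma upow_holds n (p : formula n) : forall e : 'I_n -> nat -> F,
  holds (F := upow_vdf) p (fun i => upi (e i)) <-> ult [set s | holds p (fun i => e i s)].
Proof.
elim: p => {n} [n t1 t2|n t|n q IH|n q IHq r IHr|n q IH] e /=.
- by rewrite !upow_teval upiE.
- by rewrite upow_teval; exact: upi_valring.
- by rewrite IH; apply: ult_not.
- rewrite IHq IHr; split=> [[]|H]; first exact: ultI.
  by split; apply: ultS H => s /= [].
split=> [[x]|H].
  have [f ->] := upi_surj x.
  pose e' (i : 'I_n.+1) : nat -> F := if unlift ord0 i is Some j then e j else f.
  have -> : env_cons (F := upow_vdf) (upi f) (fun i => upi (e i)) = fun i => upi (e' i).
    by apply/funext => i; rewrite /env_cons /e'; case: unlift.
  move=> /IH; apply: ultS => s /= H; exists (f s); congr (holds q _): H.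
  by apply/funext => i; rewrite /env_cons /e'; case: unlift.
have /choice[f fP] : forall s, exists x, (exists x, holds q (env_cons x (fun i => e i s))) ->
    holds q (env_cons x (fun i => e i s)).
  move=> s; have [[x Hx]|nx] := pselect (exists x, holds q (env_cons x (fun i => e i s))).
    by exists x.
  by exists 0.
exists (upi f); pose e' (i : 'I_n.+1) : nat -> F := if unlift ord0 i is Some j then e j else f.
have -> : env_cons (F := upow_vdf) (upi f) (fun i => upi (e i)) = fun i => upi (e' i).
  by apply/funext => i; rewrite /env_cons /e'; case: unlift.
apply/IH; apply: ultS H => s /= /fP Hf; congr (holds q _): Hf.
by apply/funext => i; rewrite /env_cons /e'; case: unlift.
Qed.

Theorem upow_equivalent : elementarily_equivalent F upow_vdf.
Proof.
move=> p; have := upow_holds p (fun=> fun=> 0); rewrite /models => H; split=> [Fp|].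
  have -> : (fun=> 0 : upow_vdf) = (fun i : 'I_0 => upi (fun=> 0)) by apply/funext => -[].
  by apply/H/ult_all => s /=; congr (holds p _): Fp; apply/funext => -[].
have -> : (fun=> 0 : upow_vdf) = (fun i : 'I_0 => upi (fun=> 0)) by apply/funext => -[].
move=> /H Hs; apply: contrapT => nFp.
suff : ult set0 by move=> /ult0.
by apply: ultS Hs => s /= Hp; apply: nFp; congr (holds p _): Hp; apply/funext => -[].
Qed.

Lemma upow_monotone : monotone F -> monotone upow_vdf.
Proof.
move=> mon x; have [f ->] := upi_surj x; rewrite -[@der upow_vdf _]/(uder (upi f)) upi_der.
by apply/upi_val_le/ult_all => n /=; apply: mon.
Qed.

(** At coordinate n only the first [N n] balls are considered. They meet pairwise there, so the
    centre of the smallest lies in all of them, and each fixed ball is considered at almost all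
    coordinates. *)
Lemma upow_countably_complete : countably_complete upow_vdf.
Proof.
move=> C Cc compat.
have [[p0 Cp0]|C0] := pselect (C !=set0); last first.
  by exists 0 => p Cp; case: C0; exists p.
have /countable_injP[h hinj] := Cc.
have [p_ pC] : exists p_ : nat -> upow F * upow F,
    (forall i, C (p_ i)) /\ forall p, C p -> exists i, p = p_ i.
  exists (fun i => xget p0 [set p | C p /\ h p = i]); split=> [i|p Cp].
    by case: xgetP => [p _ []|].
  exists (h p); case: xgetP => [q _ [Cq E]|/(_ p) []//].
  by apply: hinj; rewrite ?inE.
case: pC => pC pall.
pose b i := urep (p_ i).1; pose g i := urep (p_ i).2.
have pE i : p_ i = (upi (b i), upi (g i)) by rewrite !urepK -surjective_pairing.
pose ok i j n := val_le v (g i n) (b i n - b j n) || val_le v (g j n) (b i n - b j n).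
have uok i j : ult [set n | ok i j n].
  have := compat _ _ (pC i) (pC j); rewrite !pE /= upiN upiD => /orP[]/upi_val_le;
    by apply: ultS => n /= H; rewrite /ok H ?orbT.
have [|N [Nlarge Nok]] := @ult_diagonal (fun m =>
    [set n | forall i, (i < m.+1)%N -> forall j, (j < m.+1)%N -> ok i j n]).
  by move=> m; apply: ult_bigI => i _; apply: ult_bigI => j _; apply: uok.
have /choice[y yP] : forall n, exists y, forall j, (j < N n)%N -> val_le v (g j n) (y - b j n).
  move=> n; case E : (N n) => [|m]; first by exists 0.
  pose i := extremum (fun a b : F => val_le v b a) (ord0 : 'I_m.+1) xpredT (fun i : 'I_m.+1 => g i n).
  have imax (j : 'I_m.+1) : val_le v (g j n) (g i n).
    rewrite /i; case: extremumP => [a|a a' a'' h1 h2|a a'||l _ H] //.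
    - exact: val_le_refl.
    - exact: val_le_trans h2 h1.
    - by rewrite orbC; apply: val_le_total.
    - exact: (H j isT).
  exists (b i n) => j jm; have gj := imax (Ordinal jm).
  have mN : (m < N n)%N by rewrite E.
  have /orP[H|//] := Nok n m mN i (ltn_ord i) j jm.
  exact: val_le_trans gj H.
exists (upi y) => p /pall[i ->]; rewrite pE /= upiN upiD; apply/upi_val_le.
by apply: ultS (Nlarge i) => n /= iN; apply: yP.
Qed.

(** Having finite support, [W] is represented by polynomials [Wt] over [F] with support contained in
    it. They satisfy the hypotheses at almost all coordinates, and zeros chosen there represent a
    zero of [W]. *)
Lemma upow_zeros : zeros_of_linear_residue F -> zeros_of_linear_residue upow_vdf.
Proof.
move=> zF n W iW mW [l lW].
pose w k := urep W@_k.
pose Wt t : {mpoly F[n]} := \sum_(k <- msupp W) w k t *: 'X_[k].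
have Wtk t k : (Wt t)@_k = if k \in msupp W then w k t else 0.
  rewrite (raddf_sum (mcoeff k)) /=.
  under eq_bigr do rewrite mcoeffZ mcoeffX.
  case: ifP => [kW|kW]; last first.
    by rewrite big_seq big1 // => j jW; case: eqP => [E|]; rewrite ?mulr0 //; rewrite E kW in jW.
  rewrite (bigD1_seq k) //= ?msupp_uniq // eqxx mulr1 big1 ?addr0 // => j jk.
  by rewrite (negbTE jk) mulr0.
have u1 : ult [set t | integral v (Wt t)].
  have : ult [set t | forall k, k \in msupp W -> w k t \in valring_pred v].
    by apply: ult_all_in => k _; apply/upi_valring; rewrite urepK; apply: iW.
  by apply: ultS => t H k; rewrite Wtk; case: ifP => [/H//|_]; apply: rpred0.
have u2 : ult [set t | forall k, (1 < mdeg k)%N -> (Wt t)@_k \in maxideal_pred v].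
  have : ult [set t | forall k, k \in msupp W -> (1 < mdeg k)%N -> w k t \in maxideal_pred v].
    apply: ult_all_in => k _; have [k2|k2] := boolP (1 < mdeg k)%N; last exact: ult_all.
    have : ult [set t | w k t \in maxideal_pred v] by apply/upi_maxideal; rewrite urepK; apply: mW.
    by apply: ultS => t.
  by apply: ultS => t H k k2; rewrite Wtk; case: ifP => [kW|_]; [apply: H | rewrite maxideal0].
have u3 : ult [set t | (Wt t)@_U_(l) \notin maxideal_pred v].
  have lS : U_(l)%MM \in msupp W.
    by rewrite mcoeff_msupp; apply: contraNneq lW => ->; rewrite maxideal0.
  have /ult_not : ~ ult [set t | w U_(l)%MM t \in maxideal_pred v].
    by move=> /upi_maxideal; rewrite urepK; apply/negP.
  by apply: ultS => t /= /negP; rewrite Wtk lS.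
have /choice[z zP] : forall t, exists z, integral v (Wt t) ->
    (forall k, (1 < mdeg k)%N -> (Wt t)@_k \in maxideal_pred v) ->
    (Wt t)@_U_(l) \notin maxideal_pred v -> z \in valring_pred v /\ (Wt t).@[jet der z] = 0.
  move=> t; have [[h1 [h2 h3]]|nh] := pselect (integral v (Wt t) /\
    (forall k, (1 < mdeg k)%N -> (Wt t)@_k \in maxideal_pred v) /\ (Wt t)@_U_(l) \notin maxideal_pred v).
    by have [z Oz Ez] := zF _ _ h1 h2 (ex_intro _ l h3); exists z.
  by exists 0 => h1 h2 h3; case: nh.
have uz : ult [set t | z t \in valring_pred v /\ (Wt t).@[jet der (z t)] = 0].
  by apply: ultS (ultI (ultI u1 u2) u3) => t [[h1 h2] h3]; apply: zP.
exists (upi z); first by apply/upi_valring; apply: ultS uz => t [].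
have -> : W.@[jet der (upi z : upow_vdf)] = upi (fun t => (Wt t).@[jet der (z t)]).
  rewrite mevalE.
  have -> : (fun t => (Wt t).@[jet der (z t)]) =
      fun t => \sum_(k <- msupp W) w k t * \prod_i jet der (z t) i ^+ k i.
    apply/funext => t; rewrite (raddf_sum (meval _)) /=; apply: eq_bigr => k _.
    by rewrite mevalZ mevalX.
  rewrite -upi_sum; apply: eq_bigr => k _.
  rewrite -[LHS]/(W@_k * _ : upow F) -{1}[W@_k]urepK.
  have -> : (\prod_(i < n) jet der (upi z : upow_vdf) i ^+ k i : upow F) =
      upi (fun t => \prod_(i < n) jet der (z t) i ^+ k i).
    rewrite -upi_prod; apply: eq_bigr => i _.
    by rewrite -upiX; congr (_ ^+ _); apply: upi_iter.
  exact: upiM.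
by apply/upi_eq0; apply: ultS uz => t [].
Qed.

End UltrapowerValuedDifferentialField.

(** * Cross-sections *)

Section UltrapowerAdditive.
Variables (V W : zmodType) (p : {additive V -> W}).

Lemma umap_zmod_morphism : zmod_morphism (umap p).
Proof.
move=> x y; have [f ->] := upi_surj x; have [g ->] := upi_surj y.
rewrite upiN upiD (umapE p) [X in _ = X - _](umapE p) [X in _ = _ - X](umapE p) upiN upiD; congr upi.
by apply/funext => n; rewrite raddfB.
Qed.

HB.instance Definition _ := GRing.isZmodMorphism.Build (upow V) (upow W) (umap p) umap_zmod_morphism.

Lemma upiMn (f : nat -> V) n : upi f *+ n = upi (fun t => f t *+ n).
Proof.
elim: n => [|n IH]; first by rewrite mulr0n upi0.
by rewrite mulrS IH upiD; congr upi; apply/funext => t; rewrite mulrS.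
Qed.

Lemma upiMz (f : nat -> V) z : upi f *~ z = upi (fun t => f t *~ z).
Proof. by case: z => n; rewrite ?NegzE ?mulrNz -?pmulrn upiMn ?upiN. Qed.

End UltrapowerAdditive.

Definition torsion_free (W : zmodType) := forall (w : W) n, w *+ n.+1 = 0 -> w = 0.

Lemma oag_torsion_free (G : oagType) : torsion_free G.
Proof.
have pos (g : G) n : 0 < g -> 0 < g *+ n.+1.
  move=> g0; elim: n => [|n IH]; first by rewrite mulr1n.
  by rewrite mulrS -[0]addr0; apply: oag_ltleD => //; apply: ltW.
move=> g n E; apply/eqP; apply: contraT; rewrite oag_neq_lt => /orP[g0|g0].
  have : 0 < (- g) *+ n.+1 by apply: pos; rewrite -(oag_ltD2r g) add0r addNr.
  by rewrite mulNrn E oppr0 ltxx.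
by have := pos _ n g0; rewrite E ltxx.
Qed.

Section Splitting.
Variables (V W : zmodType) (p : {additive V -> W}).
Hypothesis p_surj : forall w, exists x, p x = w.
Local Notation P := (umap p).

(* The system is solved coordinatewise up to a level that grows along the
   ultrafilter, descending from that level. *)
Lemma upow_solve (w : nat -> upow W) (s : nat -> upow V) (j : nat -> int) :
  (forall N, w N = w N.+1 *~ j N + P (s N)) ->
  exists y : nat -> upow V, forall N, P (y N) = w N /\ y N = y N.+1 *~ j N + s N.
Proof.
move=> ws; have [r rK] := choice p_surj.
pose a N := urep (w N); pose b N := urep (s N).
have [|f [fN fX]] := ult_diagonal (X := fun N => [set t | a N t = a N.+1 t *~ j N + p (b N t)]).
  move=> N; apply/upiE; rewrite -upiD -upiMz !urepK {1}ws; congr (_ + _).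
pose fix go t d N {struct d} := if d is d'.+1 then go t d' N.+1 *~ j N + b N t else r (a N t).
pose y N t := go t (f t - N)%N N.
have yS N t : (N < f t)%N -> y N t = y N.+1 t *~ j N + b N t.
  by move=> Nf; rewrite /y -(subnSK Nf).
have goP t d N : (N + d = f t)%N -> p (go t d N) = a N t.
  elim: d N => [|d IH] N E //=; rewrite raddfD raddfMz /= IH ?addSnnS //.
  by rewrite (fX t N) // -E addnS ltnS leq_addr.
exists (fun N => upi (y N)) => N; split.
  rewrite umapE -[RHS]urepK; apply/upiE; apply: ultS (fN N) => t /= Nt.
  by apply: goP; rewrite subnKC // ltnW.
rewrite -[s N]urepK upiMz upiD; apply/upiE; apply: ultS (fN N) => t /=; exact: yS.
Qed.

(* S is the image of a section of umap p over a pure subgroup of upow W. *)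
Definition pure_section (S : set (upow V)) :=
  [/\ S 0, forall x y, S x -> S y -> S (x - y), forall x, S x -> P x = 0 -> x = 0 &
   forall x z n, S x -> P x = z *+ n.+1 -> exists2 y, S y & P y = z].

Lemma pure_sectionN S x : pure_section S -> S x -> S (- x).
Proof. by move=> [S0 SB _ _] Sx; rewrite -[- x]add0r; apply: SB. Qed.

Lemma pure_sectionD S x y : pure_section S -> S x -> S y -> S (x + y).
Proof.
move=> PS Sx Sy; rewrite -[y]opprK; case: (PS) => _ SB _ _; apply: SB => //.
exact: pure_sectionN.
Qed.

Lemma pure_sectionMz S x z : pure_section S -> S x -> S (x *~ z).
Proof.
move=> PS Sx; have Mn n : S (x *+ n).
  elim: n => [|n IH]; first by rewrite mulr0n; case: PS.
  by rewrite mulrS; apply: pure_sectionD.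
by case: z => n; rewrite ?NegzE ?mulrNz; [|apply: pure_sectionN PS _]; apply: Mn.
Qed.

(** Let D be the image of [S]. The pure hull of D + Zw has rank one over D: it is the union of the
    groups D + Z u_N, where N! u_N is congruent to m_N w modulo D with m_N > 0 least. Modulo D each
    u_N is a multiple of u_(N+1), and [upow_solve] lifts all u_N compatibly with these relations. *)
Lemma pure_section_step S w : pure_section S -> (forall x, S x -> P x <> w) ->
  exists S', [/\ pure_section S', S `<=` S' & exists2 x, S' x & P x = w].
Proof.
move=> PS nw; have [S0 SB Sinj Spure] := PS.
have SD := fun x y => @pure_sectionD S x y PS; have SMz := fun x z => @pure_sectionMz S x z PS.
pose D z := exists2 x, S x & P x = z.
have D0 : D 0 by exists 0; rewrite ?raddf0.
have DB x y : D x -> D y -> D (x - y).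
  by move=> [x' Sx <-] [y' Sy <-]; exists (x' - y'); rewrite ?raddfB //; apply: SB.
have DMz x z : D x -> D (x *~ z).
  by move=> [x' Sx <-]; exists (x' *~ z); rewrite ?raddfMz //; apply: SMz.
have DD x y : D x -> D y -> D (x + y).
  by move=> [x' Sx <-] [y' Sy <-]; exists (x' + y'); rewrite ?raddfD //; apply: SD.
have Dpure z n : (0 < n)%N -> D (z *+ n) -> D z.
  by case: n => // n _ [x Sx E]; have [y Sy yz] := Spure _ _ _ Sx E; exists y.
have nDw : ~ D w by move=> [x Sx]; apply: nw.
(* [m] is good at level [N] when m w is divisible by N! modulo D. The integer N! itself is good, and
   division with remainder shows that the least positive one divides all others. *)
pose good N m := exists z, D (z *+ N`! - w *~ m%:Z).
have good_fact N : good N N`! by exists w; rewrite -pmulrn subrr.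
have [m mP] : exists m : nat -> nat, forall N, [/\ (0 < m N)%N, good N (m N) &
    forall z (l : int), D (z *+ N`! - w *~ l) -> (m N %| l)%Z].
  suff mN N : exists m, [/\ (0 < m)%N, good N m &
      forall z (l : int), D (z *+ N`! - w *~ l) -> (m %| l)%Z].
    by have [m mP] := choice mN; exists m.
  pose q n := (0 < n)%N && `[< good N n >].
  have q0 : exists n, q n by exists N`!; rewrite /q fact_gt0; apply/asboolP.
  have [m /andP[m0 /asboolP gm] mmin] := ex_minnP q0.
  exists m; split=> // z l Dzl; have [z0 Dz0] := gm.
  have m0' : (m%:Z) != 0 by rewrite eqz_nat -lt0n.
  apply/dvdz_mod0P/eqP; apply: contraT => r0.
  have rE : (l %% m)%Z = `|(l %% m)%Z|%N :> int by rewrite gez0_abs // modz_ge0.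
  have : q `|(l %% m)%Z|%N.
    rewrite /q absz_gt0 r0; apply/asboolP; exists (z - z0 *~ (l %/ m)%Z).
    rewrite -rE /modz mulrzBr mulrnBl.
    have -> : z *+ N`! - (z0 *~ (l %/ m)%Z) *+ N`! - (w *~ l - w *~ ((l %/ m)%Z * m)) =
        (z *+ N`! - w *~ l) - (z0 *+ N`! - w *~ m%:Z) *~ (l %/ m)%Z.
      rewrite mulrzBl !pmulrn -!mulrzA [m%:Z * _]mulrC [N`!%:Z * _]mulrC.
      by rewrite !opprD !opprK addrACA.
    by apply: DB => //; apply: DMz.
  by move=> /mmin; rewrite -lez_nat -rE leNgt ltz_pmod // ltz_nat.
have /choice[u uP] : forall N, exists z : upow W, D (z *+ N`! - w *~ (m N)%:Z).
  by move=> N; case: (mP N).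
(* Once n divides N!, an element with n-th multiple in D + Zw is a multiple of [u N] modulo D: this
   holds after multiplication by N!, and D is pure. *)
have cover z l n : (0 < n)%N -> D (z *+ n - w *~ l) -> forall N, (n %| N`!)%N ->
    exists j : int, D (z - u N *~ j).
  move=> n0 Dz N /dvdnP[d dE].
  have Dz' : D (z *+ N`! - w *~ (l * d%:Z)).
    by rewrite dE mulnC mulrnA mulrzA -[X in _ - X]pmulrn -mulrnBl pmulrn; apply: DMz.
  have [_ _ /(_ _ _ Dz')/dvdzP[j jE]] := mP N; exists j.
  apply: (Dpure _ N`!); first exact: fact_gt0.
  have -> : (z - u N *~ j) *+ N`! = (z *+ N`! - w *~ (l * d%:Z)) - (u N *+ N`! - w *~ (m N)%:Z) *~ j.
    rewrite mulrnBl mulrzBl -!mulrzA jE [j * _]mulrC opprB addrA subrK.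
    by rewrite !pmulrn -!mulrzA [_ * j]mulrC.
  by apply: DB => //; apply: DMz.
have /choice[j jP] : forall N, exists j : int, D (u N - u N.+1 *~ j).
  move=> N; apply: (cover _ _ _ (fact_gt0 N) (uP N)).
  by rewrite factS dvdn_mull.
have /choice[s sP] : forall N, exists x : upow V, S x /\ P x = u N - u N.+1 *~ j N.
  by move=> N; have [x Sx xE] := jP N; exists x.
have [|y yP] := @upow_solve u s j.
  by move=> N; have [_ ->] := sP N; rewrite addrC subrK.
pose S' x := exists N x' l, S x' /\ x = x' + y N *~ l.
have raise N N' x l : (N <= N')%N -> S x -> exists x' l', S x' /\ x + y N *~ l = x' + y N' *~ l'.
  move=> /subnKC <-; elim: (N' - N)%N => [|d IH] in x l * => Sx.
    by exists x, l; rewrite addn0.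
  have [x' [l' [Sx' ->]]] := IH x l Sx; have [_ ->] := yP (N + d)%N.
  exists (x' + s (N + d)%N *~ l'), (j (N + d)%N * l'); split.
    by apply: SD => //; apply: SMz; case: (sP (N + d)%N).
  by rewrite addnS mulrzDl mulrzA addrA addrAC.
have S'D N x l : S x -> S' (x + y N *~ l) by exists N, x, l.
(* If l u_N lies in D with l nonzero, then so does m_N l w, and purity puts [w] itself in D. This
   gives injectivity of the enlarged section. *)
have nDu N l : D (u N *~ l) -> l = 0.
  move=> Du; apply/eqP; apply: contraT => l0; case: nDw.
  have [mN0 _ _] := mP N.
  apply: (Dpure _ (m N * `|l|)%N); first by rewrite muln_gt0 mN0 absz_gt0.
  have : D (w *~ ((m N)%:Z * l)).
    have -> : w *~ ((m N)%:Z * l) = (u N *~ l) *~ N`!%:Z - (u N *+ N`! - w *~ (m N)%:Z) *~ l.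
      by rewrite mulrzBl pmulrn -!mulrzA opprB addrC [l * _]mulrC subrK.
    by apply: DB; apply: DMz.
  have [e [eE]] : exists e : int, w *+ (m N * `|l|) = (w *~ ((m N)%:Z * l)) *~ e /\ true.
    exists (Num.sg l); split=> //; rewrite -mulrzA -mulrA [l * _]mulrC -normrEsg.
    by rewrite pmulrn PoszM abszE.
  by rewrite eE => _; apply: DMz.
exists S'; split=> [|x Sx|]; last 2 first.
- by exists 0%N, x, 0; rewrite mulr0z addr0.
- have [l Dl] : exists l : int, D (w - u 0%N *~ l).
    by apply: (cover w 1 1%N); rewrite // mulr1z mulr1n subrr.
  have [x Sx xE] := Dl; exists (x + y 0%N *~ l); first exact: S'D.
  by rewrite raddfD raddfMz /= xE; have [-> _] := yP 0%N; rewrite subrK.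
split.
- by exists 0%N, 0, 0; rewrite mulr0z addr0.
- move=> _ _ [N [x [l [Sx ->]]]] [N' [x' [l' [Sx' ->]]]].
  have [z [k [Sz ->]]] := raise N (maxn N N') x l (leq_maxl _ _) Sx.
  have [z' [k' [Sz' ->]]] := raise N' (maxn N N') x' l' (leq_maxr _ _) Sx'.
  exists (maxn N N'), (z - z'), (k - k'); split; first exact: SB.
  by rewrite mulrzBr opprD addrACA.
- move=> _ [N [x [l [Sx ->]]]]; have [yE _] := yP N; rewrite raddfD raddfMz /= yE => E.
  have l0 : l = 0.
    apply: (nDu N); exists (- x); first exact: pure_sectionN PS Sx.
    by rewrite raddfN; apply/eqP; rewrite eqr_oppLR -addr_eq0 E.
  by move: E; rewrite l0 !mulr0z !addr0; apply: Sinj.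
move=> _ z n [N [x [l [Sx ->]]]]; have [yE _] := yP N; rewrite raddfD raddfMz /= yE => E.
have Dz : D (z *+ (n.+1 * N`!) - w *~ ((m N)%:Z * l)).
  have -> : z *+ (n.+1 * N`!) - w *~ ((m N)%:Z * l) =
      P x *~ N`!%:Z + (u N *+ N`! - w *~ (m N)%:Z) *~ l.
    by rewrite mulrnA -E mulrnDl mulrzBl -!mulrzA !pmulrn -!mulrzA [l * _]mulrC addrA.
  by apply: DD; apply: DMz => //; exists x.
have n0 : (0 < n.+1 * N`!)%N by rewrite muln_gt0 fact_gt0.
(* The level (n + 1) N! is chosen because every positive integer divides its own factorial. *)
have [|l' [x' Sx' xE]] := cover _ _ _ n0 Dz (n.+1 * N`!)%N.
  by apply: dvdn_fact; rewrite n0 leqnn.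
exists (x' + y (n.+1 * N`!)%N *~ l'); first exact: S'D.
by rewrite raddfD raddfMz /= xE; have [-> _] := yP (n.+1 * N`!)%N; rewrite subrK.
Qed.

Hypothesis tfW : torsion_free W.

Lemma upow_torsion_free : torsion_free (upow W).
Proof.
move=> w n; have [f ->] := upi_surj w; rewrite upiMn => /upi_eq0 fn; apply/upi_eq0.
by apply: ultS fn => t /=; apply: tfW.
Qed.

(** The zero subgroup is a pure section because [upow W] is torsion-free. A maximal pure section
    covers [upow W], and injectivity on it makes the choice of preimages additive. *)
Theorem upow_section : exists s : {additive upow W -> upow V}, forall w, P (s w) = w.
Proof.
have base : pure_section [set 0].
  split=> // [x y -> ->|x z n -> E]; first by rewrite /= subrr.
  by exists 0 => //; rewrite raddf0; apply/esym/(@upow_torsion_free z n); rewrite -E raddf0.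
have [|S [PS _] maxS] := @Zorn_above (upow V) pure_section [set 0] base.
  move=> F FP [X0 FX0] totF.
  have both x y : (\bigcup_(X in F) X) x -> (\bigcup_(X in F) X) y -> exists2 X, F X & X x /\ X y.
    move=> [X FX Xx] [Y FY Yy]; case: (totF _ _ FX FY) => XY; last by exists X => //; split=> //; apply: XY.
    by exists Y => //; split=> //; apply: XY.
  split.
  - by exists X0 => //; case: (FP _ FX0).
  - by move=> x y Ux Uy; have [X FX [Xx Xy]] := both x y Ux Uy;
      exists X => //; case: (FP _ FX) => _ + _ _; apply.
  - by move=> x [X FX Xx]; case: (FP _ FX) => _ _ + _; apply.
  move=> x z n [X FX Xx] E; case: (FP _ FX) => _ _ _ /(_ x z n Xx E)[y Xy yz].
  by exists y => //; exists X.
have surj w : exists x, S x /\ P x = w.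
  apply: contrapT => nw.
  have [|S' [PS' SS' [x S'x xw]]] := @pure_section_step S w PS.
    by move=> x Sx xw; apply: nw; exists x.
  by apply: nw; exists x; split=> //; apply: (maxS S').
have [s sP] := choice surj.
have sB : zmod_morphism s.
  move=> a b; have [Sab Pab] := sP (a - b); have [Sa Pa] := sP a; have [Sb Pb] := sP b.
  apply/eqP; rewrite -subr_eq0; apply/eqP; case: PS => _ SB Sinj _.
  by apply: Sinj; [apply: (SB) => //; apply: (SB) | rewrite !raddfB /= Pab Pa Pb -opprD subrr].
pose sm := GRing.isZmodMorphism.Build _ _ s sB.
by exists (HB.pack_for {additive upow W -> upow V} s sm) => w; case: (sP w).
Qed.

End Splitting.

(** * Elements with logarithmic derivative in the lifted residue field *)

Section LogarithmicGroup.
Variables (M : valuedDiffField) (mon : monotone M) (hens : henselian M).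
Local Notation v := (vdf_val M).
Local Notation O := (valring_pred v).
Local Notation m := (maxideal_pred v).
Variable K : gfield der (vunit v).
Hypothesis Klift : forall x, x \in O -> exists2 b, gf_set K b & x - b \in m.
Local Notation A := (gf_type K).

Lemma gf_pchar0 : [pchar A] =i pred0.
Proof. by move=> p; rewrite -(fmorph_pchar (val : {rmorphism A -> M})); apply: df_pchar0. Qed.

Definition lift_df : diffField := DiffField (is_der_gf (derP M) K) gf_pchar0.

Definition log_pred : {pred M} := fun x => (x != 0) && `[< gf_set K (der x / x) >].

(* This group of nonzero elements of M is written additively. *)
Record log_group := LogGroup { log_val : M; _ : log_val \in log_pred }.

HB.instance Definition _ := [isSub for log_val].
HB.instance Definition _ := [Choice of log_group by <:].

Lemma log_neq0 (x : log_group) : val x != 0.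
Proof. by have /andP[] := valP x. Qed.

Lemma log_gf (x : log_group) : der (val x) / val x \in gf_pred K.
Proof. by have /andP[] := valP x. Qed.

Definition log_der (x : log_group) : A := GfType (log_gf x).

Lemma log_mul_subproof (x y : log_group) : val x * val y \in log_pred.
Proof.
have x0 := log_neq0 x; have y0 := log_neq0 y.
apply/andP; split; first by rewrite mulf_neq0.
have -> : der (val x * val y) / (val x * val y) = val (log_der x + log_der y).
  rewrite rmorphD /= (is_derM (derP M)); field.
  by rewrite x0 y0.
by apply/asboolP/gf_valP.
Qed.

Lemma log_inv_subproof (x : log_group) : (val x)^-1 \in log_pred.
Proof.
have x0 := log_neq0 x; apply/andP; split; first by rewrite invr_eq0.
have -> : der (val x)^-1 / (val x)^-1 = val (- log_der x).
  rewrite rmorphN /= (is_derV (derP M)) ?unitfE //; field.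
  by rewrite x0 oner_neq0.
by apply/asboolP/gf_valP.
Qed.

Lemma log_one_subproof : 1 \in log_pred.
Proof.
apply/andP; split; first exact: oner_neq0.
apply/asboolP; rewrite (is_der1 (derP M)) mul0r.
exact: (gf_valP (0 : A)).
Qed.

Definition log_mul x y := LogGroup (log_mul_subproof x y).
Definition log_inv x := LogGroup (log_inv_subproof x).
Definition log_one := LogGroup log_one_subproof.

Lemma log_mulA : associative log_mul.
Proof. by move=> x y z; apply: val_inj; rewrite /= mulrA. Qed.
Lemma log_mulC : commutative log_mul.
Proof. by move=> x y; apply: val_inj; rewrite /= mulrC. Qed.
Lemma log_mul1 : left_id log_one log_mul.
Proof. by move=> x; apply: val_inj; rewrite /= mul1r. Qed.
Lemma log_mulV : left_inverse log_one log_inv log_mul.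
Proof. by move=> x; apply: val_inj; rewrite /= mulVf // log_neq0. Qed.

HB.instance Definition _ := GRing.isZmodule.Build log_group log_mulA log_mulC log_mul1 log_mulV.

Lemma log_valD (x y : log_group) : val (x + y) = val x * val y. Proof. by []. Qed.

Lemma log_der_zmod_morphism : zmod_morphism log_der.
Proof.
have D : {morph log_der : x y / x + y}.
  move=> x y; apply: val_inj; rewrite rmorphD /= (is_derM (derP M)).
  have x0 := log_neq0 x; have y0 := log_neq0 y; field.
  by rewrite x0 y0.
by move=> x y; apply/eqP; rewrite eq_sym subr_eq -D subrK.
Qed.

Definition log_value (x : log_group) : vgroup v := v (val x).

Lemma log_value_zmod_morphism : zmod_morphism log_value.
Proof.
have D : {morph log_value : x y / x + y}.
  by move=> x y; rewrite /log_value log_valD Defs.valM // log_neq0.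
by move=> x y; apply/eqP; rewrite eq_sym subr_eq -D subrK.
Qed.

HB.instance Definition _ := GRing.isZmodMorphism.Build log_group A log_der log_der_zmod_morphism.
HB.instance Definition _ :=
  GRing.isZmodMorphism.Build log_group (vgroup v) log_value log_value_zmod_morphism.

Lemma log_value_surj g : exists x, log_value x = g.
Proof.
have [x x0 xg] := val_surj g.
have [y [y0 yx [b Kb yb]]] := log_derivative_lift mon hens Klift x0.
have py : y \in log_pred by apply/andP; split=> //; apply/asboolP; rewrite yb mulfK.
by exists (LogGroup py); rewrite /log_value /= yx.
Qed.

End LogarithmicGroup.

Section LinearSurjectivity.
Variables (k : diffField) (G : oagType) (c : G -> k) (M : valuedDiffField).
Variables (L : lifting c M) (mon : monotone M) (zeros : zeros_of_linear_residue M).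
Local Notation v := (vdf_val M).
Local Notation O := (valring_pred v).
Local Notation m := (maxideal_pred v).

(** The equation is lifted and solved in the valuation ring. The residue of the solution solves it
    exactly, since a lifted element that is infinitesimal vanishes. *)
Lemma lifting_linearly_surjective : linearly_surjective k.
Proof.
move=> A A0 b.
pose W : {mpoly M[size A]} := \sum_(i < size A) rep L A`_i *: 'X_i - (rep L b)%:MP.
have Wk j : W@_j = \sum_(i < size A) rep L A`_i * (U_(i)%MM == j)%:R - rep L b * (j == 0%MM)%:R.
  rewrite mcoeffB mcoeffC (raddf_sum (mcoeff j)) /=; congr (_ - _).
  by apply: eq_bigr => i _; rewrite mcoeffZ mcoeffX.
have ON n : (n%:R : M) \in O by exact: rpred_nat.
have sA : (0 < size A)%N by rewrite lt0n size_poly_eq0.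
have lA : ((size A).-1 < size A)%N by rewrite prednK.
have [|j j1||z Oz Ez] := zeros (W := W).
- move=> j; rewrite Wk rpredB ?rpredM ?rep_O //.
  by apply: rpred_sum => i _; rewrite rpredM ?rep_O.
- rewrite Wk (_ : (j == 0%MM) = false) ?mulr0 ?subr0; last first.
    by apply/eqP => j0; rewrite j0 mdeg0 in j1.
  rewrite big1 ?maxideal0 // => i _; case: eqP => [E|]; last by rewrite mulr0.
  by rewrite -E mdeg1 in j1.
- exists (Ordinal lA); rewrite Wk (bigD1 (Ordinal lA)) //= eqxx mulr1 big1 => [|i ne]; last first.
    by rewrite eq_mnm1 (negbTE ne) mulr0.
  rewrite mnm1_eq0 mulr0 subr0 addr0; apply/negP => /rep_m/eqP.
  by rewrite -lead_coefE lead_coef_eq0 (negbTE A0).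
have [a ma] := rep_residue L Oz; exists a; apply/eqP; rewrite -subr_eq0; apply/eqP.
apply: (rep_m (L := L)).
have dm i : iter i der (z - rep L a) \in m.
  by elim: i => //= i; apply: derm.
move: Ez; rewrite mevalB mevalC raddf_sum /= => /eqP; rewrite subr_eq0 => /eqP Ez.
rewrite raddfB /= -Ez raddf_sum /= -sumrB; apply: maxideal_sum => i _.
rewrite mevalZ mevalXU rmorphM /= -mulrBr maxidealM ?rep_O // -maxidealN opprB.
have := dm i; by rewrite iter_derB rep_iter.
Qed.

End LinearSurjectivity.

(** * The residue lift and the cross-section of the ultrapower *)

Section UltrapowerLifting.
Variables (F : valuedDiffField) (mon : monotone F) (hens : henselian F).
Local Notation v := (vdf_val F).
Local Notation O := (valring_pred v).
Local Notation m := (maxideal_pred v).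
Variable K : gfield der (vunit v).
Hypothesis Klift : forall x, x \in O -> exists2 b, gf_set K b & x - b \in m.
Local Notation A := (gf_type K).
Local Notation E := (log_group K).
Local Notation UM := (upow_vdf F).
Local Notation k := (upow_df (lift_df K)).
Local Notation G := (upow (vgroup v)).

Definition lift_rep : k -> UM := umap (val : A -> F).

Lemma lift_repE (f : nat -> A) : lift_rep (upi f) = upi (fun t => val (f t)).
Proof. exact: umapE. Qed.

Lemma lift_rep_zmod_morphism : zmod_morphism lift_rep.
Proof. exact: (umap_zmod_morphism (val : {additive A -> F})). Qed.

Lemma lift_rep_monoid_morphism : monoid_morphism lift_rep.
Proof.
split; first exact: lift_repE (fun=> 1).
move=> x y; have [f ->] := upi_surj x; have [g ->] := upi_surj y.
by rewrite upiM !lift_repE; apply/esym/upiM.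
Qed.

HB.instance Definition _ := GRing.isZmodMorphism.Build k UM lift_rep lift_rep_zmod_morphism.
HB.instance Definition _ := GRing.isMonoidMorphism.Build k UM lift_rep lift_rep_monoid_morphism.

Variable s : {additive G -> upow E}.
Hypothesis sK : forall a, umap (@log_value F K) (s a) = a.

(** The logarithmic derivative of the cross-section, which lies in [k] by the choice of the group
    [E]. *)
Definition lift_char (a : G) : k := umap (@log_der F K) (s a).

Lemma lift_char_zmod_morphism : zmod_morphism lift_char.
Proof. by move=> a b; rewrite /lift_char raddfB; apply: (umap_zmod_morphism (@log_der F K)). Qed.

HB.instance Definition _ := GRing.isZmodMorphism.Build G k lift_char lift_char_zmod_morphism.

Definition lift_sec (a : G) : UM := umap (val : E -> F) (s a).

Theorem upow_lifting : lifting lift_char UM.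
Proof.
pose R : {rmorphism k -> UM} := lift_rep.
have RE f : R (upi f) = upi (fun t => val (f t)) by exact: lift_repE.
apply: (@Lifting _ _ _ _ R lift_sec).
- move=> x; have [f ->] := upi_surj x.
  by rewrite RE -[LHS]/(uder _) -[@der k _]/(uder _) !upi_der RE.
- move=> x; have [f ->] := upi_surj x => /upi_neq0 f0; rewrite RE.
  have u : ult [set t | vunit v (val (f t))].
    apply: ultS f0 => t /= f0; case: (gf_good (gf_valP (f t))) => // E0.
    by case/eqP: f0; apply: val_inj; rewrite E0 rmorph0.
  split; first by apply/upi_valring; apply: ultS u => t [].
  apply/negP => /upi_maxideal; apply/ult_not; apply: ultS u => t [_ /= /negP].
  exact.
- by rewrite /lift_sec raddf0; exact: umapE.
- move=> a b; rewrite /lift_sec raddfD; have [f ->] := upi_surj (s a).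
  by have [g ->] := upi_surj (s b); rewrite upiD !umapE; apply/esym/upiM.
- move=> a; rewrite /lift_sec /lift_char; have [f ->] := upi_surj (s a).
  rewrite !umapE RE -[LHS]/(uder _) upi_der -[RHS]/(upi _ * upi _ : upow F) upiM.
  by congr upi; apply/funext => t; rewrite /= divfK ?log_neq0.
- move=> a b; rewrite -{2}[a]sK -{2}[b]sK /lift_sec; have [f ->] := upi_surj (s a).
  have [g ->] := upi_surj (s b); rewrite !umapE.
  have vle t : val_le v (val (f t)) (val (g t)) = (log_value (f t) <= log_value (g t)).
    by rewrite /val_le (negbTE (log_neq0 _)) (negbTE (log_neq0 _)).
  apply/idP/idP => [/upi_val_le H|/upi_le H].
    by apply/upi_le; apply: ultS H => t /=; rewrite vle.
  by apply/upi_val_le; apply: ultS H => t /=; rewrite vle.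
move=> x; have [f ->] := upi_surj x => /upi_neq0 f0.
have [h hE] := upi_surj (s (uval v (upi f))).
have vh : ult [set t | v (f t) = v (val (h t))].
  by apply/upiE; rewrite -upi_val -[LHS]sK hE umapE.
(* [h] represents the monomial with the value of [f]. Where the values agree, the quotient of [f] by
   [h] is a unit whose residue is lifted by [K]; the default (0, 0) is used only outside a set of
   the ultrafilter. *)
have /choice[b bP] : forall t, exists b : A * F, f t != 0 -> v (f t) = v (val (h t)) ->
    [/\ b.1 != 0, b.2 \in m & f t = val b.1 * val (h t) * (1 + b.2)].
  move=> t; have [[f0t vf]|nf] := pselect (f t != 0 /\ v (f t) = v (val (h t))); last first.
    by exists (0, 0) => ? ?; case: nf.
  have h0 := log_neq0 (h t).
  have uq : vunit v (f t / val (h t)).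
    apply/vunitE; first by rewrite mulf_neq0 ?invr_eq0.
    by rewrite Defs.valM ?invr_eq0 // valV // vf subrr.
  have [Oq mq] := uq; have [b Kb mb] := Klift Oq.
  have b0 : b != 0 by apply: contraNneq mq => b0; rewrite b0 subr0 in mb.
  have ub : vunit v b by case: (gf_good Kb) => // b00; rewrite b00 eqxx in b0.
  have pb : b \in gf_pred K by apply/asboolP.
  exists (GfType pb, (f t / val (h t) - b) / b) => _ _; split=> /=.
  - by apply: contra_neq b0 => /(congr1 val).
  - by rewrite maxidealMr //; case: (vunitV ub).
  - by field; rewrite h0 b0.
have u := ultI f0 vh.
exists (upi (fun t => (b t).1)), (uval v (upi f)).
split; first by apply/upi_neq0; apply: ultS u => t [/= f0t vf]; have [] := bP t f0t vf.
rewrite /lift_sec hE RE umapE; split.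
  rewrite -[_ * _]/(upi _ * upi _ : upow F) upiM; apply/upi_neq0; apply: ultS u => t [/= f0t vf].
  by have [b0 _ _] := bP t f0t vf; rewrite mulf_neq0 ?log_neq0.
exists (upi (fun t => (b t).2)).
  by apply/upi_maxideal; apply: ultS u => t [/= f0t vf]; have [] := bP t f0t vf.
rewrite -[RHS]/(upi _ * upi _ * (1 + upi _) : upow F) upi1 upiD !upiM.
by apply/upiE; apply: ultS u => t [/= f0t vf]; have [] := bP t f0t vf.
Qed.

End UltrapowerLifting.

Theorem theorem2 (F : valuedDiffField) (Fmon : monotone F) (Fdh : diff_henselian F) :
  exists (k : diffField) (G : oagType) (c : {additive G -> k}),
    linearly_surjective k /\ elementarily_equivalent F (hahn_vdf c).
Proof.
have zF := diff_henselian_zeros Fdh.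
have hens := zeros_henselian Fmon zF.
have [K Klift] := residue_field_lift Fmon hens.
have [s sK] := upow_section (log_value_surj Fmon hens Klift) (@oag_torsion_free _).
have L := upow_lifting Klift sK.
have UM := upow_monotone Fmon; have Uz := upow_zeros zF.
(* Used twice: it is part of the conclusion, and it makes the Hahn field henselian in
   [hahn_tame]. *)
have Uls := lifting_linearly_surjective L UM Uz.
pose c : {additive upow (vgroup (vdf_val F)) -> upow_df (lift_df K)} := lift_char s.
exists (upow_df (lift_df K)), (upow (vgroup (vdf_val F))), c.
split=> // p; apply: (iff_trans (@upow_equivalent F p)).
apply: (@tame_equivalent _ _ _ _ _ L (hahn_lifting c) _ (hahn_tame c Uls) p).
by split=> //; [exact: zeros_henselian | exact: upow_countably_complete].
Qed.
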